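(* Let $G$ be a chordal graph on $n$ vertices and $m$ edges and let $k$ be a positive integer. Then one can decide whether $\mathrm{MinHLT}(G)\le n-k$ in $O(n^2) + 2^{O(k^2)}$ time and $O(n^2)$ space. Moreover, if this inequality holds, a DFS tree of $G$ of height at most $n-k$ can be returned within the same time and space bounds.
   Context: All graphs are simple, finite, undirected and connected. A graph is chordal if it has no induced cycle of length at least four. A DFS tree of a connected graph $G$ is a spanning tree of $G$ with a root such that for every edge $uv\in E(G)$, $u$ and $v$ are in an ancestor–descendant relationship; the height of a rooted tree is the number of vertices on a longest root-to-leaf path. $\mathrm{MinHLT}(G)$ denotes the minimum height of a DFS tree of $G$. *)

(* Defs.v *)
From mathcomp Require Import all_boot.

Set Implicit Arguments.
Unset Strict Implicit.
Unset Printing Implicit Defensive.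

(** * Graphs and DFS trees *)

Record sgraph (V : finType) := SGraph {
  adj :> rel V;
  adj_sym : symmetric adj;
  adj_irrefl : irreflexive adj
}.

Section Graphs.
Variables (V : finType) (G : sgraph V).

(* A connected graph is nonempty. *)
Definition connected_graph : Prop :=
  0 < #|V| /\ forall u v : V, connect G u v.

Definition induced_cycle (c : seq V) : bool :=
  [&& 2 < size c, uniq c, cycle G c &
      all2rel (fun u v => G u v ==> (v == next c u) || (u == next c v)) c].

Definition chordal : Prop := forall c : seq V, induced_cycle c -> size c < 4.

(* A rooted tree on all of [V], given by parent pointers; the root is its own
   parent. *)
Definition rtree : finType := (V * {ffun V -> V})%type.
Definition root (T : rtree) : V := T.1.
Definition parent (T : rtree) : V -> V := T.2.

(* [u] is an ancestor of [v]; every vertex is an ancestor of itself. *)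
Definition ancestor (T : rtree) (u v : V) : bool := fconnect (parent T) v u.

Definition spanning_tree (T : rtree) : bool :=
  [&& parent T (root T) == root T,
      [forall v, (v != root T) ==> G v (parent T v)] &
      [forall v, ancestor T (root T) v]].

Definition dfs_tree (T : rtree) : bool :=
  spanning_tree T &&
  [forall u, forall v, G u v ==> ancestor T u v || ancestor T v u].

Definition leaf (T : rtree) (v : V) : bool :=
  [forall u, (parent T u == v) ==> (u == v)].

(* The vertices of the path from the root to [v] are the ancestors of [v]. *)
Definition height (T : rtree) : nat :=
  \max_(v | leaf T v) #|[set u | ancestor T u v]|.

(* The default value #|V| is never smaller than a height, and a connected graph
   has a DFS tree, so that for connected [G] this is the actual minimum. *)
Definition MinHLT : nat := \big[minn/#|V|]_(T : rtree | dfs_tree T) height T.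

End Graphs.

(** * A word RAM

    Structured programs over random-access memory.  A program text mentions
    finitely many arrays, named by natural numbers; a scalar variable is an array
    used at index 0 only.  Unwritten cells contain 0. *)

Definition store := nat -> nat -> nat.

Definition upd (m : store) (a i x : nat) : store :=
  fun b j => if (b == a) && (j == i) then x else m b j.

Inductive binop := Add | Sub | Mul | Div | Mod | Eq | Lt.

Definition binop_eval (o : binop) (x y : nat) : nat :=
  match o with
  | Add => x + y
  | Sub => x - y
  | Mul => x * y
  | Div => x %/ y
  | Mod => x %% y
  | Eq => x == y
  | Lt => x < y
  end.

Inductive expr :=
  | Const of nat
  | Get of nat & expr
  | Bin of binop & expr & expr.

Inductive cmd :=
  | Skip
  | Put of nat & expr & expr
  | Seq of cmd & cmd
  | If of expr & cmd & cmd
  | While of expr & cmd.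

Fixpoint expr_cost (e : expr) : nat :=
  match e with
  | Const _ => 1
  | Get _ e => (expr_cost e).+1
  | Bin _ e1 e2 => (expr_cost e1 + expr_cost e2).+1
  end.

Section Semantics.
(* Execution gets stuck as soon as a computed or loaded value is not below
   [bound] (a machine word holds a number less than [bound]), or an index is not
   below [space].  A program with [r] arrays that does not get stuck thus uses at
   most [r * space] words, where [r] is a constant depending on the program
   only. *)
Variables (bound space : nat).

Definition word (x : nat) : option nat := if x < bound then Some x else None.

Fixpoint eval (m : store) (e : expr) : option nat :=
  match e with
  | Const x => word x
  | Get a e =>
      if eval m e is Some i then
        if i < space then word (m a i) else None
      else None
  | Bin o e1 e2 =>
      if eval m e1 is Some x then
        if eval m e2 is Some y then word (binop_eval o x y) else None
      else None
  end.

(* [exec c m t m']: started in memory [m], [c] terminates in memory [m'] after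
   [t] elementary steps.  The semantics is deterministic. *)
Inductive exec : cmd -> store -> nat -> store -> Prop :=
  | ExecSkip m : exec Skip m 1 m
  | ExecPut a e1 e2 m i x :
      eval m e1 = Some i -> i < space -> eval m e2 = Some x ->
      exec (Put a e1 e2) m (expr_cost e1 + expr_cost e2).+1 (upd m a i x)
  | ExecSeq c1 c2 m1 m2 m3 t1 t2 :
      exec c1 m1 t1 m2 -> exec c2 m2 t2 m3 ->
      exec (Seq c1 c2) m1 (t1 + t2) m3
  | ExecIf e c1 c2 m m' x t :
      eval m e = Some x -> exec (if x != 0 then c1 else c2) m t m' ->
      exec (If e c1 c2) m (expr_cost e + t).+1 m'
  | ExecWhileDone e c m :
      eval m e = Some 0 ->
      exec (While e c) m (expr_cost e).+1 m
  | ExecWhileStep e c m1 m2 m3 x t1 t2 :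
      eval m1 e = Some x -> x != 0 ->
      exec c m1 t1 m2 -> exec (While e c) m2 t2 m3 ->
      exec (While e c) m1 (expr_cost e + t1 + t2).+1 m3.

End Semantics.

(** * Input and output conventions *)

(* Array 0 holds [n] and [k]; array 1 holds the adjacency matrix, row by row. *)
Definition input (n : nat) (G : sgraph 'I_n) (k : nat) : store :=
  fun a i =>
    match a, i with
    | 0, 0 => n
    | 0, 1 => k
    | 1, _ => [exists u : 'I_n, exists v : 'I_n, (i == u * n + v) && G u v]
    | _, _ => 0
    end.

(* Cell 0 of array 2 holds the answer, 1 for yes and 0 for no. *)
Definition answers (m : store) (b : bool) : Prop := m 2 0 = b.

(* Cell 1 of array 2 holds the root, and array 3 the parent of each vertex. *)
Definition returns_tree (n : nat) (m : store) (T : rtree 'I_n) : Prop :=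
  m 2 1 = root T /\ forall v : 'I_n, m 3 v = parent T v.

(* Main.v *)
From mathcomp Require Import all_boot fingroup perm.
From mathcomp Require Import zify.
Require Import Defs.

Set Implicit Arguments.
Unset Strict Implicit.
Unset Printing Implicit Defensive.

(* A tree whose parent pointers lead to the latest earlier neighbour in some
   vertex order is a DFS tree as soon as its ancestor relation covers all edges;
   for a maximum cardinality search of a chordal graph this holds, because the
   earlier neighbours of each vertex form a clique.

   Let [v] be the last vertex of such an order with at least [k + 1] descendants
   and let the bag be the clique of [v] and its earlier neighbours.  No component
   of the rest meets both a subtree below a child of [v], of size at most [k],
   and the part outside the subtree of [v], so if at least [2 k] vertices are
   outside the bag, a second search that starts with the bag yields a tree of
   height at most [n - k].

   Otherwise the graph is a clique [S] plus [q < 2 k] vertices.  All of [S] lies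
   on one root-to-leaf path of any DFS tree of height at most [n - k].  At most
   [5 k] vertices of [S] matter: the others can be removed and reinserted, in any
   order, as one segment of that path, and the heights change accordingly because
   each removed vertex has [k] vertices of [S] below it.  So a solution is given
   by a tree on [5 k + q] vertices and a place in it.  Swapping twins, these
   vertices can be taken in a set of size [2^O(k)] with [5 k + q]
   representatives of every neighbourhood outside [S]; there are [2^O(k^2)]
   candidates, each checked in time linear in [n]. *)
(* [lia] splits cases on boolean hypotheses, hence the reduced context. *)
Ltac nlia := repeat match goal with
  | H : context [nat_of_bool] |- _ => clear H
  | x := _ : bool |- _ => clearbody x
  | H : ?P |- _ => lazymatch P with
      is_true (leq _ _) => fail
    | is_true (leq _ _ && leq _ _) => fail
    | @eq nat _ _ => fail
    | _ => clear H end
  end; lia.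

(** * Trees of latest earlier neighbours *)

(** Trees are handled as lists of numbers throughout. When ancestors are listed first, the earlier
    neighbours of a vertex of a DFS tree are ancestors of it, and the last of them is its parent; so
    the list alone determines the tree, and a machine can recompute and check it.

    The exponent [k^2] comes from [2^O(k)] choices for each of the [O(k)] entries of a certificate.
    Enough twins must be kept for one to be free whenever an entry has to be exchanged, hence as
    many representatives of a neighbourhood as a certificate has entries.

    Checking all candidates costs a product of [n] and a number [W] in [2^O(k^2)]; the additive
    bound follows from [n W <= n^2 + W^2]. *)

Section LatestNeighbour.
Variable e : rel nat.

(** The default [j] makes a vertex without earlier neighbours its own parent, so [par j < j] singles
    out the vertices that are not roots. *)
Fixpoint latest (j i : nat) : nat :=
  if i is i'.+1 then (if e i' j then i' else latest j i') else j.

Definition par (j : nat) : nat := latest j j.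

(** Parents do not increase, so a path from [j] is stationary after at most [j] steps and [j.+1]
    terms of the trajectory contain all ancestors. *)
Definition anc (i j : nat) : bool := i \in traject par j j.+1.

Definition depth (N j : nat) : nat := \sum_(i < N) anc i j.

Definition rooted (N : nat) : Prop := forall j, 0 < j < N -> par j < j.

Definition dfs_order (N : nat) : Prop :=
  forall i j, i < j < N -> e i j -> anc i j.

Lemma latestP j i :
  (latest j i = j /\ forall l, l < i -> ~~ e l j) \/
  [/\ latest j i < i, e (latest j i) j &
      forall l, l < i -> e l j -> l <= latest j i].
Proof.
elim: i => [|i IHi] /=; first by left.
case: ifP => eij; first by right; split=> // l; rewrite ltnS.
case: IHi => [[-> noe]|[lt_i el max_i]].
  left; split=> // l; rewrite ltnS leq_eqVlt => /orP[/eqP->|/noe//].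
  by rewrite eij.
right; split=> // [|l]; first exact: leqW.
rewrite ltnS leq_eqVlt => /orP[/eqP->|]; [by rewrite eij | exact: max_i].
Qed.

Lemma par_le j : par j <= j.
Proof. by rewrite /par; case: (latestP j j) => [[->]|[/ltnW]]. Qed.

Lemma par_edge j : par j < j -> e (par j) j.
Proof. by rewrite /par; case: (latestP j j) => [[->]|[]//]; rewrite ltnn. Qed.

Lemma par_max i j : i < j -> e i j -> i <= par j < j.
Proof.
rewrite /par => lij eij.
case: (latestP j j) => [[_ /(_ i lij)]|[-> _ /(_ i lij eij) ->//]].
by rewrite eij.
Qed.

Lemma par_eq i j : i < j -> e i j -> (forall l, i < l < j -> ~~ e l j) ->
  par j = i.
Proof.
move=> lij eij max_i; have /andP[le_i lt_j] := par_max lij eij.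
have e_par := par_edge lt_j; apply/eqP; rewrite eqn_leq le_i andbT leqNgt.
by apply/negP => lt_i; move: (max_i (par j)); rewrite lt_i lt_j e_par => /(_ isT).
Qed.

Lemma iter_par_le t j : iter t par j <= j.
Proof. by elim: t => //= t IHt; apply: leq_trans (par_le _) IHt. Qed.

Lemma ancP i j : reflect (exists t, iter t par j = i) (anc i j).
Proof.
apply: (iffP trajectP) => [[t _ ->]|[t <-]]; first by exists t.
suff [s le_s ->] : exists2 s, s <= j & iter t par j = iter s par j.
  by exists s.
elim: t j => [|t IHt] j; first by exists 0.
rewrite iterSr; have := par_le j; rewrite leq_eqVlt => /orP[/eqP Ej|lt_j].
  by rewrite Ej; apply: IHt.
have [s le_s ->] := IHt (par j); exists s.+1; last by rewrite iterSr.
exact: leq_ltn_trans le_s lt_j.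
Qed.

Lemma ancxx i : anc i i. Proof. by apply/ancP; exists 0. Qed.

Lemma anc_le i j : anc i j -> i <= j.
Proof. by case/ancP=> t <-; apply: iter_par_le. Qed.

(** The guard turns this into a recursion on [j]; the program fills its ancestor matrix by the same
    rule. *)
Lemma ancE i j : anc i j = (i == j) || (par j < j) && anc i (par j).
Proof.
apply/ancP/idP => [[[|t]]|/orP[/eqP->|/andP[_ /ancP[t <-]]]].
- by move=> /= ->; rewrite eqxx.
- rewrite iterSr => <-; have := par_le j; rewrite leq_eqVlt => /orP[/eqP Ej|->].
    rewrite Ej ltnn orbF; apply/eqP.
    by elim: t => //= t ->.
  by apply/orP; right; apply/ancP; exists t.
- by exists 0.
- by exists t.+1; rewrite iterSr.
Qed.

Lemma anc_par j : anc (par j) j.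
Proof. by apply/ancP; exists 1. Qed.

Lemma anc_trans a b c : anc a b -> anc b c -> anc a c.
Proof.
by move=> /ancP[s <-] /ancP[t <-]; apply/ancP; exists (s + t); rewrite iterD.
Qed.

Lemma anc_chain a b c : anc a c -> anc b c -> a <= b -> anc a b.
Proof.
elim/ltn_ind: c => c IHc; rewrite (ancE a) (ancE b).
case/predU1P=> [->|/andP[lt_c ac]]; case/predU1P=> [->|/andP[lt_bc bc]] le_ab.
- exact: ancxx.
- by have:= anc_le bc; lia.
- by rewrite ancE lt_c ac orbT.
- exact: (IHc _ lt_c).
Qed.

Lemma anc_proper i j : anc i j -> i < j -> par j < j /\ anc i (par j).
Proof. by rewrite ancE => /predU1P[->|/andP[]//]; rewrite ltnn. Qed.

Lemma anc_child i j : anc i j -> i < j ->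
  exists2 c, i < c & par c = i /\ anc c j.
Proof.
elim/ltn_ind: j => j IHj aij lt_ij; have [lt_j aip] := anc_proper aij lt_ij.
case: (ltngtP i (par j)) (anc_le aip) => // [lt_ip|Ei] _.
  have [c lt_c [Ec ac]] := IHj _ lt_j aip lt_ip.
  by exists c => //; split=> //; apply: anc_trans ac (anc_par j).
by exists j => //; split=> //; apply: ancxx.
Qed.

Lemma root_anc N j : rooted N -> j < N -> anc 0 j.
Proof.
move=> rN; elim/ltn_ind: j => -[|j] IHj lt_j; first exact: ancxx.
have lt_p := rN j.+1 lt_j; rewrite ancE lt_p IHj ?orbT //.
exact: ltn_trans lt_j.
Qed.

(* The latest-neighbour tree of a (reversed) perfect elimination order is a DFS
   tree: the earlier neighbours of a vertex form a clique, hence move up along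
   the parent pointers. *)
Definition peo (N : nat) : Prop :=
  forall a b c, a < b -> b < c -> c < N -> e a c -> e b c -> e a b.

(** If [par u] is not [w], both are earlier neighbours of [u], hence adjacent, and induction
    continues at [par u]. The second conclusion later shows that [w] is in the bag of a center lying
    between [w] and [u]. *)
Lemma peo_up N w u : peo N -> w < u < N -> e w u ->
  anc w u /\ forall i, anc i u -> w < i -> e w i.
Proof.
move=> pN; elim/ltn_ind: u => u IHu /andP[lt_wu lt_u] ewu.
have /andP[le_wp lt_p] := par_max lt_wu ewu.
have eq_or_lt: w = par u \/ w < par u by lia.
case: eq_or_lt => [->|lt_wp].
  split=> [|i]; first exact: anc_par.
  rewrite ancE => /predU1P[-> _|/andP[_ /anc_le]]; [exact: par_edge | lia].
have ewp : e w (par u) by apply: pN ewu (par_edge lt_p).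
have [|awp Hi] := IHu _ lt_p _ ewp; first by rewrite lt_wp; lia.
split=> [|i]; first by apply: anc_trans awp (anc_par u).
by rewrite ancE => /predU1P[->|/andP[_ /Hi]].
Qed.

Lemma peo_dfs N : peo N -> dfs_order N.
Proof. by move=> pN i j lij eij; case: (peo_up pN lij eij). Qed.

End LatestNeighbour.

Lemma latest_ext e e' j i : (forall l, l < i -> e l j = e' l j) ->
  latest e j i = latest e' j i.
Proof.
elim: i => //= i IHi He; rewrite He // IHi // => l ll; apply: He; exact: leqW.
Qed.

Lemma par_ext e e' N j : (forall a b, a < b < N -> e a b = e' a b) -> j < N ->
  par e j = par e' j.
Proof. by move=> He lj; apply: latest_ext => l ll; apply: He; rewrite ll. Qed.

Lemma anc_ext e e' N i j : (forall a b, a < b < N -> e a b = e' a b) -> j < N ->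
  anc e i j = anc e' i j.
Proof.
move=> He; elim/ltn_ind: j => j IHj lj.
rewrite ancE [RHS]ancE (par_ext He lj); case: ltnP => //= lp.
by rewrite IHj //; apply: ltn_trans lj.
Qed.

Lemma depth_ext e e' N M j : (forall a b, a < b < N -> e a b = e' a b) ->
  j < N -> depth e M j = depth e' M j.
Proof. by move=> He lj; apply: eq_bigr => i _; rewrite (anc_ext _ He). Qed.

(** * Maximum cardinality search on chordal graphs *)

(** The cycle is [p 0, ..., p r], so [2 < r] means length at least four. *)
Definition hole_free (e : rel nat) (N : nat) : Prop :=
  forall r (p : nat -> nat), 2 < r ->
    (forall i, i <= r -> p i < N) ->
    (forall i j, i < j <= r -> p i != p j) ->
    (forall i j, i < j <= r ->
       e (p i) (p j) = (j == i.+1) || (i == 0) && (j == r)) -> False.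

(* The property of maximum cardinality search used by Tarjan and Yannakakis. *)
Definition mcs_order (e : rel nat) (N : nat) : Prop :=
  forall a b c, a < b -> b < c -> c < N -> e a c -> ~~ e a b ->
    exists2 d, d < b & e d b && ~~ e d c.

Section McsPeo.
Variables (e : rel nat) (N : nat).
Hypotheses (e_sym : symmetric e) (eP : mcs_order e N) (eH : hole_free e N).

Definition chordless (r : nat) (p : nat -> nat) : Prop :=
  forall i j, i < j <= r -> e (p i) (p j) = (j == i.+1).

Lemma chordless_rev r p : chordless r p -> chordless r (fun i => p (r - i)).
Proof.
by move=> cp i j lij; rewrite e_sym cp; last lia; apply/eqP/eqP; lia.
Qed.

(* Tarjan and Yannakakis: no chordless path has its inner vertices later than
   both ends.  The search property at the later end [p r] gives a vertex [x]
   that either closes a hole or ends another such path with earlier ends. *)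
Lemma no_late_path m r p : 1 < r -> chordless r p -> p 0 < p r -> p r <= m ->
  (forall i, 0 < i < r -> p r < p i < N) -> False.
Proof.
elim: m r p => [|m IHm] r p lt_r cp lt_0r le_rm late; first by lia.
have /andP[lt_r1 lt_1N] : p r < p 1 < N by apply: late.
have [||x lt_x] := eP lt_0r lt_r1 lt_1N; rewrite ?cp //; try by lia.
move=> /andP[exr nex1].
(* Cut the path at the first neighbour of [x] after [p 0]. Since [x] misses [p 1], the cut is beyond
   [p 1]. *)
have ex_j : exists j, (0 < j) && e x (p j) by exists r; rewrite exr; lia.
case: (ex_minnP ex_j) => j /andP[lt_0j exj] min_j.
have lt_1j : 1 < j.
  by case: (ltngtP j 1) nex1 exj => // [|->]; [lia | case: (e _ _)].
have le_jr : j <= r by apply: min_j; rewrite exr; lia.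
have nexi i : 0 < i < j -> e (p i) x = false.
  move=> /andP[lt0i ltij]; rewrite e_sym; apply/negbTE/negP => exi.
  by have:= min_j i; rewrite lt0i exi => /(_ isT); lia.
have late_r i : 0 < i <= r -> p r <= p i < N.
  move=> /andP[i_gt0]; rewrite leq_eqVlt => /predU1P[->|lir]; first by lia.
  by have/andP[/ltnW-> ->] : p r < p i < N by apply: late; rewrite i_gt0.
have nx0 : x != p 0.
  by apply: contraTneq exr => ->; rewrite cp; lia.
pose p' i := if i <= j then p i else x.
have p'_le i : i <= j -> p' i = p i by rewrite /p' => ->.
have p'_j : p' j.+1 = x by rewrite /p' ltnn.
(* If [x] sees [p 0], then [p 0, ..., p j, x] is a hole; otherwise it is a chordless path with both
   ends before [p r]. *)
case e0x : (e (p 0) x).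
  apply: (eH (r := j.+1) (p := p')) => // [i le_i|i l|i l].
  - case: (ltngtP i j.+1) le_i => // [lt_i _|-> _]; last by rewrite p'_j; lia.
    rewrite p'_le //; case: i lt_i => [|i] lt_i; first by lia.
    by have:= late_r i.+1; lia.
  - move=> /andP[lt_il le_l]; rewrite p'_le; last lia.
    case: (ltngtP l j.+1) le_l => // [lt_l _|El _]; last first.
      rewrite El p'_j; case: i lt_il => [|i] lt_il; first by rewrite eq_sym.
      by have:= late_r i.+1; lia.
    rewrite p'_le //; apply/eqP => Eil.
    case: (ltngtP l r) => [lt_lr|gt_lr|El]; try lia.
      have: e (p i) (p l.+1) by rewrite Eil cp ?eqxx; lia.
      by rewrite cp; lia.
    case: i lt_il Eil => [|i] lt_il; first by rewrite El; lia.
    by rewrite El => Eil; have:= late i.+1; lia.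
  - move=> /andP[lt_il le_l]; rewrite (p'_le i); last lia.
    case: (ltngtP l j.+1) le_l => // [lt_l _|El _]; last first.
      rewrite El p'_j; case: (posnP i) => [->|i_gt0]; first by rewrite e0x; lia.
      case: (ltngtP i j) => [lij|lij|->]; try lia.
        by rewrite nexi; lia.
      by rewrite e_sym exj; lia.
    by rewrite p'_le // cp; lia.
have cp' : chordless j.+1 p'.
  move=> i l /andP[lt_il le_l]; rewrite (p'_le i); last lia.
  case: (ltngtP l j.+1) le_l => // [lt_l _|El _]; last first.
    rewrite El p'_j; case: (posnP i) => [->|i_gt0]; first by rewrite e0x; lia.
    case: (ltngtP i j) => [lij|lij|->]; try lia.
      by rewrite nexi; lia.
    by rewrite e_sym exj; lia.
  by rewrite p'_le // cp; lia.
have late' i : 0 < i < j.+1 -> x < p' i /\ p 0 < p' i /\ p' i < N.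
  by move=> li; rewrite p'_le; [have:= late_r i|]; lia.
(* The induction hypothesis wants the earlier end first, so the path is reversed if that end is
   [x]. *)
case: (ltngtP x (p 0)) nx0 => // [lt_x0|lt_0x] _.
  apply: (IHm j.+1 (fun i => p' (j.+1 - i))); rewrite ?subn0 ?subnn ?p'_j ?p'_le //.
  - exact: chordless_rev.
  - lia.
  - by move=> i li; have := late' (j.+1 - i); lia.
apply: (IHm j.+1 p'); rewrite ?subn0 ?subnn ?p'_j ?p'_le //.
- lia.
- by move=> i li; have := late' i; lia.
Qed.

Lemma mcs_peo : peo e N.
Proof.
move=> a b c lab lbc lcN eac ebc; apply/negPn/negP => neab.
(* If [a] and [b] were not adjacent, [a, c, b] would be a chordless path whose inner vertex is
   latest. *)
pose p i := if i == 0 then a else if i == 1 then c else b.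
apply: (@no_late_path b 2 p) => //.
- move=> [|[|i]] [|[|[|j]]] //=; rewrite /p /= ?eac ?(negbTE neab) //; try lia.
  by rewrite e_sym ebc.
- by case=> [|[|i]] //= _; rewrite /p /= lbc lcN.
Qed.

End McsPeo.

(** * Adjacency of numbers, and holes in chordal graphs *)

Section Chordal.
Variables (n : nat) (G : sgraph 'I_n).

(** Adjacency on numbers, false outside the graph, because memory cells, orders and certificates
    contain numbers rather than ordinals. *)
Definition gadj (a b : nat) : bool :=
  [exists u : 'I_n, exists v : 'I_n, [&& a == u, b == v & G u v]].

Lemma gadjE (u v : 'I_n) : gadj u v = G u v.
Proof.
apply/existsP/idP => [[u' /existsP[v' /and3P[/eqP Eu /eqP Ev]]]|Guv].
  by rewrite (ord_inj Eu) (ord_inj Ev).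
by exists u; apply/existsP; exists v; rewrite !eqxx.
Qed.

Lemma gadj_lt a b : gadj a b -> a < n /\ b < n.
Proof.
by case/existsP=> u /existsP[v /and3P[/eqP-> /eqP-> _]]; rewrite !ltn_ord.
Qed.

Lemma gadj_sym : symmetric gadj.
Proof.
suff H a b : gadj a b -> gadj b a by move=> a b; apply/idP/idP; apply: H.
move=> gab; have [la lb] := gadj_lt gab.
by move: gab; rewrite (gadjE (Ordinal la) (Ordinal lb))
  (gadjE (Ordinal lb) (Ordinal la)) adj_sym.
Qed.

Lemma gadj_irr a : gadj a a = false.
Proof.
case gaa: (gadj a a) => //; have [la _] := gadj_lt gaa.
by move: gaa; rewrite (gadjE (Ordinal la) (Ordinal la)) adj_irrefl.
Qed.

Lemma input_adj k a b : a < n -> b < n -> input G k 1 (a * n + b) = gadj a b.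
Proof.
move=> la lb /=; congr nat_of_bool.
rewrite (gadjE (Ordinal la) (Ordinal lb)).
apply/existsP/idP => [[u /existsP[v /andP[/eqP Euv]]]|Gab]; last first.
  by exists (Ordinal la); apply/existsP; exists (Ordinal lb); rewrite eqxx.
have [lu lv] := (ltn_ord u, ltn_ord v).
have Eu : a = u by have := congr1 (divn^~ n) Euv; rewrite /= !divnMDl ?divn_small //; lia.
have Ev : b = v by move: Euv; rewrite Eu; lia.
by congr (G _ _); apply: val_inj.
Qed.

Lemma chordal_hole_free : chordal G -> hole_free gadj n.
Proof.
move=> chG r p lt_r lt_p inj_p e_p.
pose q (i : nat) : 'I_n := insubd (Ordinal (lt_p 0 isT)) (p i).
have qE i : i <= r -> q i = p i :> nat by move=> li; rewrite /q val_insubd lt_p.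
have Gq i j : i < j <= r -> G (q i) (q j) = (j == i.+1) || (i == 0) && (j == r).
  by move=> lij; rewrite -e_p // -gadjE !qE //; lia.
pose c := mkseq q r.+1.
have szc : size c = r.+1 by rewrite size_mkseq.
have nthc i : i <= r -> nth (q 0) c i = q i by move=> li; rewrite nth_mkseq.
have uq : uniq c.
  apply/(uniqP (q 0)) => i j; rewrite !inE szc !ltnS => li lj.
  rewrite !nthc // => /(congr1 val) /=; rewrite !qE // => Eij.
  case: (ltngtP i j) => // lij; [move: (inj_p i j)|move: (inj_p j i)];
    by rewrite lij Eij eqxx ?li ?lj => /(_ isT).
have nextc i : i <= r -> next c (q i) = q (if i == r then 0 else i.+1).
  move=> li; rewrite -(nthc i) // next_nth mem_nth ?szc // index_uniq ?szc //.
  have -> : c = q 0 :: mkseq (fun i => q i.+1) r.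
    by rewrite /c /mkseq /= (iotaDl 1 0 r) -map_comp.
  case: ifP => [/eqP->|ne_i]; first by rewrite nth_default // size_mkseq.
  by rewrite nth_mkseq //; lia.
have : size c < 4; last by rewrite szc; lia.
apply: chG; apply/and4P; split=> //; first by rewrite szc; lia.
  have -> : c = q 0 :: mkseq (fun i => q i.+1) r.
    by rewrite /c /mkseq /= (iotaDl 1 0 r) -map_comp.
  apply/(pathP (q 0)) => i; rewrite size_rcons size_mkseq ltnS => li.
  rewrite -rcons_cons !nth_rcons /= size_mkseq.
  have -> : nth (q 0) (q 0 :: mkseq (fun i => q i.+1) r) i = q i.
    by case: i li => //= i li; rewrite nth_mkseq.
  case: (ltngtP i r) li => // [lt_i|->] _; rewrite ?ltnS ?(ltnW lt_i) ?leqnn.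
    by rewrite nth_mkseq // Gq ?eqxx //; lia.
  by rewrite adj_sym Gq ?eqxx ?orbT //; lia.
apply/allrelP => x y /(nthP (q 0))[i]; rewrite szc ltnS => li <-.
case/(nthP (q 0))=> j; rewrite szc ltnS => lj <-; rewrite !nthc //.
apply/implyP => Gij; rewrite !nextc //.
case: (ltngtP i j) => [lij|lji|Eij]; last by rewrite Eij adj_irrefl in Gij.
- move: Gij; rewrite Gq; last lia.
  case/orP=> [/eqP Ej|/andP[/eqP-> /eqP->]]; rewrite ?eqxx ?orbT // Ej.
  by have -> : i == r = false; [lia | rewrite eqxx].
- move: Gij; rewrite adj_sym Gq; last lia.
  case/orP=> [/eqP Ej|/andP[/eqP-> /eqP->]]; rewrite ?eqxx ?orbT // Ej.
  by have -> : j == r = false; [lia | rewrite eqxx orbT].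
Qed.

End Chordal.

(** * DFS trees *)

Section TreeOfOrder.
Variables (n : nat) (G : sgraph 'I_n) (X : nat -> nat) (h : nat).
Hypotheses (n_gt0 : 0 < n) (X_lt : forall j, j < n -> X j < n)
  (X_inj : forall i j, i < n -> j < n -> X i = X j -> i = j).
Let e : rel nat := fun i j => gadj G (X i) (X j).
Hypotheses (e_rooted : rooted e n) (e_dfs : dfs_order e n)
  (e_depth : forall j, j < n -> depth e n j <= h).

Let xo (j : 'I_n) : 'I_n := Ordinal (X_lt (ltn_ord j)).
Let po (j : 'I_n) : 'I_n := Ordinal (leq_ltn_trans (par_le e j) (ltn_ord j)).

Lemma xo_inj : injective xo.
Proof. by move=> i j [] /X_inj Eij; apply: val_inj; apply: Eij. Qed.

Let T : rtree 'I_n := (xo (Ordinal n_gt0), [ffun v => xo (po (invF xo_inj v))]).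

Let rootE : root T = xo (Ordinal n_gt0). Proof. by []. Qed.

Let parentE j : parent T (xo j) = xo (po j).
Proof. by rewrite /parent /= ffunE invF_f. Qed.

Let e_gadj i j : e (nat_of_ord i) (nat_of_ord j) = G (xo i) (xo j).
Proof. by rewrite -gadjE. Qed.

Lemma ancestorE i j : ancestor T (xo i) (xo j) = anc e i j.
Proof.
have iterE t : iter t (parent T) (xo j) = xo (iter t po j).
  by elim: t => //= t ->; rewrite parentE.
have valE t : iter t po j = iter t (par e) j :> nat.
  by elim: t => //= t ->.
apply/idP/ancP => [/iter_findex|[t Et]].
  rewrite iterE => /xo_inj Ei.
  by exists (findex (parent T) (xo j) (xo i)); rewrite -valE Ei.
have <- : iter t po j = i by apply: ord_inj; rewrite valE.
by rewrite /ancestor -iterE; apply: fconnect_iter.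
Qed.

(** An injective [X] is a permutation of the vertices, so the pointers [par e] between positions can
    be transported to vertices. *)
Lemma order_dfs_tree : exists T : rtree 'I_n,
  [/\ dfs_tree G T, height T <= h, root T = X 0 :> nat &
      forall j (v : 'I_n), j < n -> v = X j :> nat ->
        parent T v = X (par e j) :> nat].
Proof.
have xoK v : xo (invF xo_inj v) = v by apply: f_invF.
exists T; split=> //.
- apply/andP; split; last first.
    apply/forallP => u; apply/forallP => v; apply/implyP.
    rewrite -(xoK u) -(xoK v) !ancestorE -e_gadj.
    move: (invF _ u) (invF _ v) => i j eij.
    case: (ltngtP i j) => [lij|lji|Eij].
    - by rewrite e_dfs // lij ltn_ord.
    - by rewrite orbC e_dfs // ?lji ?ltn_ord // /e gadj_sym.
    - by rewrite /e Eij gadj_irr in eij.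
  apply/and3P; split.
  - rewrite rootE parentE; apply/eqP; congr xo; apply: val_inj => /=.
    by have := par_le e 0; lia.
  - apply/forallP => v; rewrite -(xoK v); move: (invF _ v) => j.
    apply/implyP; rewrite rootE (inj_eq xo_inj) parentE adj_sym -e_gadj => nj0.
    apply: par_edge; apply: e_rooted; rewrite ltn_ord andbT lt0n.
    by apply: contraNneq nj0 => Ej; apply/eqP/val_inj.
  - apply/forallP => v; rewrite -(xoK v) rootE ancestorE.
    by apply: (@root_anc _ n) => //; apply: ltn_ord.
- apply/bigmax_leqP => v _; apply: leq_trans (e_depth (ltn_ord (invF xo_inj v))).
  rewrite -sum1_card /depth (reindex_inj xo_inj) /= big_mkcond /=.
  apply: leq_sum => i _; rewrite inE -{1}(xoK v) ancestorE.
  by case: anc.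
- move=> j v lj Ev; have -> : v = xo (Ordinal lj) by apply: val_inj.
  by rewrite parentE.
Qed.

End TreeOfOrder.

(** * Minimum height and levels in DFS trees *)

Section MinHeight.
Variables (V : finType) (G : sgraph V).

(** Below [#|V|] the default value of the minimum cannot be the one attained, so an actual tree
    attains it. *)
Lemma MinHLT_leP h : h < #|V| ->
  reflect (exists2 T : rtree V, dfs_tree G T & height T <= h) (MinHLT G <= h).
Proof.
move=> lt_h; apply: (iffP idP) => [|[T dT hT]].
  have [/existsP[T /andP[]]|noT] :=
      boolP [exists T : rtree V, dfs_tree G T && (height T <= h)].
    by exists T.
  rewrite leqNgt => /negP[]; rewrite /MinHLT.
  elim/big_ind: _ => [//|x y lx ly|T dT]; first by rewrite leq_min lx.
  by rewrite ltnNge; apply: contra noT => hT; apply/existsP; exists T; rewrite dT.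
apply: leq_trans hT; rewrite /MinHLT.
elim: (index_enum _) (mem_index_enum T) => // T' s IHs; rewrite inE big_cons.
case/predU1P=> [<-|/IHs le_s]; first by rewrite dT geq_minl.
by case: ifP => // _; apply: leq_trans (geq_minr _ _) le_s.
Qed.

Variable T : rtree V.

Lemma ancestor_refl v : ancestor T v v. Proof. exact: connect0. Qed.

Lemma ancestor_trans u v w : ancestor T u v -> ancestor T v w -> ancestor T u w.
Proof. by move=> uv vw; apply: connect_trans vw uv. Qed.

Lemma ancestor_parent v : ancestor T (parent T v) v.
Proof. exact: fconnect1. Qed.

Lemma ancestor_iter u v : ancestor T u v -> exists t, iter t (parent T) v = u.
Proof. by move/iter_findex => <-; eexists. Qed.

Lemma ancestorS u v : ancestor T u v -> u != v -> ancestor T u (parent T v).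
Proof.
move=> /ancestor_iter[[|t] <-]; first by rewrite eqxx.
by rewrite iterSr => _; apply: fconnect_iter.
Qed.

Lemma ancestor_chain u v w : ancestor T u w -> ancestor T v w ->
  ancestor T u v || ancestor T v u.
Proof.
have H s t : s <= t ->
    ancestor T (iter t (parent T) w) (iter s (parent T) w).
  by move=> le_st; rewrite -(subnK le_st) iterD; apply: fconnect_iter.
move=> /ancestor_iter[s <-] /ancestor_iter[t <-].
by case/orP: (leq_total s t) => /H ->; rewrite ?orbT.
Qed.

Hypothesis dT : dfs_tree G T.

Lemma dfs_root : parent T (root T) = root T.
Proof. by case/andP: dT => /and3P[/eqP]. Qed.

Lemma dfs_parent v : v != root T -> G v (parent T v).
Proof. by case/andP: dT => /and3P[_ /forallP/(_ v)/implyP]. Qed.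

Lemma dfs_root_ancestor v : ancestor T (root T) v.
Proof. by case/andP: dT => /and3P[_ _ /forallP]. Qed.

Lemma dfs_comparable u v : G u v -> ancestor T u v || ancestor T v u.
Proof. by case/andP: dT => _ /forallP/(_ u)/forallP/(_ v)/implyP. Qed.

(** Otherwise the parent pointers have a cycle through [v]. Going around it often enough takes at
    least the number of steps from [v] to the root, where the walk stays; so [v] is the root. *)
Lemma ancestor_anti u v : ancestor T u v -> ancestor T v u -> u = v.
Proof.
move=> /ancestor_iter[s Es] /ancestor_iter[t Et].
have cyc : iter (t + s) (parent T) v = v by rewrite iterD Es Et.
have [ts0|] := posnP (t + s); first by move: Es; rewrite (_ : s = 0) //; lia.
move=> ts_gt0; have [r Er] := ancestor_iter (dfs_root_ancestor v).
have iter_v m : iter (m * (t + s)) (parent T) v = v.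
  by elim: m => //= m IHm; rewrite mulSn iterD IHm.
have iter_root m : iter m (parent T) (root T) = root T.
  by elim: m => //= m ->; apply: dfs_root.
have Ev : v = root T.
  have le_r : r <= r * (t + s) by rewrite leq_pmulr.
  by rewrite -(iter_v r) -(subnK le_r) iterD Er iter_root.
by move: Es; rewrite Ev iter_root.
Qed.

Definition level (v : V) : nat := #|[set u | ancestor T u v]|.

Lemma level_lt u v : ancestor T u v -> u != v -> level u < level v.
Proof.
move=> uv nuv; apply: proper_card; apply/properP; split.
  by apply/subsetP => w; rewrite !inE => wu; apply: ancestor_trans wu uv.
exists v; rewrite inE ?ancestor_refl //.
by apply: contra nuv => vu; apply/eqP/ancestor_anti.
Qed.

(** The height looks at leaves only, but a vertex of maximum level is a leaf, since a child would
    have a larger level. *)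
Lemma level_height v : level v <= height T.
Proof.
have [w _ max_w] := @arg_maxnP V v xpredT level isT.
have leaf_w : leaf T w.
  apply/forallP => u; apply/implyP => /eqP Ew; apply/negPn/negP => nuw.
  have : level u <= level w := max_w u isT.
  rewrite leqNgt level_lt //; last by rewrite eq_sym.
  by rewrite -Ew ancestor_parent.
apply: leq_trans (max_w v isT) _.
exact: (leq_bigmax_cond (F := level)).
Qed.

End MinHeight.

(** * Orders starting with a bag *)

Section PrefixOrder.
Variables (e : rel nat) (n k i0 : nat) (f : nat -> nat).
Hypotheses (e_sym : symmetric e) (e_peo : peo e n) (lt_i0 : i0 < n).

(** Positions are those of the first order, with center [i0]; [f] sends a position of the second
    order to that of the same vertex in the first. *)
Definition bag (i : nat) : bool := (i == i0) || (i < i0) && e i i0.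

Hypotheses (f_lt : forall j, j < n -> f j < n)
  (f_inj : forall i j, i < n -> j < n -> f i = f j -> i = j)
  (f_bag : forall i j, i < j < n -> bag (f j) -> bag (f i)).
Hypotheses (i0_large : k < \sum_(j < n) anc e i0 j)
  (i0_last : forall c, i0 < c < n -> \sum_(j < n) anc e c j <= k)
  (bag_small : k.*2 + \sum_(i < n) bag i <= n).

Let e2 : rel nat := fun i j => e (f i) (f j).

(* The bag of [i0] separates the subtrees below [i0] from each other and from
   the rest of the graph. *)
Lemma subtree_closed c u w : anc e i0 c ->
    (forall x, anc e x c -> x < c -> x <= i0) ->
    u < n -> w < n -> ~~ bag w -> e u w -> anc e c u -> anc e c w.
Proof.
move=> a0c c_child lu lw nBw euw acu.
case: (ltngtP u w) => [luw|lwu|<- //].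
  have [|auw _] := peo_up (w := u) (u := w) e_peo _ euw; first by rewrite luw.
  exact: anc_trans acu auw.
rewrite e_sym in euw; have [|awu up] := peo_up (w := w) (u := u) e_peo _ euw.
  by rewrite lwu.
case: (leqP c w) => [lcw|lwc]; first exact: anc_chain acu awu lcw.
have awc : anc e w c by apply: anc_chain awu acu (ltnW lwc).
(* A neighbour strictly above [c] is at or above [i0]; by [peo_up] it sees the whole path down to
   [u], in particular [i0], and so is in the bag. *)
have := c_child _ awc lwc; rewrite leq_eqVlt => /predU1P[Ew|lw0].
  by rewrite /bag Ew eqxx in nBw.
by move: nBw; rewrite /bag lw0 up ?orbT //; apply: anc_trans a0c acu.
Qed.

(** The bag comes first in the second order, so the ancestors of [j] outside the bag form the lower
    end of its root path. Consecutive ones are adjacent and thus never leave [Q]. *)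
Lemma avoiding_path (Q : pred nat) :
    (forall u w, u < n -> w < n -> ~~ bag u -> ~~ bag w -> e u w -> Q u -> Q w) ->
  forall j i, j < n -> ~~ bag (f j) -> Q (f j) -> anc e2 i j ->
    ~~ bag (f i) -> Q (f i).
Proof.
move=> Q_closed; elim/ltn_ind=> j IHj i lj nBj Qj.
rewrite ancE => /predU1P[->//|/andP[lp aip]] nBi.
have lpn := ltn_trans lp lj.
have nBp : ~~ bag (f (par e2 j)).
  have := anc_le aip; rewrite leq_eqVlt => /predU1P[<-//|lip].
  by apply: contra nBi; apply: f_bag; rewrite lip.
apply: (IHj _ lp) => //; apply: Q_closed Qj; rewrite ?f_lt //.
by rewrite e_sym; apply: (par_edge lp).
Qed.

Lemma depth_cover (C : pred nat) j :
    (forall i, i < n -> anc e2 i j -> C (f i)) ->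
  depth e2 n j <= \sum_(i < n) C i.
Proof.
move=> C_anc; pose fo (i : 'I_n) : 'I_n := Ordinal (f_lt (ltn_ord i)).
have fo_inj : injective fo.
  by move=> i l [] Eil; apply/ord_inj/f_inj.
rewrite /depth [X in _ <= X](reindex_inj fo_inj) /=; apply: leq_sum => i _.
by have:= C_anc i (ltn_ord i); case: anc => // ->.
Qed.

(** Three cases: a root path inside the bag has at most [n - 2 k] vertices; one that leaves the bag
    outside the subtree of [i0] misses the at least [k] proper descendants of [i0]; one that enters
    the subtree of a child of [i0] has at most [k] vertices besides those of the bag, hence the
    [2 k] in [bag_small]. *)
Lemma prefix_depth j : j < n -> depth e2 n j <= n - k.
Proof.
move=> lj; have [Bj|nBj] := boolP (bag (f j)).
  apply: leq_trans (@depth_cover bag j _) _; last by lia.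
  move=> i li; rewrite ancE => /predU1P[->//|/andP[lp /anc_le lip]].
  by apply: f_bag Bj; rewrite lj andbT; apply: leq_ltn_trans lip lp.
have closed0 u w : u < n -> w < n -> ~~ bag w -> e u w -> anc e i0 u -> anc e i0 w.
  by apply: subtree_closed; [apply: ancxx | move=> x _ /ltnW].
have [a0j|na0j] := boolP (anc e i0 (f j)); last first.
  have C_anc i : i < n -> anc e2 i j -> bag (f i) || ~~ anc e i0 (f i).
    move=> li aij; have [//|nBi] := boolP (bag (f i)) => /=.
    apply: (@avoiding_path (fun u => ~~ anc e i0 u)) aij nBi => //.
    move=> u w lu lw nBu nBw euw; apply: contra; apply: closed0 => //.
    by rewrite e_sym.
  apply: leq_trans (@depth_cover (fun u => bag u || ~~ anc e i0 u) j C_anc) _.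
  (* Only [i0] itself is counted by both sums. *)
  have: \sum_(i < n) (bag i || ~~ anc e i0 i) + \sum_(i < n) anc e i0 i <=
        \sum_(i < n) (1 + (i == Ordinal lt_i0)).
    rewrite -big_split /=; apply: leq_sum => i _.
    have [a0i|_] := boolP (anc e i0 i); last by case: bag.
    rewrite orbF /bag.
    by have:= anc_le a0i; rewrite -val_eqE /=; case: (ltngtP i i0).
  rewrite big_split /= sum_nat_const card_ord muln1.
  have -> : \sum_(i < n) (i == Ordinal lt_i0) = 1.
    rewrite (bigD1 (Ordinal lt_i0)) //= eqxx big1 // => i ne_i.
    by rewrite (negbTE ne_i).
  move=> /=; move: i0_large (\sum_(i < n) (bag i || _)).
  by move: (\sum_(i < n) anc e i0 i) => x lx y; lia.
have lt_0j : i0 < f j.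
  rewrite ltn_neqAle (anc_le a0j) andbT; apply: contraNneq nBj => <-.
  by rewrite /bag eqxx.
have [c lt_c [Ec acj]] := anc_child a0j lt_0j.
have lt_cn : c < n := leq_ltn_trans (anc_le acj) (f_lt lj).
apply: leq_trans (@depth_cover (fun u => bag u || anc e c u) j _) _.
  move=> i li aij; have [//|nBi] := boolP (bag (f i)) => /=.
  apply: (@avoiding_path (anc e c)) aij nBi => //.
  move=> u w lu lw _; apply: subtree_closed => //.
    by rewrite -Ec; apply: anc_par.
  by move=> x axc lxc; have [_] := anc_proper axc lxc; rewrite Ec => /anc_le.
have: \sum_(i < n) (bag i || anc e c i) <=
      \sum_(i < n) bag i + \sum_(i < n) anc e c i.
  by rewrite -big_split /=; apply: leq_sum => i _; case: bag; case: anc.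
by have := i0_last (c := c); rewrite lt_c lt_cn => /(_ isT); lia.
Qed.

End PrefixOrder.

(* Maximum cardinality search; the weight [n] forces the vertices of the clique
   [B] to come first. *)
Section McsSearch.
Variables (g : rel nat) (n : nat) (B : pred nat) (X : nat -> nat).
Hypotheses (g_sym : symmetric g).

Definition weight (j u : nat) : nat := n * B u + \sum_(i < j) g (X i) u.

Definition fresh (j u : nat) : Prop := forall i, i < j -> X i != u.

Hypotheses (X_lt : forall j, j < n -> X j < n)
  (X_inj : forall i j, i < n -> j < n -> X i = X j -> i = j)
  (X_max : forall j u, j < n -> u < n -> fresh j u -> weight j u <= weight j (X j)).

Hypothesis (B_clique : forall u v, u < n -> v < n -> u != v -> B u -> B v -> g u v).

Let e : rel nat := fun i j => g (X i) (X j).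

Lemma count_le j u : \sum_(i < j) g (X i) u <= j.
Proof.
by rewrite -[X in _ <= X]card_ord -sum1_card; apply: leq_sum => i _; case: g.
Qed.

Lemma fresh_later i j : i <= j -> j < n -> fresh i (X j).
Proof.
move=> lij lj l ll; apply/eqP => /X_inj Elj.
by have := Elj (ltn_trans (leq_trans ll lij) lj) lj; lia.
Qed.

(** At step [i] a vertex outside [B] weighs at most [i < n], less than any unvisited vertex of
    [B]. *)
Lemma bag_first i j : i < j < n -> B (X j) -> B (X i).
Proof.
move=> /andP[lij lj] Bj; apply/negPn/negP => /negbTE nBi.
have li := ltn_trans lij lj.
have := X_max li (X_lt lj) (fresh_later (ltnW lij) lj).
by rewrite /weight Bj nBi muln0 muln1; have := count_le i (X i); lia.
Qed.

(** At time [b] the chosen vertex has at least as many visited neighbours as [X c], and [a] counts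
    only for the latter, so some [d] counts only for the former. The bonus for [B] does not
    interfere: if [X b] or [X c] were in [B], then [X a] and [X b] would be, and they would be
    adjacent. *)
Lemma search_mcs : mcs_order e n.
Proof.
move=> a b c lab lbc lc eac neab; have lb := ltn_trans lbc lc.
have la := ltn_trans lab lb.
have nBb : B (X b) = false.
  apply/negbTE; apply: contra neab => Bb; apply: B_clique; rewrite ?X_lt //.
    by apply/eqP => /X_inj; lia.
  by apply: bag_first Bb; rewrite lab.
have nBc : B (X c) = false.
  by apply/negbTE; apply: contraFN nBb; apply: bag_first; rewrite lbc.
have [/existsP[d /andP[edb nedc]]|] :=
  boolP [exists d : 'I_b, e d b && ~~ e d c].
  by exists d; rewrite ?ltn_ord // edb.
move=> /existsPn none.
have := X_max lb (X_lt lc) (fresh_later (ltnW lbc) lc).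
rewrite /weight nBb nBc muln0 !add0n leqNgt => /negP[].
rewrite (bigD1 (Ordinal lab)) //= [X in _ < X](bigD1 (Ordinal lab)) //=.
have -> : g (X a) (X b) = false by apply: negbTE.
have -> : g (X a) (X c) by [].
rewrite add0n add1n ltnS; apply: leq_sum => i _.
by have := none i; rewrite /e; case: g; case: g.
Qed.

(** Some unvisited vertex has a visited neighbour, so the chosen one has positive weight. If that is
    due to [B], then [X 0] is in [B] too and is a neighbour. *)
Lemma search_rooted (G_conn : forall j, 0 < j < n ->
    exists2 i, i < j & exists2 u, u < n & fresh j u /\ g (X i) u) : rooted e n.
Proof.
move=> j lj; have [i lij [u lu [fu giu]]] := G_conn j lj.
have /andP[j_gt0 ljn] := lj.
suff [l llj elj] : exists2 l, l < j & e l j.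
  by have /andP[] := par_max llj elj.
have [Bj|nBj] := boolP (B (X j)).
  exists 0 => //; apply: B_clique; rewrite ?X_lt //; try lia.
    by apply/eqP => /X_inj; lia.
  by apply: bag_first Bj; rewrite j_gt0.
have [/existsP[l elj]|/existsPn none] := boolP [exists l : 'I_j, e l j].
  by exists l.
have := X_max ljn lu fu; rewrite leqNgt => /negP[].
rewrite {1}/weight (negbTE nBj) muln0 big1 => [|l _]; last first.
  by have := none l; rewrite /e; case: g.
by rewrite /weight (bigD1 (Ordinal lij)) //= giu; lia.
Qed.

End McsSearch.

(** * Certificates *)

Section Insertion.
Variable g : rel nat.
Hypothesis g_sym : symmetric g.

Definition seq_adj (x : seq nat) : rel nat := fun i j => g (nth 0 x i) (nth 0 x j).

(* [x] lists the vertices of a DFS tree of height at most [h] after their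
   parents; it starts with the root path of [nth 0 x t]. *)
Record valid (x : seq nat) (t h : nat) : Prop := Valid {
  valid_place : t < size x;
  valid_rooted : rooted (seq_adj x) (size x);
  valid_dfs : dfs_order (seq_adj x) (size x);
  valid_path : forall j, j <= t -> par (seq_adj x) j = j.-1;
  valid_depth : forall j, j < size x -> depth (seq_adj x) (size x) j <= h }.

(* [o] can be inserted into the tree just above [nth 0 x t]. *)
Record fits (x : seq nat) (t o : nat) : Prop := Fits {
  fits_below : g o (nth 0 x t);
  fits_above : 0 < t -> g o (nth 0 x t.-1);
  fits_dfs : forall j, t <= j < size x -> g o (nth 0 x j) -> anc (seq_adj x) t j }.

Definition insert (x : seq nat) (t : nat) (s : seq nat) : seq nat :=
  take t x ++ s ++ drop t x.

Section One.
Variables (x : seq nat) (t h o : nat).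
Hypotheses (vx : valid x t h) (fo : fits x t o).

Let x' := insert x t [:: o].
Let e := seq_adj x.
Let e' := seq_adj x'.
Let lt_t : t < size x := valid_place vx.

Let size_x' : size x' = (size x).+1.
Proof. by rewrite !size_cat size_takel ?size_drop 1?(ltnW lt_t) //=; lia. Qed.

Let nth_lt i : i < t -> nth 0 x' i = nth 0 x i.
Proof. by move=> li; rewrite nth_cat size_takel 1?(ltnW lt_t) // li nth_take. Qed.

Let nth_t : nth 0 x' t = o.
Proof. by rewrite nth_cat size_takel 1?(ltnW lt_t) // ltnn subnn. Qed.

Let nth_bump i : nth 0 x' (bump t i) = nth 0 x i.
Proof.
rewrite /bump; case: leqP => [le_i|/nth_lt //].
rewrite nth_cat size_takel 1?(ltnW lt_t) // ltnNge leqW ?add1n //=.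
by rewrite subSn //= nth_drop subnKC.
Qed.

Let e'_bump i j : e' (bump t i) (bump t j) = e i j.
Proof. by rewrite /e' /seq_adj !nth_bump. Qed.

Let par_lt j : j < t -> par e' j = par e j.
Proof.
move=> lj; apply: (@par_ext _ _ t) => // a b /andP[lab lb].
by rewrite /e' /seq_adj !nth_lt //; apply: ltn_trans lb.
Qed.

Let par_t : par e' t = t.-1.
Proof.
have [->|t_gt0] := posnP t; first by have := par_le e' 0; lia.
apply: par_eq => [||l]; try lia.
rewrite /e' /seq_adj nth_t nth_lt; last lia.
by rewrite g_sym; apply: (fits_above fo).
Qed.

Let par_tS : par e' t.+1 = t.
Proof.
apply: par_eq => // [|l]; last by lia.
have := nth_bump t; rewrite /bump leqnn add1n /e' /seq_adj nth_t => ->.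
exact: (fits_below fo).
Qed.

Let par_path j : j <= t -> par e' j = j.-1.
Proof.
rewrite leq_eqVlt => /predU1P[->|lj]; first exact: par_t.
by rewrite par_lt // (valid_path vx) // ltnW.
Qed.

Let par_gt j : t < j < size x -> par e' j.+1 = bump t (par e j).
Proof.
move=> lj; have lp : par e j < j by apply: (valid_rooted vx); lia.
have Ej : j.+1 = bump t j by rewrite /bump; lia.
apply: par_eq => [||l]; first by rewrite /bump; lia.
  by rewrite Ej e'_bump; apply: par_edge.
move=> ll; have [El|nel] := eqVneq l t.
  (* By [fits_dfs] a neighbour of [o] beyond the place is a proper descendant of the vertex there,
     so its old parent comes after [o] and remains the latest neighbour. *)
  apply/negP; rewrite Ej El /e' /seq_adj nth_t nth_bump => goj.
  have atj : anc e t j by apply: (fits_dfs fo) => //; lia.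
  by have [] := anc_proper atj _; [lia | move=> _ /anc_le; move: ll; rewrite /bump; lia].
have [l' El] : exists l', l = bump t l'.
  by exists (unbump t l); rewrite unbumpKcond (negbTE nel).
apply/negP; rewrite Ej El e'_bump => el'.
have := @par_max e l' j; rewrite el' => H; move: ll; rewrite El /bump.
by case: (ltnP l' j) => [/H/(_ isT)|]; lia.
Qed.

Let bump_lt j : j < t -> bump t j = j.
Proof. by rewrite /bump; lia. Qed.

Let bump_ge j : t <= j -> bump t j = j.+1.
Proof. by rewrite /bump; lia. Qed.

Let bump_eq i j : (bump t i == bump t j) = (i == j).
Proof. by apply/eqP/eqP => [/(can_inj (bumpK t))|->]. Qed.

Let anc_bump i j : j < size x -> anc e' (bump t i) (bump t j) = anc e i j.
Proof.
elim/ltn_ind: j => j IHj lj; rewrite [RHS]ancE.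
case: (ltngtP j t) => [ljt|ltj|Ej].
- rewrite ancE bump_eq (bump_lt ljt) par_lt //.
  case: ltnP => lp //=; rewrite -(IHj _ lp (ltn_trans lp lj)).
  by rewrite (bump_lt (ltn_trans lp ljt)).
- have lp : par e j < j by apply: (valid_rooted vx); lia.
  rewrite ancE bump_eq (bump_ge (ltnW ltj)) par_gt ?ltj // lp.
  rewrite (IHj _ lp (ltn_trans lp lj)) (_ : bump t (par e j) < j.+1) //.
  by rewrite /bump; lia.
- rewrite ancE bump_eq Ej (bump_ge (leqnn t)) par_tS ltnSn /=.
  rewrite ancE (_ : (bump t i == t) = false) /=; last by rewrite /bump; lia.
  rewrite par_t (valid_path vx) //; case: (ltnP t.-1 t) => lt_t1 //=.
  by rewrite -IHj; [rewrite (bump_lt lt_t1) | lia | lia].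
Qed.

Let anc_t j : t <= j < size x -> anc e' t (bump t j) = anc e t j.
Proof.
elim/ltn_ind: j => j IHj /andP[]; rewrite leq_eqVlt => /predU1P[<-|ltj] lj.
  by rewrite (bump_ge (leqnn t)) ancxx -{1}par_tS anc_par.
have lp : par e j < j by apply: (valid_rooted vx); lia.
rewrite ancE [RHS]ancE (bump_ge (ltnW ltj)).
rewrite par_gt ?ltj // lp (_ : bump t (par e j) < j.+1); last by rewrite /bump; lia.
rewrite (ltn_eqF ltj) (ltn_eqF (leqW ltj)) /=.
have [le_p|lt_p] := leqP t (par e j).
  by rewrite IHj //; lia.
by rewrite (bump_lt lt_p); apply/idP/idP => /anc_le; lia.
Qed.

Let anc_path i : i <= t -> anc e' i t.
Proof.
move=> le_i; apply/ancP; exists (t - i).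
have H s : s <= t -> iter s (par e') t = t - s.
  elim: s => [|s IHs] ls; first by rewrite subn0.
  by rewrite iterS IHs 1?ltnW // par_path; lia.
by rewrite H ?leq_subr // subKn.
Qed.

Let bumpP j : j = t \/ exists j', j = bump t j'.
Proof.
have [->|nej] := eqVneq j t; [by left | right].
by exists (unbump t j); rewrite unbumpKcond (negbTE nej).
Qed.

(** [bump t] renumbers the old vertices. Only the vertex at the place changes its parent, to [o],
    which takes over the old one; ancestry among old vertices is unchanged and a root path gains at
    most [o]. *)
Lemma insert1_valid : valid x' t h.+1.
Proof.
split; rewrite ?size_x'.
- exact: ltnW.
- move=> j /andP[j_gt0 lj]; case: (ltngtP j t) => [ljt|ltj|Ejt].
  + by rewrite par_path; lia.
  + case: j ltj {j_gt0} lj => // j; rewrite !ltnS leq_eqVlt => /predU1P[<-|ltj] lj.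
      by rewrite par_tS.
    rewrite par_gt ?ltj //; have : par e j < j by apply: (valid_rooted vx); lia.
    by rewrite /bump; lia.
  + by rewrite Ejt par_t; lia.
- rewrite -/e' => i j lij; case: (bumpP j) => [Ej|[j' Ej]].
    by rewrite Ej => _; apply: anc_path; lia.
  move: lij; rewrite Ej; case: (bumpP i) => [->|[i' ->]] lij.
    rewrite /e' /seq_adj nth_t nth_bump => goj.
    have lj' : t <= j' < size x by move: lij; rewrite /bump; lia.
    by rewrite anc_t //; apply: (fits_dfs fo).
  rewrite -/e' e'_bump => eij; rewrite anc_bump; last by move: lij; rewrite /bump; lia.
  by apply: (valid_dfs vx) => //; move: lij; rewrite /bump; lia.
- exact: par_path.
- have lt_t' : t < (size x).+1 by apply: ltnW.
  have depth_le j j' : j' < size x -> (forall i, anc e' (bump t i) j -> anc e i j') ->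
      depth e' (size x).+1 j <= h.+1.
    move=> lj' Hj; rewrite /depth (bigD1_ord (Ordinal lt_t')) //= -(add1n h).
    apply: leq_add; first by case: anc.
    apply: leq_trans (valid_depth vx lj'); apply: leq_sum => i _.
    by have := Hj i; case: (anc e' _ _) => // ->.
  move=> j lj; case: (bumpP j) => [->|[j' Ej]]; last first.
    have lj' : j' < size x by move: lj; rewrite Ej /bump; lia.
    by apply: (depth_le _ j') => // i; rewrite Ej anc_bump.
  apply: (depth_le _ t) => // i ait; rewrite -anc_bump //.
  apply: anc_trans ait _; rewrite (_ : bump t t = t.+1); last by rewrite /bump leqnn.
  by rewrite -{1}par_tS anc_par.
Qed.

(** The place [t] is now occupied by [o], so the next vertex goes just above [o]. *)
Lemma insert1_fits o' : fits x t o' -> g o' o -> fits x' t o'.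
Proof.
move=> fo' go'o; split; rewrite ?nth_t // ?size_x'.
  by move=> t_gt0; rewrite nth_lt; [apply: fits_above fo' t_gt0 | lia].
move=> j lj; case: (bumpP j) => [->|[j' Ej]]; first by rewrite ancxx.
have lj' : t <= j' < size x by move: lj; rewrite Ej /bump; lia.
by rewrite Ej nth_bump anc_t //; apply: (fits_dfs fo').
Qed.

End One.

(** The last element of [s] goes in first and each other one just above its successor. *)
Lemma insert_valid x t h s : valid x t h -> uniq s -> {in s, forall o, fits x t o} ->
  {in s &, forall o o', o != o' -> g o o'} -> valid (insert x t s) t (h + size s).
Proof.
elim/last_ind: s x h => [|s o IHs] x h vx.
  by rewrite /insert /= cat_take_drop addn0.
rewrite rcons_uniq => /andP[nos us] fs gs.
have lt_t := valid_place vx.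
have -> : insert x t (rcons s o) = insert (insert x t [:: o]) t s.
  rewrite /insert take_size_cat ?size_takel ?drop_size_cat ?size_takel 1?ltnW //.
  by rewrite -cats1 -!catA.
have fo : fits x t o by apply: fs; rewrite mem_rcons mem_head.
rewrite size_rcons -addSnnS; apply: IHs => //.
- exact: insert1_valid.
- move=> o' so'; apply: (insert1_fits vx) => //.
    by apply: fs; rewrite mem_rcons in_cons so' orbT.
  apply: gs; rewrite ?mem_rcons ?mem_head // ?in_cons ?so' ?orbT //.
  by apply: contraNneq nos => <-.
- by move=> a b sa sb; apply: gs; rewrite mem_rcons in_cons ?sa ?sb orbT.
Qed.

End Insertion.

(** * Pruning a DFS tree *)

Lemma subset_of_card (V : finType) (A : {set V}) m : m <= #|A| ->
  exists2 B : {set V}, B \subset A & #|B| = m.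
Proof.
move=> le_m; exists [set v in take m (enum A)].
  by apply/subsetP => v; rewrite inE => /mem_take; rewrite mem_enum.
rewrite cardsE; have /card_uniqP -> := take_uniq m (enum_uniq A).
by rewrite size_takel // -cardE.
Qed.

Section Pruning.
Variables (V : finType) (G : sgraph V) (T : rtree V) (S : {set V}) (k : nat).
Hypotheses (dT : dfs_tree G T)
  (clique : {in S &, forall u v, u != v -> G u v}).

Local Notation above := (ancestor T).
Local Notation lv := (level T).
Let q := #|~: S|.

Definition below (s : V) : {set V} := [set y in S | above s y & y != s].

(* The vertices of [S] whose removal lets their children be reattached to an
   ancestor in [S], and keeps [k] vertices of [S] below each removed one. *)
Definition removable (t : V) : {set V} :=
  [set o in S | [&& o != root T, parent T o \in S, o != t,
    [forall v, (parent T v == o) ==> (v \in S)] & k <= #|below o|]].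

Lemma clique_comparable u v : u \in S -> v \in S -> above u v || above v u.
Proof.
move=> Su Sv; have [->|nuv] := eqVneq u v; first by rewrite ancestor_refl.
exact: dfs_comparable dT _ _ (clique Su Sv nuv).
Qed.

Lemma parent_neq v : v != root T -> parent T v != v.
Proof.
move=> /(dfs_parent dT) Gv; apply/eqP => Ev.
by rewrite Ev adj_irrefl in Gv.
Qed.

(** Vertices of a clique are comparable, so distinct ones are not siblings. *)
Lemma parent_inj_clique : {in S &, forall u v,
  u != root T -> v != root T -> parent T u = parent T v -> u = v}.
Proof.
have H u v : u \in S -> v \in S -> u != root T ->
    parent T u = parent T v -> above u v -> u = v.
  move=> Su Sv nur Euv auv; apply/eqP/negPn/negP => nuv.
  have := ancestorS auv nuv; rewrite -Euv => au.
  by move: (parent_neq nur); rewrite (ancestor_anti dT (ancestor_parent T u) au) eqxx.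
move=> u v Su Sv nur nvr Euv.
case/orP: (clique_comparable Su Sv) => [/H|/H H']; first exact.
by apply/esym/H'.
Qed.

Lemma card_below_lt u v : u \in S -> v \in S -> u != v -> above u v ->
  #|below v| < #|below u|.
Proof.
move=> Su Sv nuv auv; apply: proper_card; apply/properP; split.
  apply/subsetP => y; rewrite !inE => /and3P[-> avy nyv] /=.
  rewrite (ancestor_trans auv avy) /=; apply: contraNneq nyv => Ey.
  by rewrite -Ey in auv *; rewrite (ancestor_anti dT avy auv) Ey.
by exists v; rewrite !inE ?Sv ?eqxx ?andbF //= auv eq_sym.
Qed.

(** Vertices with parent outside [S] are at most [q] by injectivity of parents on the clique; those
    with a child outside [S] are at most [q], being parents of such children; those with fewer than
    [k] vertices of [S] below have distinct such numbers, [S] being a chain. The root and [t]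
    account for the 2. For [q < 2 k] the total is at most [5 k]. *)
Lemma removable_many t : #|S :\: removable t| <= q + q + k + 2.
Proof.
pose A1 := [set s in S | (s != root T) && (parent T s \notin S)].
pose A2 := [set s in S | [exists v, (parent T v == s) && (v \notin S)]].
pose A3 := [set s in S | #|below s| < k].
have cA1 : #|A1| <= q.
  rewrite -(@card_in_imset _ _ (parent T) A1).
    apply: subset_leq_card; apply/subsetP => x /imsetP[s].
    by rewrite !inE => /and3P[_ _ nSp] ->.
  move=> u v; rewrite !inE => /and3P[Su nur _] /and3P[Sv nvr _].
  exact: parent_inj_clique.
have cA2 : #|A2| <= q.
  apply: leq_trans (leq_imset_card (parent T) (~: S)); apply: subset_leq_card.
  apply/subsetP => s; rewrite inE => /andP[_ /existsP[v /andP[/eqP<- nSv]]].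
  by apply: imset_f; rewrite inE.
have cA3 : #|A3| <= k.
  have [k0|k_gt0] := posnP k.
    by rewrite (_ : A3 = set0) ?cards0 //; apply/setP => s; rewrite !inE k0 andbF.
  pose f s : 'I_k.-1.+1 := inord #|below s|.
  rewrite -[X in _ <= X](prednK k_gt0) -[X in _ <= X]card_ord.
  rewrite -(@card_in_imset _ _ f A3); first exact: max_card.
  move=> u v; rewrite !inE => /andP[Su lu] /andP[Sv lv'] /(congr1 val).
  rewrite /= !inordK ?prednK // => Euv; apply/eqP/negPn/negP => nuv.
  case/orP: (clique_comparable Su Sv) => /card_below_lt.
    by move/(_ Su Sv nuv); lia.
  by move/(_ Sv Su); rewrite eq_sym => /(_ nuv); lia.
have sub : S :\: removable t \subset A1 :|: A2 :|: A3 :|: [set root T; t].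
  apply/subsetP => s; rewrite !inE => /andP[] + Ss; rewrite Ss /=.
  case: (s == root T) => //=; rewrite ?orbT //.
  case: (s == t); rewrite ?orbT //= !orbF.
  case: (parent T s \in S) => //=; rewrite negb_and -ltnNge.
  case/orP=> [|->]; last by rewrite orbT.
  case/forallPn=> v; rewrite negb_imply => Hv.
  by apply/orP; left; apply/existsP; exists v.
apply: leq_trans (subset_leq_card sub) _.
have := cards2 (root T) t.
have := (leq_card_setU A1 A2, leq_card_setU (A1 :|: A2) A3,
         leq_card_setU (A1 :|: A2 :|: A3) [set root T; t]).
move=> [[[+ _] [+ _]] [+ _]].
by move: cA1 cA2 cA3; case: (_ != _); lia.
Qed.

Section Removal.
Variables (t : V) (O : {set V}).
Hypotheses (k_le : k <= #|V|) (T_height : forall v, lv v <= #|V| - k)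
  (O_rem : O \subset removable t).

Let W := ~: O.

Let OP o : o \in O -> [/\ o \in S, o != root T, parent T o \in S,
  forall v, parent T v = o -> v \in S & k <= #|below o|].
Proof.
move/(subsetP O_rem); rewrite inE => /and5P[So nr Sp _ /andP[/forallP ch kb]].
by split=> // v Ev; have := ch v; rewrite Ev eqxx.
Qed.

Lemma root_kept : root T \in W.
Proof. by rewrite inE; apply/negP => /OP[_ /eqP]. Qed.

(** The new parent is the deepest kept proper ancestor [u]. If the old parent was removed, [v] is in
    [S], being a child of a removable vertex, and [u] is in [S], being the parent of the topmost
    removed vertex between [u] and [v]; the clique provides the edge. *)
Lemma kept_parent v : v \in W -> v != root T ->
  exists u, [/\ u \in W, above u v, u != v, G u v &
    forall w, w \in W -> above w v -> w != v -> above w u].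
Proof.
move=> Wv nvr.
pose P u := [&& u \in W, above u v & u != v].
have Pr : P (root T).
  by rewrite /P root_kept (dfs_root_ancestor dT) eq_sym.
have [u /and3P[Wu auv nuv] max_u] := @arg_maxnP V _ P lv Pr.
have deepest w : w \in W -> above w v -> w != v -> above w u.
  move=> Ww awv nwv; case/orP: (ancestor_chain awv auv) => // auw.
  have : lv w <= lv u by apply: max_u; rewrite /P Ww awv.
  have [<- _|nuw] := eqVneq u w; first exact: ancestor_refl.
  by rewrite leqNgt (level_lt dT).
exists u; split=> //; have nPv := parent_neq nvr.
have aup := ancestorS auv nuv.
have [Wp|] := boolP (parent T v \in W).
  have apu := deepest _ Wp (ancestor_parent T v) nPv.
  by rewrite (ancestor_anti dT aup apu) adj_sym dfs_parent.
rewrite inE negbK => Op; have [_ _ _ /(_ v erefl) Sv _] := OP Op.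
pose Q c := [&& c \in O, above u c & above c v].
have Qp : Q (parent T v) by rewrite /Q Op aup ancestor_parent.
have [c /and3P[Oc auc acv] min_c] := @arg_minnP V _ Q lv Qp.
have [Sc ncr Spc _ _] := OP Oc.
have nuc : u != c by apply: contraTneq Wu => ->; rewrite inE Oc.
have aupc := ancestorS auc nuc.
have apcv := ancestor_trans (ancestor_parent T c) acv.
have Wpc : parent T c \in W.
  rewrite inE; apply/negP => Opc.
  have := min_c (parent T c); rewrite /Q Opc aupc apcv => /(_ isT).
  by rewrite leqNgt (level_lt dT) ?ancestor_parent ?parent_neq.
have npcv : parent T c != v.
  apply: contraTneq Wv => Epc; rewrite inE negbK.
  by rewrite -(ancestor_anti dT acv) // -Epc ancestor_parent.
have Eu : u = parent T c.
  by apply: (ancestor_anti dT aupc); apply: deepest.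
by apply: clique => //; rewrite Eu.
Qed.

(** If all removed vertices are above [v], its level drops by their number. Otherwise let [o'] be
    the lowest removed vertex: the at least [k] vertices of [S] below it are kept, and none is above
    [v], as all of [O] would then be above [v]. *)
Lemma kept_level v : v \in W -> #|[set u in W | above u v]| <= #|W| - k.
Proof.
move=> Wv; have cW : #|W| + #|O| = #|V| by rewrite addnC cardsC.
have [/forallP allO|/forallPn[o]] := boolP [forall o, (o \in O) ==> above o v].
  have : #|[set u in W | above u v]| + #|O| <= lv v.
    rewrite /level -(cardsID O [set u | above u v]) addnC leq_add // subset_leq_card //;
      apply/subsetP => u; rewrite !inE // => Ou.
    by rewrite Ou andbT (implyP (allO u)).
  by have := T_height v; lia.
rewrite negb_imply => /andP[Oo nov].
have [o' Oo' max_o] := @arg_maxnP V _ (mem O) lv Oo.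
have le_o' w : w \in O -> above w o'.
  move=> Ow; have [[Sw _ _ _ _] [So' _ _ _ _]] := (OP Ow, OP Oo').
  case/orP: (clique_comparable Sw So') => // ao'w.
  have [<-|ne] := eqVneq o' w; first exact: ancestor_refl.
  by have : lv w <= lv o' := max_o w Ow; rewrite leqNgt (level_lt dT).
have [_ _ _ _ kb] := OP Oo'.
have sub : below o' \subset W :\: [set u in W | above u v].
  apply/subsetP => y; rewrite !inE => /and3P[Sy ao'y ny].
  have nOy : y \notin O.
    apply: contra ny => /le_o' ayo'.
    by apply/eqP; apply: (ancestor_anti dT).
  rewrite nOy /= andbT; apply: contra nov => ayv.
  by apply: ancestor_trans (le_o' _ Oo) _; apply: ancestor_trans ao'y ayv.
have subW : [set u in W | above u v] \subset W.
  by apply/subsetP => u; rewrite inE => /andP[].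
have := subset_leq_card sub; have := subset_leq_card subW.
by rewrite cardsDS //; lia.
Qed.

End Removal.
End Pruning.

(** * Listing a pruned DFS tree as a certificate *)

Section Certificate.
Variables (n : nat) (G : sgraph 'I_n) (T : rtree 'I_n) (S : {set 'I_n}) (k : nat).
Hypotheses (dT : dfs_tree G T) (k_le : k <= n)
  (clique : {in S &, forall u v, u != v -> G u v})
  (T_height : forall v, level T v <= n - k).

Local Notation above := (ancestor T).
Local Notation lv := (level T).

Section Listing.
Variables (t : 'I_n) (O : {set 'I_n}).
Hypotheses (O_rem : O \subset removable T S k t) (Wt : t \notin O)
  (t_top : forall o, o \in O -> [/\ t \in S, t != root T, parent T t \in S,
     parent T t \notin O & above t o]).

Let W := ~: O.

(* Ordering the kept vertices with the ancestors of [t] first. *)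
Let key (v : 'I_n) : nat := (~~ above v t) * n + lv v.
Let x : seq 'I_n := sort (relpre key leq) (enum W).
Let N := size x.
Let xn i := nth t x i.
Let g := gadj G.
Let y : seq nat := map val x.
Let e := seq_adj g y.

Let size_y : size y = N. Proof. exact: size_map. Qed.
Let uniq_x : uniq x. Proof. by rewrite sort_uniq enum_uniq. Qed.
Let mem_x v : (v \in x) = (v \in W). Proof. by rewrite mem_sort mem_enum. Qed.
Let size_x : N = #|W|. Proof. by rewrite /N size_sort -cardE. Qed.

Let xnW i : i < N -> xn i \in W. Proof. by move=> li; rewrite -mem_x mem_nth. Qed.

Let eE i j : i < N -> j < N -> e i j = G (xn i) (xn j).
Proof. by move=> li lj; rewrite /e /seq_adj !(nth_map t) // /g gadjE. Qed.

Let xn_inj i j : i < N -> j < N -> xn i = xn j -> i = j.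
Proof. by move=> li lj /eqP; rewrite nth_uniq // => /eqP. Qed.

Let idx v : v \in W -> index v x < N /\ xn (index v x) = v.
Proof. by rewrite -mem_x => xv; rewrite index_mem /xn nth_index. Qed.

Let key_le i j : i <= j < N -> key (xn i) <= key (xn j).
Proof.
move=> /andP[lij lj].
have sx : sorted (relpre key leq) x by apply: sort_sorted => u v; apply: leq_total.
have tr : transitive (relpre key leq) by move=> u v w; apply: leq_trans.
have rf : reflexive (relpre key leq) by move=> u; apply: leqnn.
apply: (sorted_leq_nth tr rf t sx) => //; rewrite inE //.
exact: leq_ltn_trans lj.
Qed.

Let anc_lt i j : i < N -> j < N -> above (xn i) (xn j) -> i != j -> i < j.
Proof.
move=> li lj aij nij.
have nx : xn i != xn j by apply: contraNneq nij => /xn_inj ->.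
rewrite ltnNge; apply/negP => lji; have := @key_le j i; rewrite lji li => /(_ isT).
have := level_lt dT aij nx; rewrite /key.
have [ajt|] := boolP (above (xn j) t); last by case: (above (xn i) t); nlia.
by rewrite (ancestor_trans aij ajt); nlia.
Qed.

Let root_first j : j < N -> (xn j == root T) = (j == 0).
Proof.
move=> lj; have [lr Er] := idx (root_kept O_rem).
have r0 : index (root T) x = 0.
  apply/eqP/negPn/negP => nr0; have N_gt0 : 0 < N by nlia.
  have := @anc_lt (index (root T) x) 0; rewrite Er (dfs_root_ancestor dT).
  by move=> /(_ lr N_gt0 isT nr0).
apply/eqP/eqP => [Ej|->]; last by rewrite -r0.
by apply: xn_inj => //; [nlia | rewrite Ej -r0].
Qed.

Let parE j : 0 < j < N -> exists i, [/\ i < j, par e j = i, G (xn i) (xn j),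
  above (xn i) (xn j) &
  forall w, w \in W -> above w (xn j) -> w != xn j -> above w (xn i)].
Proof.
move=> /andP[j_gt0 lj].
have nr : xn j != root T by rewrite root_first // -lt0n.
have [u [Wu auj nuj Gju deep]] := kept_parent dT clique O_rem (xnW lj) nr.
have [li Ei] := idx Wu; set i := index u x in li Ei; rewrite -Ei in auj nuj Gju deep.
have nij : i != j by apply: contraNneq nuj => ->.
have lij : i < j by apply: anc_lt.
exists i; split=> //; apply: par_eq => // [|l /andP[lil llj]].
  by rewrite eE.
have ll : l < N by apply: ltn_trans lj.
rewrite eE //; apply/negP => Glj.
have nlj : xn l != xn j by apply/eqP => /xn_inj; nlia.
have alj : above (xn l) (xn j).
  case/orP: (dfs_comparable dT Glj) => // ajl.
  have := anc_lt lj ll ajl; nlia.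
have := anc_lt ll li (deep _ (xnW ll) alj nlj); nlia.
Qed.

Let ancE_x i j : i < N -> j < N -> anc e i j = above (xn i) (xn j).
Proof.
elim/ltn_ind: j => j IHj in i *; move=> li lj; rewrite ancE.
have [->|nij] := eqVneq i j; first by rewrite ancestor_refl.
have [j0|j_gt0] := posnP j.
  rewrite j0 in lj nij *; rewrite /=; apply/esym/negP => ai0.
  by have := anc_lt li lj ai0 nij.
have [|p [lp -> _ apj deep]] := @parE j; first by rewrite j_gt0.
rewrite lp IHj ?(ltn_trans lp lj) //=; apply/idP/idP => [aip|aij].
  exact: ancestor_trans aip apj.
by apply: deep => //; [apply: xnW | apply: contraNneq nij => /xn_inj ->].
Qed.

Let tau := index t x.
Let lt_tau : tau < N. Proof. by case: (idx (v := t)) => //; rewrite inE. Qed.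
Let x_tau : xn tau = t. Proof. by case: (idx (v := t)) => //; rewrite inE. Qed.

(** Levels are positive and that of [t] is at most [n], so any vertex not above [t] has a larger key
    than [t]. *)
Let before_tau i : i <= tau -> above (xn i) t.
Proof.
move=> li; have := @key_le i tau; rewrite li lt_tau => /(_ isT).
rewrite /key x_tau ancestor_refl /=; case: (above (xn i) t) => //=.
have lv_gt0 : 0 < lv (xn i).
  by apply/card_gt0P; exists (xn i); rewrite inE ancestor_refl.
by have := T_height t; nlia.
Qed.

Let path_tau j : j <= tau -> par e j = j.-1.
Proof.
have [->|j_gt0] := posnP j; first by have := par_le e 0; nlia.
move=> ljt; have lj := leq_ltn_trans ljt lt_tau.
have [|i [lij -> _ _ deep]] := @parE j; first by rewrite j_gt0.
have lj1 : j.-1 < N by nlia.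
have nj : xn j.-1 != xn j by apply/eqP => /xn_inj; nlia.
have aj : above (xn j.-1) (xn j).
  have := ancestor_chain (before_tau (leq_trans (leq_pred j) ljt)) (before_tau ljt).
  by case/orP=> // /(anc_lt lj lj1); nlia.
have li := ltn_trans lij lj.
have := deep _ (xnW lj1) aj nj.
by have [|nji /(anc_lt lj1 li)/(_ nji)] := eqVneq j.-1 i; nlia.
Qed.

Lemma listing_valid : valid g y tau (N - k).
Proof.
split; rewrite ?size_y //.
- by move=> j lj; have [i [lij -> _ _ _]] := parE lj.
- move=> i j /andP[lij lj]; have li := ltn_trans lij lj.
  rewrite -/e eE // ancE_x // => Gij; case/orP: (dfs_comparable dT Gij) => //.
  by move/(anc_lt lj li); nlia.
- move=> j lj; rewrite -/e size_x.
  apply: leq_trans (kept_level dT clique _ _ O_rem (xnW lj)); rewrite ?card_ord //.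
  rewrite /depth -size_x (eq_bigr (fun i : 'I_N => nat_of_bool (above (xn i) (xn j)))).
    rewrite -(big_mkord xpredT (fun i => nat_of_bool (above (xn i) (xn j)))).
    rewrite -(big_nth t xpredT (fun u => nat_of_bool (above u (xn j)))).
    rewrite (perm_big (enum W)) ?perm_sort // big_enum_cond /=.
    rewrite -sum1_card big_mkcond [X in _ <= X]big_mkcond /=.
    by apply: leq_sum => u _; rewrite !inE; case: (u \in O); case: (above _ _).
  by move=> i _; rewrite ancE_x.
Qed.

(** A neighbour of [o] listed from [t] on is comparable with [o]. Below [o] it is below [t]; above
    [o] it is comparable with [t], and a proper ancestor of [t] would be listed before it. *)
Lemma listing_fits o : o \in O -> fits g y tau o.
Proof.
move=> Oo; have [St ntr Spt nOp ato] := t_top Oo.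
have So : o \in S by move/(subsetP O_rem): Oo; rewrite inE => /andP[].
have GS u : u \in S -> u \notin O -> G o u.
  by move=> Su nOu; apply: clique => //; apply: contraNneq nOu => <-.
have tau_gt0 : 0 < tau by rewrite lt0n -root_first // x_tau.
have gE j : j < N -> g o (nth 0 y j) = G o (xn j).
  by move=> lj; rewrite (nth_map t) // /g gadjE.
split=> [|_|j]; rewrite ?size_y.
- by rewrite gE // x_tau GS.
- rewrite gE; last nlia.
  have [|i [lij Ei _ ait deep]] := @parE tau; first by rewrite tau_gt0.
  have -> : tau.-1 = i by rewrite -Ei path_tau.
  rewrite x_tau in ait deep.
  have -> : xn i = parent T t.
    apply: (ancestor_anti dT); last first.
      apply: deep; rewrite ?inE ?ancestor_parent //.
      by apply/eqP => Ep; have := dfs_parent dT ntr; rewrite Ep adj_irrefl.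
    apply: ancestorS ait _; rewrite -x_tau; apply/eqP => /xn_inj; nlia.
  exact: GS.
- move=> /andP[ltj lj]; rewrite gE // ancE_x // x_tau => Goj.
  case/orP: (dfs_comparable dT Goj) => [|ajo]; first exact: ancestor_trans.
  case/orP: (ancestor_chain ato ajo) => // ajt.
  have := anc_lt lj lt_tau; rewrite x_tau => /(_ ajt).
  have [->|] := eqVneq j tau; first by rewrite x_tau ancestor_refl.
  by move=> _ /(_ isT); nlia.
Qed.

Lemma listing_cover : [/\ uniq x, size x = #|W| & forall o, o \notin x -> o \in O].
Proof. by split=> // o; rewrite mem_x inE negbK. Qed.

End Listing.

Let q := #|~: S|.

(** The place is the topmost vertex of [S] whose parent is in [S]. Every removable vertex is of this
    kind, hence below it, and by minimality its parent is not removable. Truncated subtraction in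
    the size of [O] yields the minimum in [N]. *)
Lemma certificate : q < k.*2 -> let N := minn n (5 * k + q) in
  exists (x : seq 'I_n) (t : nat), [/\ uniq x, size x = N,
    valid (gadj G) (map val x) t (N - k) &
    forall o, o \notin x -> o \in S /\ fits (gadj G) (map val x) t o].
Proof.
move=> lq N; have cS : #|S| + q = n by rewrite cardsC card_ord.
pose nice s := [&& s \in S, s != root T & parent T s \in S].
pose t0 := if [pick s | nice s] is Some s0 then [arg min_(s < s0 | nice s) lv s]
           else root T.
have [O O_rem cO] : exists2 O : {set 'I_n}, O \subset removable T S k t0 &
    #|O| = #|S| - 5 * k.
  apply: subset_of_card; have := removable_many k dT clique t0.
  have sub : removable T S k t0 \subset S.
    by apply/subsetP => o; rewrite inE => /andP[].
  by rewrite cardsDS //; have := subset_leq_card sub; rewrite -/q; nlia.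
have Wt : t0 \notin O.
  by apply/negP => /(subsetP O_rem); rewrite inE eqxx !andbF.
have t_top o : o \in O -> [/\ t0 \in S, t0 != root T, parent T t0 \in S,
    parent T t0 \notin O & above t0 o].
  move=> Oo; have := subsetP O_rem _ Oo; rewrite inE => /and5P[So nro Spo nt _].
  have nice_o : nice o by rewrite /nice So nro.
  move: nt; rewrite /t0; case: pickP => [s0 nice0|/(_ o)]; last by rewrite nice_o.
  case: arg_minnP => // s nice_s min_s nos; have /and3P[Ss nrs Sps] := nice_s.
  have Gs := dfs_parent dT nrs.
  split=> //.
    apply/negP => /(subsetP O_rem); rewrite inE => /and5P[_ npr Spp _ _].
    have : lv s <= lv (parent T s) by apply: min_s; rewrite /nice Sps npr.
    rewrite leqNgt => /negP[]; apply: (level_lt dT); rewrite ?ancestor_parent //.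
    by apply/eqP => Ep; rewrite Ep adj_irrefl in Gs.
  case/orP: (clique_comparable dT clique Ss So) => // aos.
  by have := min_s o nice_o; rewrite leqNgt (level_lt dT).
have [ux sx cov] := listing_cover t0 O.
have cW : #|~: O| = N by rewrite cardsCs setCK card_ord cO /N; nlia.
exists (sort (relpre (fun v => (~~ above v t0) * n + lv v) leq) (enum (~: O))).
eexists; split=> //; first by rewrite sx.
  by rewrite -cW -sx; apply: listing_valid.
move=> o /cov Oo; split; last exact: listing_fits.
by have := subsetP O_rem _ Oo; rewrite inE => /andP[].
Qed.

End Certificate.

Lemma valid_ext g x x' t h : size x = size x' ->
    (forall i j, i < size x -> j < size x -> seq_adj g x i j = seq_adj g x' i j) ->
  valid g x t h -> valid g x' t h.
Proof.
move=> Es Ea vx.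
have Ee a b : a < b < size x -> seq_adj g x a b = seq_adj g x' a b.
  by move=> lab; apply: Ea; lia.
split; rewrite -?Es.
- exact: valid_place vx.
- by move=> j lj; rewrite -(par_ext Ee); [apply: (valid_rooted vx) | lia].
- move=> i j lij eij; rewrite -(anc_ext _ Ee); last lia.
  by apply: (valid_dfs vx) => //; rewrite Ee.
- move=> j ljt; rewrite -(par_ext Ee); first exact: (valid_path vx).
  exact: leq_ltn_trans ljt (valid_place vx).
- by move=> j lj; rewrite -(depth_ext _ Ee) //; apply: (valid_depth vx).
Qed.

Lemma fits_ext g x x' t o o' : size x = size x' -> t < size x ->
    (forall i j, i < size x -> j < size x -> seq_adj g x i j = seq_adj g x' i j) ->
    (forall i, i < size x -> g o (nth 0 x i) = g o' (nth 0 x' i)) ->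
  fits g x t o -> fits g x' t o'.
Proof.
move=> Es lt_t Ea Eo fx.
have Ee a b : a < b < size x -> seq_adj g x a b = seq_adj g x' a b.
  by move=> lab; apply: Ea; lia.
split; rewrite -?Es -?Eo //; try lia.
- exact: fits_below fx.
- exact: fits_above fx.
- move=> j lj; rewrite -Eo; last lia.
  by rewrite -(anc_ext _ Ee); [apply: (fits_dfs fx) | lia].
Qed.

(** * Exchanging twins of the clique *)

Section Twins.
Variables (n : nat) (G : sgraph 'I_n) (S U : {set 'I_n}) (h : nat).
Hypotheses (clique : {in S &, forall u v, u != v -> G u v}).

Definition twin (u v : 'I_n) : bool := [forall r, (r \notin S) ==> (G u r == G v r)].

Definition listing (x : seq 'I_n) (t : nat) : Prop :=
  [/\ uniq x, valid (gadj G) (map val x) t h &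
    forall o, o \notin x -> o \in S /\ fits (gadj G) (map val x) t o].

(** Inside the clique all vertices look alike, so agreement outside [S] makes the transposition an
    automorphism. *)
Lemma twin_swap u v : u \in S -> v \in S -> twin u v ->
  forall a b, G (tperm u v a) (tperm u v b) = G a b.
Proof.
move=> Su Sv /forallP tw.
have E a : a != u -> a != v -> G u a = G v a.
  move=> nau nav; have [Sa|nSa] := boolP (a \in S).
    by rewrite !clique // eq_sym.
  exact/eqP/(implyP (tw a)).
move=> a b; case: (tpermP u v a) => [->|->|/eqP nau /eqP nav];
  case: (tpermP u v b) => [->|->|/eqP nbu /eqP nbv] //; rewrite ?adj_irrefl //.
- exact: adj_sym.
- by rewrite E.
- exact: adj_sym.
- by rewrite E.
- by rewrite adj_sym -E // adj_sym.
- by rewrite adj_sym E // adj_sym.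
Qed.

Lemma swap_listing u v x t : u \in S -> v \in S -> twin u v ->
  listing x t -> listing (map (tperm u v) x) t.
Proof.
move=> Su Sv tw [ux vx cov]; have Gs := twin_swap Su Sv tw.
have E i j : i < size (map val x) -> j < size (map val x) ->
    seq_adj (gadj G) (map val x) i j =
    seq_adj (gadj G) (map val (map (tperm u v) x)) i j.
  rewrite size_map => li lj; rewrite /seq_adj.
  by rewrite !(nth_map u) ?size_map // !gadjE Gs.
split; first by rewrite map_inj_uniq //; apply: perm_inj.
  by apply: valid_ext vx => //; rewrite !size_map.
move=> o; rewrite -{1}(tpermK u v o) mem_map; last exact: perm_inj.
move=> /cov[So fo]; split.
  by move: So; case: (tpermP u v o) => [->|->|].
apply: fits_ext fo; rewrite ?size_map //.
- by have := valid_place vx; rewrite size_map.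
- by move=> i j li lj; apply: E; rewrite size_map.
- move=> i li; rewrite !(nth_map u) ?size_map // !gadjE.
  by rewrite -[in LHS](tpermK u v (nth u x i)) Gs.
Qed.

(** An entry [v] outside [U] leaves fewer than [size x] slots for its twins in [U], so one of them
    is not listed. Swapping it with [v] lowers the number of entries outside [U]. *)
Lemma listing_in_reps x t :
    (forall v, v \notin U -> v \in S /\ size x <= #|[set u in U | twin u v]|) ->
    listing x t ->
  exists x', [/\ listing x' t, size x' = size x & {subset x' <= U}].
Proof.
move Em : (size x) => m U_reps.
have [c] := ubnP (count [predC U] x); elim: c x Em => // c IHc x Em lt_c lx.
have [/allP xU|/allPn[v xv nUv]] := boolP (all (mem U) x); first by exists x; split=> // w /xU.
have [Sv reps] := U_reps v nUv; have [ux vx cov] := lx.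
have [u /andP[Uu tw] nxu] : exists2 u, (u \in U) && twin u v & u \notin x.
  have [/exists_inP[u Uu nxu]|] :=
    boolP [exists (u | (u \in U) && twin u v), u \notin x]; first by exists u.
  move=> /exists_inPn none; have sub : [set u in U | twin u v] \subset rem v x.
    apply/subsetP => u; rewrite inE => Uu; have := none u Uu; rewrite negbK => xu.
    rewrite mem_rem_uniq // inE xu andbT; apply: contraNneq nUv => <-.
    by case/andP: Uu.
  have x_gt0 : 0 < size x by case: (x) xv.
  have := leq_trans reps (leq_trans (subset_leq_card sub) (card_size _)).
  by rewrite size_rem // Em; lia.
(* [U] may contain vertices outside [S] with the type of [v], but those are all listed, so [u] is in
   [S]. *)
have [Su _] := cov u nxu.
have lx' := swap_listing Su Sv tw lx.
apply: IHc lx'; first by rewrite size_map.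
rewrite -ltnS; apply: leq_trans lt_c; rewrite ltnS count_map.
rewrite !(seq.permP (perm_to_rem xv)) /= tpermR Uu (nUv : v \notin U) add0n add1n ltnS.
rewrite (@eq_in_count _ _ [predC U]) // => w; rewrite mem_rem_uniq // inE.
move=> /andP[nwv xw]; rewrite /= tpermD // 1?eq_sym //.
by apply: contraNneq nxu => <-.
Qed.

End Twins.

(** * Checking and enumerating certificates *)

Lemma eq_nat_of_bool (a b : bool) : (a == b :> nat) = (a == b).
Proof. by case: a; case: b. Qed.

Lemma iotaS i : iota 0 i.+1 = rcons (iota 0 i) i.
Proof. by rewrite -addn1 iotaD cats1. Qed.

Lemma count_sum (P : pred nat) i : count P (iota 0 i) = \sum_(u < i) P u.
Proof.
rewrite -sum1_count -{1}(subn0 i) -/(index_iota 0 i) big_mkcond big_mkord.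
by apply: eq_bigr => u _; case: P.
Qed.

Section Types.
Variables (g : rel nat) (R : seq nat).

Definition same_type (v w : nat) : bool := all (fun r => g w r == g v r) R.

Lemma types_bound s c : (forall w, count (same_type w) s <= c) ->
  size s <= c * 2 ^ size R.
Proof.
move=> Hc; pose ty w : {ffun 'I_(size R) -> bool} := [ffun i => g w (nth 0 R (nat_of_ord i))].
have tyE v w : (ty w == ty v) = same_type v w.
  apply/eqP/allP => [E r /(nthP 0)[i li <-]|H].
    by have /ffunP/(_ (Ordinal li)) := E; rewrite !ffunE /= => ->.
  apply/ffunP => i; rewrite !ffunE.
  by have /eqP := H _ (mem_nth 0 (ltn_ord i)).
have -> : size s = \sum_t count (fun w => ty w == t) s.
  elim: s {Hc} => [|w s IHs] /=; first by rewrite big1.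
  rewrite big_split /= -IHs (bigD1 (ty w)) //= eqxx big1 // => t.
  by rewrite eq_sym => /negbTE ->.
rewrite mulnC -[2]card_bool -[X in _ ^ X](card_ord) -card_ffun -sum_nat_const.
apply: leq_sum => t _; have [/hasP[v sv /eqP <-]|] := boolP (has (fun w => ty w == t) s).
  by rewrite (eq_count (tyE v)).
by rewrite has_count -leqNgt leqn0 => /eqP ->.
Qed.
End Types.

Section Check.
Variables (n k : nat) (g : rel nat) (B : pred nat).

(** Stated the way the program evaluates it: counting the marked vertices tests [uniq x]. The height
    bound is [N - k] because each of the [n - N] missing vertices will add at most one. *)
Definition check (x : seq nat) (t : nat) : bool :=
  let N := size x in let e := seq_adj g x in
  [&& all (fun v => (v \in x) || B v) (iota 0 n),
      \sum_(v < n) (nat_of_ord v \in x) == N,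
      all (fun j => [&& (j == 0) || (par e j < j), (t < j) || (par e j == j.-1),
             all (fun i => (i < j) && e i j ==> anc e i j) (iota 0 N) &
             depth e N j <= N - k]) (iota 0 N) &
      all (fun v => (v \in x) || [&& g v (nth 0 x t), (0 < t) ==> g v (nth 0 x t.-1) &
             all (fun j => (t <= j) && g v (nth 0 x j) ==> anc e t j) (iota 0 N)])
          (iota 0 n)].

Lemma checkP (x : seq nat) t : t < size x -> all (ltn^~ n) x ->
  reflect [/\ uniq x, valid g x t (size x - k) &
              forall o, o < n -> o \notin x -> B o /\ fits g x t o] (check x t).
Proof.
move=> lt_t lx; set N := size x; set e := seq_adj g x.
have xI (v : nat) : v \in iota 0 n = (v < n) by rewrite mem_iota.
have NI (j : nat) : j \in iota 0 N = (j < N) by rewrite mem_iota.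
have sum_uniq : (\sum_(v < n) (nat_of_ord v \in x) == N) = uniq x.
  have -> : \sum_(v < n) (nat_of_ord v \in x) = size (undup x).
    rewrite -(count_sum (fun v => v \in x)) -size_filter; apply: perm_size.
    apply: uniq_perm; rewrite ?filter_uniq ?iota_uniq ?undup_uniq // => v.
    rewrite mem_filter xI mem_undup andbC.
    by have [xv|_] := boolP (v \in x); rewrite ?andbF ?andbT //; apply: (allP lx).
  rewrite /N; elim: (x) => //= v s IHs; case: ifP => //= sv.
  by apply/eqP => Es; have := size_undup s; rewrite Es ltnn.
rewrite /check sum_uniq; apply: (iffP and4P) => [[/allP c1 c2 /allP c3 /allP c4]|[ux vx cov]].
  have {}c3 j : j < N -> [/\ (j == 0) || (par e j < j), (t < j) || (par e j == j.-1),
      all (fun i => (i < j) && e i j ==> anc e i j) (iota 0 N) & depth e N j <= N - k].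
    by rewrite -NI => /c3/and4P.
  split=> //.
    split=> //.
    - by move=> j /andP[j_gt0 /c3[+ _ _ _]]; case: j j_gt0.
    - move=> i j /andP[lij lj] eij; have [_ _ /allP/(_ i) + _] := c3 j lj.
      by rewrite NI (ltn_trans lij lj) lij (eij : e i j) => /(_ isT).
    - move=> j ljt; have [_ + _ _] := c3 j (leq_ltn_trans ljt lt_t).
      by rewrite ltnNge ljt => /eqP.
    - by move=> j /c3[].
  move=> o lo nxo; have := c1 o; have := c4 o; rewrite xI lo (negbTE nxo) /=.
  move=> /(_ isT)/and3P[f1 f2 /allP f3] /(_ isT) Bo; split=> //; split=> //.
    exact/implyP.
  by move=> j /andP[ltj lj] gj; have := f3 j; rewrite NI lj ltj gj => /(_ isT).
split=> //; apply/allP => v; rewrite ?xI ?NI => lv.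
- by have [//|nxv] := boolP (v \in x); have [->] := cov v lv nxv.
- apply/and4P; split.
  + by case: v lv => // v lv; rewrite (valid_rooted vx).
  + by case: leqP => //= lvt; rewrite (valid_path vx).
  + apply/allP => i _; apply/implyP => /andP[liv eiv].
    by apply: (valid_dfs vx) => //; rewrite liv.
  + exact: (valid_depth vx).
- have [//|nxv] := boolP (v \in x); have [_ fv] := cov v lv nxv.
  apply/and3P; split; first exact: fits_below fv.
    by apply/implyP => /(fits_above fv).
  apply/allP => j; rewrite NI => lj; apply/implyP => /andP[ltj gj].
  by apply: (fits_dfs fv); rewrite ?ltj.
Qed.
End Check.

(** * Numbering candidates by their digits *)

Definition digit (u c j : nat) : nat := (c %/ u ^ j) %% u.

(** Incrementing [c] carries into position [j] exactly when [u ^ j] divides [c.+1]. *)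
Lemma digitS u c j : 0 < u ->
  let a := digit u c j + (u ^ j %| c.+1) in
  digit u c.+1 j = a * (a != u) /\ (u ^ j.+1 %| c.+1) = (a == u).
Proof.
move=> u_gt0 a; have lt_d : digit u c j < u by rewrite ltn_mod.
have p_gt0 : 0 < u ^ j by rewrite expn_gt0 u_gt0.
have Ed : digit u c.+1 j = a %% u.
  by rewrite /digit divnS // addnC modnDml.
have Ea : (a == u) = (a %% u == 0) && (u ^ j %| c.+1).
  rewrite /a; case: (_ %| _) => /=; last by rewrite addn0 andbF; apply/eqP; lia.
  rewrite andbT addn1; have [->|ne] := eqVneq (digit u c j).+1 u; first by rewrite modnn.
  by rewrite modn_small //; lia.
split.
  rewrite Ed; have [->|ne] := eqVneq a u; first by rewrite modnn muln0.
  rewrite muln1 modn_small // ltn_neqAle ne /a; case: (_ %| _); lia.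
rewrite Ea; apply/idP/andP => [dv|[dv1 dv2]].
  have dv2 : u ^ j %| c.+1 by apply: dvdn_trans dv; rewrite dvdn_exp2l.
  split=> //; move: dv; rewrite expnSr -{1}(divnK dv2) [_ %/ _ * _]mulnC dvdn_pmul2l //.
  by rewrite /dvdn -Ed.
by rewrite expnSr -(divnK dv2) [_ %/ _ * _]mulnC dvdn_pmul2l // /dvdn; rewrite -Ed in dv1.
Qed.

Lemma digit_surj u (d : nat -> nat) L : (forall j, j < L -> d j < u) ->
  exists2 c, c < u ^ L & forall j, j < L -> digit u c j = d j.
Proof.
elim: L d => [|L IHL] d ld; first by exists 0.
have [|c lc Hc] := IHL (fun j => d j.+1); first by move=> j lj; apply: ld.
have ld0 : d 0 < u by apply: ld.
have u_gt0 : 0 < u by apply: leq_ltn_trans ld0.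
exists (c * u + d 0).
  rewrite expnSr; apply: leq_trans (_ : c.+1 * u <= _); first by rewrite mulSn; lia.
  by rewrite leq_mul2r lc orbT.
case=> [|j] lj; rewrite /digit; first by rewrite expn0 divn1 modnMDl modn_small.
by rewrite expnS divnMA divnMDl // (divn_small ld0) addn0; apply: Hc.
Qed.

Section Candidates.
Variables (N : nat) (s : seq nat).
Let u := size s.
Let M := u ^ N.+1.

Definition cand (c : nat) : seq nat := mkseq (fun j => nth 0 s (digit u c j)) N.
(** The last of the [N + 1] digits is the place; one out of range is read as 0. *)
Definition cand_place (c : nat) : nat := digit u c N * (digit u c N < N).

(** [N] distinct entries from [s] force [N <= u], so the place is a digit as well. *)
Lemma cand_complete x t : size x = N -> uniq x -> {subset x <= s} -> t < N ->
  exists2 c, c < M & cand c = x /\ cand_place c = t.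
Proof.
move=> sx ux xs lt_t; have le_u : N <= u by rewrite -sx uniq_leq_size.
pose d j := if j < N then index (nth 0 x j) s else t.
have [|c lc dc] := @digit_surj u d N.+1.
  move=> j lj; rewrite /d; case: (ltnP j N) => lj'; last exact: leq_trans lt_t le_u.
  by rewrite index_mem; apply/xs/mem_nth; rewrite sx.
exists c => //; split; last first.
  by rewrite /cand_place dc // /d ltnn lt_t muln1.
apply: (@eq_from_nth _ 0); rewrite size_mkseq // => j lj.
rewrite nth_mkseq // dc; last exact: ltnW.
rewrite /d lj nth_index //.
by apply/xs/mem_nth; rewrite sx.
Qed.

End Candidates.

(** * Correctness of the algorithm *)

Section Glue.
Variables (n k : nat) (G : sgraph 'I_n).
Hypotheses (n_gt0 : 0 < n) (connG : connected_graph G) (chG : chordal G).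
Let g := gadj G.

Section Greedy.
Variables (B : pred nat) (X : nat -> nat).
Hypotheses (X_lt : forall j, j < n -> X j < n)
  (X_inj : forall i j, i < n -> j < n -> X i = X j -> i = j)
  (X_max : forall j u, j < n -> u < n -> fresh X j u ->
     weight g n B X j u <= weight g n B X j (X j))
  (B_clique : forall u v, u < n -> v < n -> u != v -> B u -> B v -> g u v).
Let e : rel nat := fun i j => g (X i) (X j).

Lemma greedy_peo : peo e n.
Proof.
apply: mcs_peo.
- by move=> i j; apply: gadj_sym.
- exact: search_mcs X_lt X_inj X_max B_clique.
- move=> r p lt_r lp ip ep; apply: (chordal_hole_free chG lt_r (p := fun i => X (p i))).
  + by move=> i li; apply/X_lt/lp.
  + move=> i j lij; apply: contra (ip i j lij) => /eqP/X_inj ->; rewrite ?eqxx ?lp //; lia.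
  + exact: ep.
Qed.

(** If no edge left the set of visited vertices, connectedness would make it everything, yet [X j]
    is not in it. *)
Lemma greedy_rooted : rooted e n.
Proof.
apply: (search_rooted X_lt X_inj X_max B_clique) => j /andP[j_gt0 lj].
pose xo i (li : i < n) : 'I_n := Ordinal (X_lt li).
pose A := [pred v : 'I_n | [exists i : 'I_j, X i == v]].
have [/existsP[u /existsP[v /and3P[/existsP[i /eqP Ei] nAv Guv]]]|] :=
    boolP [exists u, exists v, [&& u \in A, v \notin A & G u v]].
  exists i => //; exists v => //; split; last by rewrite Ei /g gadjE.
  move=> l ll; apply: contraNneq nAv => El; apply/existsP.
  by exists (Ordinal ll); rewrite /= El.
move=> none; have clA : closed G A.
  apply: intro_closed; first by apply: sym_connect_sym; apply: adj_sym.
  move=> u v Guv Au; have [//|nAv] := boolP (v \in A); case/negP: none.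
  by apply/existsP; exists u; apply/existsP; exists v; apply/and3P.
have := closed_connect clA (connG.2 (xo 0 n_gt0) (xo j lj)).
have -> : xo 0 n_gt0 \in A by apply/existsP; exists (Ordinal j_gt0).
move/esym/existsP=> [i /eqP/X_inj]; have := ltn_ord i => lij.
by move=> /(_ (ltn_trans lij lj) lj); lia.
Qed.

End Greedy.

Lemma surj_inv (X : nat -> nat) : (forall j, j < n -> X j < n) ->
    (forall i j, i < n -> j < n -> X i = X j -> i = j) ->
  exists2 f : nat -> nat, forall v, v < n -> f v < n & forall v, v < n -> X (f v) = v.
Proof.
move=> X_lt X_inj; exists (fun v => index v (mkseq X n)) => v lv;
  have memv : v \in mkseq X n.
- have us : uniq (mkseq X n).
    by rewrite map_inj_in_uniq ?iota_uniq // => i j; rewrite !mem_iota => li lj /X_inj; apply.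
  have sub : {subset mkseq X n <= iota 0 n}.
    by move=> w /mapP[i]; rewrite !mem_iota => /X_lt li ->.
  have [|_ ->] := uniq_min_size us sub; last by rewrite mem_iota.
  by rewrite size_mkseq size_iota.
- by rewrite -[X in _ < X](size_mkseq X n) index_mem.
- have us : uniq (mkseq X n).
    by rewrite map_inj_in_uniq ?iota_uniq // => i j; rewrite !mem_iota => li lj /X_inj; apply.
  have sub : {subset mkseq X n <= iota 0 n}.
    by move=> w /mapP[i]; rewrite !mem_iota => /X_lt li ->.
  have [|_ ->] := uniq_min_size us sub; last by rewrite mem_iota.
  by rewrite size_mkseq size_iota.
- have li : index v (mkseq X n) < n by rewrite -[X in _ < X](size_mkseq X n) index_mem.
  by rewrite -[LHS](nth_mkseq 0 X li) nth_index.
Qed.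

Section Sound.
Variables (B : pred nat) (x : seq nat) (t : nat).
Hypotheses (lx : all (ltn^~ n) x) (lt_t : t < size x) (k_le : k <= size x)
  (B_clique : forall u v, u < n -> v < n -> u != v -> B u -> B v -> g u v)
  (ck : check n k g B x t).

Let O := [seq v <- iota 0 n | v \notin x].
Let y := insert x t O.

Lemma insert_order : [/\ size y = n, uniq y, all (ltn^~ n) y & valid g y t (n - k)].
Proof.
have [ux vx cov] := elimT (checkP k g B lt_t lx) ck.
have py : perm_eq y (x ++ O).
  by rewrite /y /insert perm_catCA perm_sym perm_catC perm_cat2l cat_take_drop.
have pO : perm_eq (x ++ O) (iota 0 n).
  apply: uniq_perm; rewrite ?iota_uniq //.
    rewrite cat_uniq ux filter_uniq ?iota_uniq // andbT.
    by apply/hasPn => v; rewrite mem_filter => /andP[].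
  move=> v; rewrite mem_cat mem_filter mem_iota /=.
  by have [xv|] := boolP (v \in x); rewrite ?andbT //; apply/esym/(allP lx).
have p := perm_trans py pO.
have sy : size y = n by rewrite (perm_size p) size_iota.
split=> //.
- by rewrite (perm_uniq p) iota_uniq.
- by apply/allP => v; rewrite (perm_mem p) mem_iota.
have sO : size x + size O = n by rewrite -size_cat (perm_size pO) size_iota.
(* [k <= size x] keeps the truncated subtraction exact. *)
have -> : n - k = size x - k + size O by lia.
have OP o : o \in O -> o < n /\ o \notin x.
  by rewrite mem_filter mem_iota => /andP[nxo lo].
apply: insert_valid => //; first exact: gadj_sym.
- by rewrite filter_uniq ?iota_uniq.
- by move=> o /OP[lo nxo]; have [] := cov o lo nxo.
- move=> o o' /OP[lo nxo] /OP[lo' nxo'] noo'.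
  by have [[Bo _] [Bo' _]] := (cov o lo nxo, cov o' lo' nxo'); apply: B_clique.
Qed.

End Sound.

Lemma order_tree (X : nat -> nat) h : (forall j, j < n -> X j < n) ->
    (forall i j, i < n -> j < n -> X i = X j -> i = j) -> h < n ->
    let e i j := g (X i) (X j) in rooted e n -> dfs_order e n ->
    (forall j, j < n -> depth e n j <= h) ->
  MinHLT G <= h /\ forall m : store, m 2 1 = X 0 ->
    (forall j, j < n -> m 3 (X j) = X (par e j)) ->
    exists T : rtree 'I_n, [/\ dfs_tree G T, height T <= h & returns_tree m T].
Proof.
move=> X_lt X_inj lh e re de he.
have [T [dT hT rT pT]] := order_dfs_tree n_gt0 X_lt X_inj re de he.
split; first by apply/MinHLT_leP; [rewrite card_ord | exists T].
move=> m m21 m3; exists T; split=> //; split; first by rewrite m21 rT.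
have [f lf Xf] := surj_inv X_lt X_inj.
move=> v; have lv := lf _ (ltn_ord v).
by rewrite (pT _ v lv) ?Xf // -m3 // Xf.
Qed.

Section Complete.
Variables (B : pred nat) (s : seq nat) (k_gt0 : 0 < k) (k_lt : k < n).
Hypothesis (B_clique : forall u v, u < n -> v < n -> u != v -> B u -> B v -> g u v).
Let q := n - \sum_(u < n) B u.
Let R := [seq v <- iota 0 n | ~~ B v].
Hypotheses (q_lt : q < k.*2) (us : uniq s) (ls : all (ltn^~ n) s)
  (sR : forall v, v < n -> ~~ B v -> v \in s)
  (sB : forall v, v < n -> B v -> v \in s \/ 5 * k + q <= count (same_type g R v) s).

Let N := minn n (5 * k + q).

Lemma search_complete : MinHLT G <= n - k ->
  exists2 c, c < size s ^ N.+1 & check n k g B (cand N s c) (cand_place N s c).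
Proof.
move=> le_min; pose S := [set v : 'I_n | B v].
have [T dT hT] : exists2 T : rtree 'I_n, dfs_tree G T & height T <= n - k.
  by apply/MinHLT_leP; rewrite ?card_ord //; lia.
have clS : {in S &, forall u v, u != v -> G u v}.
  by move=> u v; rewrite !inE => Bu Bv nuv; rewrite -gadjE; apply: B_clique.
have qE : #|~: S| = q.
  have -> : #|~: S| = n - #|S| by rewrite cardsCs setCK card_ord.
  congr (_ - _); rewrite -sum1_card big_mkcond /=.
  by apply: eq_bigr => u _; rewrite inE; case: (B u).
have hT' v : level T v <= n - k.
  by apply: leq_trans hT; apply: (level_height dT).
have [|x [t [ux sx vx cov]]] := certificate dT (ltnW k_lt) clS hT'; first by rewrite qE.
rewrite qE -/N in sx vx.
pose U := [set v : 'I_n | nat_of_ord v \in s].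
have U_reps v : v \notin U -> v \in S /\ size x <= #|[set u in U | twin G S u v]|.
  rewrite !inE => nsv; have Bv : B v.
    by apply: contraR nsv; apply: sR.
  split=> //; have [sv|le_c] := sB (ltn_ord v) Bv; first by rewrite sv in nsv.
  rewrite sx; apply: leq_trans (geq_minr _ _) (leq_trans le_c _).
  rewrite -size_filter; set sf := filter _ _.
  have -> : size sf = size [seq insubd (Ordinal n_gt0) w | w <- sf] by rewrite size_map.
  rewrite cardE; apply: uniq_leq_size.
    rewrite map_inj_in_uniq ?filter_uniq // => w w'.
    rewrite !mem_filter => /andP[_ sw] /andP[_ sw'] /(congr1 val) /=.
    by rewrite !val_insubd (allP ls _ sw : w < n) (allP ls _ sw' : w' < n).
  move=> z /mapP[w]; rewrite mem_filter => /andP[tw sw] ->.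
  have vE : val (insubd (Ordinal n_gt0) w) = w.
    by rewrite val_insubd (allP ls _ sw : w < n).
  rewrite mem_enum !inE; apply/andP; split; first by rewrite vE.
  apply/forallP => r; apply/implyP; rewrite inE => nBr.
  have /allP/(_ (val r)) := tw; rewrite mem_filter nBr mem_iota ltn_ord => /(_ isT).
  by rewrite -!gadjE vE.
have lx : listing G S (N - k) x t by split.
have [x' [[ux' vx' cov'] sx' xU]] := listing_in_reps clS U_reps lx.
have sy : size (map val x') = N by rewrite size_map sx' sx.
have uy : uniq (map val x') by rewrite map_inj_uniq //; apply: val_inj.
have ly : all (ltn^~ n) (map val x').
  by apply/allP => _ /mapP[v _ ->]; apply: ltn_ord.
have lt_t : t < N by rewrite -sy; apply: valid_place vx'.
have suby : {subset map val x' <= s}.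
  by move=> z /mapP[v /xU]; rewrite inE => sv ->.
have [c lc [Ec Et]] := cand_complete sy uy suby lt_t.
exists c => //; rewrite Ec Et; apply/checkP => //; first by rewrite sy.
rewrite sy; split=> // o lo nyo.
have /cov'[] : Ordinal lo \notin x'.
  by apply: contra nyo => xo; apply/mapP; exists (Ordinal lo).
by rewrite inE.
Qed.

End Complete.

End Glue.

(** * Program logic *)

Definition var (a : nat) : expr := Get a (Const 0).
Definition set_var (a : nat) (e : expr) : cmd := Put a (Const 0) e.
Definition for_loop (i : nat) (e : expr) (c : cmd) : cmd :=
  Seq (set_var i (Const 0))
    (While (Bin Lt (var i) e) (Seq c (set_var i (Bin Add (var i) (Const 1))))).

Fixpoint den (m : store) (e : expr) : nat :=
  match e with
  | Const x => x
  | Get a e => m a (den m e)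
  | Bin o e1 e2 => binop_eval o (den m e1) (den m e2)
  end.

(** The exponent of [Z] in the bound on values. A load adds nothing, since memory contents are at
    most [Z] anyway. *)
Fixpoint esize (e : expr) : nat :=
  match e with
  | Const _ => 1
  | Get _ e => esize e
  | Bin _ e1 e2 => esize e1 + esize e2
  end.

Fixpoint small_consts (e : expr) : bool :=
  match e with
  | Const x => x <= 8
  | Get _ e => small_consts e
  | Bin _ e1 e2 => small_consts e1 && small_consts e2
  end.

Definition small (e : expr) : bool := (esize e <= 30) && small_consts e.

(* Kept folded, out of the reach of arithmetic decision procedures. *)
Definition wide (Z bound : nat) : Prop := Z ^ 30 < bound.

Section Logic.
(* [Z] bounds the contents of the memory; intermediate values of an expression
   of size [s] are then at most [Z ^ s]. *)
Variables (Z bound space : nat).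

Definition bounded (m : store) : Prop := forall a i, m a i <= Z.

(** Total correctness with a time bound; boundedness of the memory is carried along here, so that
    loop invariants need not mention it. *)
Definition runs (c : cmd) (m : store) (T : nat) (Q : store -> Prop) : Prop :=
  bounded m -> exists t m', [/\ exec bound space c m t m', t <= T, bounded m' & Q m'].

Lemma runs_weaken c m T T' (Q Q' : store -> Prop) :
  T <= T' -> (forall m', Q m' -> Q' m') -> runs c m T Q -> runs c m T' Q'.
Proof.
move=> le_T QQ' rc bm; have [t [m' [ex le_t bm' Qm']]] := rc bm.
exists t, m'; split=> //; [exact: leq_trans le_T | exact: QQ'].
Qed.

Lemma runs_skip m (T : nat) (Q : store -> Prop) : 0 < T -> Q m -> runs Skip m T Q.
Proof. by move=> T_gt0 Qm bm; exists 1, m; split=> //; constructor. Qed.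

Lemma runs_seq c1 c2 m T1 T Q : T1 <= T ->
    runs c1 m T1 (fun m1 => runs c2 m1 (T - T1) Q) ->
  runs (Seq c1 c2) m T Q.
Proof.
move=> le_T r1 bm; have [t1 [m1 [ex1 le1 bm1 r2]]] := r1 bm.
have [t2 [m2 [ex2 le2 bm2 Qm2]]] := r2 bm1.
by exists (t1 + t2), m2; split=> //; [apply: ExecSeq ex1 ex2 | lia].
Qed.

Hypotheses (Z_ge8 : 8 <= Z) (Z_bound : wide Z bound) (space_gt0 : 0 < space).

Fixpoint idx_ok (m : store) (e : expr) : bool :=
  match e with
  | Const _ => true
  | Get _ e => idx_ok m e && (den m e < space)
  | Bin _ e1 e2 => idx_ok m e1 && idx_ok m e2
  end.

Lemma esize_gt0 e : 0 < esize e.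
Proof. by elim: e => //= o e1 IH1 e2 IH2; rewrite addn_gt0 IH1. Qed.

Lemma den_le m e : bounded m -> small_consts e -> den m e <= Z ^ esize e.
Proof.
move=> bm; elim: e => [x|a e IH|o e1 IH1 e2 IH2] /=.
- by rewrite expn1 => lx; apply: leq_trans lx Z_ge8.
- by move=> _; apply: leq_trans (bm _ _) _; rewrite -{1}(expn1 Z) leq_pexp2l ?esize_gt0 //; lia.
case/andP=> /IH1 {}IH1 /IH2 {}IH2.
have Z_gt1 s : 0 < s -> 1 < Z ^ s.
  by move=> s_gt0; rewrite -(exp1n s) ltn_exp2r //; lia.
have := Z_gt1 _ (esize_gt0 e1); have := Z_gt1 _ (esize_gt0 e2).
rewrite expnD; move: (Z ^ esize e1) (Z ^ esize e2) IH1 IH2 => y1 y2.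
move: (den m e1) (den m e2) => x1 x2 le1 le2 lt1 lt2.
have le1' : y1 <= y1 * y2 by rewrite leq_pmulr //; lia.
have le2' : y2 <= y1 * y2 by rewrite leq_pmull //; lia.
case: o => /=.
- have : y1 + y2 <= y1 * y2 by nia.
  lia.
- lia.
- exact: leq_mul.
- by apply: leq_trans (leq_div _ _) (leq_trans le1 le1').
- by apply: leq_trans (leq_mod _ _) (leq_trans le1 le1').
- by case: eqP => _; lia.
- by case: ltnP => _; lia.
Qed.

Lemma evalE m e : bounded m -> small e -> idx_ok m e ->
  eval bound space m e = Some (den m e).
Proof.
move=> bm /andP[]; have word_ok e' : esize e' <= 30 -> small_consts e' ->
    word bound (den m e') = Some (den m e').
  move=> le_s cs; rewrite /word (leq_ltn_trans _ Z_bound) //.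
  by apply: leq_trans (den_le bm cs) _; rewrite leq_pexp2l //; lia.
elim: e => [x|a e IH|o e1 IH1 e2 IH2] le_s cs.
- by move=> _; apply: (word_ok (Const x)).
- case/andP=> ix lt_x; rewrite /= (IH le_s cs ix) lt_x.
  exact: (word_ok (Get a e)).
- case/andP: (cs) => cs1 cs2 /andP[ix1 ix2].
  have := le_s; rewrite /= => le_s'.
  rewrite (IH1 (leq_trans (leq_addr _ _) le_s') cs1 ix1).
  rewrite (IH2 (leq_trans (leq_addl _ _) le_s') cs2 ix2).
  exact: (word_ok (Bin o e1 e2)).
Qed.

Lemma runs_put a e1 e2 m T (Q : store -> Prop) :
    small e1 && small e2 ->
    [&& idx_ok m e1, idx_ok m e2, den m e1 < space & den m e2 <= Z] ->
    (expr_cost e1 + expr_cost e2).+1 <= T ->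
    Q (upd m a (den m e1) (den m e2)) ->
  runs (Put a e1 e2) m T Q.
Proof.
case/andP=> s1 s2 /and4P[i1 i2 li lx] le_T Qm bm.
do 2!eexists; split; first by apply: ExecPut li _; apply: evalE.
- exact: le_T.
- by move=> b j; rewrite /upd; case: ifP.
- exact: Qm.
Qed.

Lemma runs_if e c1 c2 m T Q :
    small e -> idx_ok m e -> (expr_cost e).+1 <= T ->
    (den m e != 0 -> runs c1 m (T - (expr_cost e).+1) Q) ->
    (den m e = 0 -> runs c2 m (T - (expr_cost e).+1) Q) ->
  runs (If e c1 c2) m T Q.
Proof.
move=> se ie le_T r1 r2 bm.
have : runs (if den m e != 0 then c1 else c2) m (T - (expr_cost e).+1) Q.
  by have [/r2|/r1] := eqVneq (den m e) 0.
case/(_ bm)=> t [m' [ex le_t bm' Qm']].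
exists (expr_cost e + t).+1, m'; split=> //; last by lia.
by apply: ExecIf ex; apply: evalE.
Qed.

Lemma runs_while e c (M Tb : nat) (I : nat -> store -> Prop) T Q :
    small e -> (forall j m, I j m -> idx_ok m e) ->
    (forall j m, I j m -> den m e != 0 -> j < M) ->
    (forall j m, I j m -> den m e != 0 -> runs c m Tb (I j.+1)) ->
    (forall j m, I j m -> den m e = 0 -> Q m) ->
    M * (Tb + (expr_cost e).+1) + (expr_cost e).+1 <= T ->
  forall m, I 0 m -> runs (While e c) m T Q.
Proof.
move=> se ie lt_M body done le_T m I0.
suff H d j m1 : M - j <= d -> I j m1 ->
    runs (While e c) m1 ((M - j) * (Tb + (expr_cost e).+1) + (expr_cost e).+1) Q.
  by apply: runs_weaken (H M 0 m _ I0); rewrite ?subn0.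
elim: d j m1 => [|d IHd] j m1 le_d Ij bm; have := evalE bm se (ie _ _ Ij) => ev.
- have de0 : den m1 e = 0.
    by apply/eqP/negPn/negP => /(lt_M _ _ Ij); lia.
  exists (expr_cost e).+1, m1; split=> //; first by constructor; rewrite -de0.
    exact: leq_addl.
  exact: done Ij de0.
- have [de0|nde0] := eqVneq (den m1 e) 0.
    exists (expr_cost e).+1, m1; split=> //; first by constructor; rewrite -de0.
      exact: leq_addl.
    exact: done Ij de0.
  have lt_j := lt_M _ _ Ij nde0.
  have [t1 [m2 [ex1 le1 bm2 Ij2]]] := body _ _ Ij nde0 bm.
  have [|t2 [m3 [ex2 le2 bm3 Q3]]] := IHd j.+1 m2 _ Ij2 bm2; first by lia.
  exists (expr_cost e + t1 + t2).+1, m3; split=> //.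
    exact: ExecWhileStep ev nde0 ex1 ex2.
  by rewrite -(subnSK lt_j) mulSn; lia.
Qed.

Lemma runs_for i e c (N Tb : nat) (I : nat -> store -> Prop) T Q m :
    small (Bin Lt (var i) e) -> N <= Z ->
    (forall j m, j <= N -> m i 0 = j -> I j m -> idx_ok m e /\ den m e = N) ->
    I 0 (upd m i 0 0) ->
    (forall j m, j < N -> m i 0 = j -> I j m ->
       runs c m Tb (fun m' => m' i 0 = j /\ I j.+1 (upd m' i 0 j.+1))) ->
    (forall m, m i 0 = N -> I N m -> Q m) ->
    N * (Tb + expr_cost e + 20) + expr_cost e + 20 <= T ->
  runs (for_loop i e c) m T Q.
Proof.
move=> se le_N bnd I0 body done le_T.
apply: (@runs_seq _ _ _ 3); first by lia.
apply: runs_put => //=; first by rewrite space_gt0.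
pose J j m := [/\ j <= N, m i 0 = j & I j m].
apply: (@runs_while _ _ N (Tb + 10) J) => //.
- by move=> j m' [le_j Ej /bnd[]//= ie _]; rewrite ie space_gt0.
- by move=> j m' [le_j Ej Ij] /=; have [_ ->] := bnd _ _ le_j Ej Ij; rewrite Ej; case: ltnP.
- move=> j m' [le_j Ej Ij] /=; have [_ ->] := bnd _ _ le_j Ej Ij; rewrite Ej.
  rewrite eqb0 negbK => lt_j.
  apply: (@runs_seq _ _ _ Tb); first by lia.
  apply: runs_weaken (body j m' lt_j Ej Ij) => // m1 [Ej1 I1].
  apply: runs_put => //=; rewrite ?space_gt0 ?Ej1 ?addn1 //=; try lia.
  by split=> //; rewrite /upd !eqxx.
- move=> j m' [le_j Ej Ij] /=; have [_ ->] := bnd _ _ le_j Ej Ij; rewrite Ej.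
  by move/eqP; rewrite eqb0 -leqNgt => ge_j; have EN : j = N by [lia]; apply: done; rewrite -EN.
- have le_mul : N * (Tb + 10 + (expr_cost (Bin Lt (var i) e)).+1) <=
      N * (Tb + expr_cost e + 20) by rewrite leq_mul2l /=; lia.
  by apply: leq_trans (leq_sub2r 3 le_T); move: le_mul => /=; lia.
- by split=> //; rewrite /upd !eqxx.
Qed.

Definition same (mods : seq nat) (m m' : store) : Prop :=
  forall a, a \notin mods -> forall i, m' a i = m a i.

Lemma same_upd mods m m' a i x : a \in mods -> same mods m m' ->
  same mods m (upd m' a i x).
Proof.
move=> am H b nb j; rewrite /upd; case: eqP => [Eb|_] /=; last exact: H.
by rewrite Eb am in nb.
Qed.

Lemma same_trans mods1 mods2 mods m1 m2 m3 : {subset mods1 <= mods} ->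
  {subset mods2 <= mods} -> same mods1 m1 m2 -> same mods2 m2 m3 -> same mods m1 m3.
Proof.
move=> s1 s2 H1 H2 a na i; rewrite H2 ?H1 //.
  by apply: contra na => /s1.
by apply: contra na => /s2.
Qed.

End Logic.

(** * The program *)

Declare Scope prog_scope.
Delimit Scope prog_scope with prog.
Bind Scope prog_scope with expr.
Bind Scope prog_scope with cmd.
Notation "a + b" := (Bin Add a b) : prog_scope.
Notation "a - b" := (Bin Sub a b) : prog_scope.
Notation "a * b" := (Bin Mul a b) : prog_scope.
Notation "a == b" := (Bin Eq a b) : prog_scope.
Notation "a < b" := (Bin Lt a b) : prog_scope.
Notation "a !! e" := (Get a%N e) (at level 2, e at level 1, format "a !! e") : prog_scope.
Notation "$ a" := (var a%N) (at level 1, format "$ a") : prog_scope.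
Notation "# x" := (Const x%N) (at level 1, format "# x") : prog_scope.
Notation "a @[ i ] <- e" := (Put a%N i e) (at level 70, i at level 69, e at level 69) : prog_scope.
Notation "c ;; d" := (Seq c d) (at level 90, right associativity) : prog_scope.

(* Arrays: [Xa] a list of vertices of length [Nv], [Pa] and [Aa] the parents and
   the ancestor matrix of its tree, [Va] and [Wa] the visited vertices and weights
   of a search, [Ba] the bag, [Ua] the [uv] vertices used in candidates, [Da] the
   digits of a candidate in base [uv], [Ma] the vertices occurring in [Xa], [Ya]
   the completed order.  Among the other scalars, [Cv] is the index of the center
   of the bag, [bv] the size of the bag, [qv] the number of other vertices, [tv]
   the place of the insertion, [kv] the result of the check, [dn] tells that the
   enumeration is over and [ca] is its carry. *)
Notation Nv := 10 (only parsing).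
Notation Iv := 11 (only parsing).
Notation Jv := 12 (only parsing).
Notation Bv := 13 (only parsing).
Notation Cv := 14 (only parsing).
Notation Sv := 15 (only parsing).
Notation bv := 16 (only parsing).
Notation qv := 17 (only parsing).
Notation uv := 18 (only parsing).
Notation cv := 19 (only parsing).
Notation Xa := 20 (only parsing).
Notation Pa := 21 (only parsing).
Notation Aa := 22 (only parsing).
Notation Ba := 23 (only parsing).
Notation Va := 24 (only parsing).
Notation Wa := 25 (only parsing).
Notation Ua := 26 (only parsing).
Notation Da := 27 (only parsing).
Notation Ma := 28 (only parsing).
Notation Ya := 29 (only parsing).
Notation ev := 30 (only parsing).
Notation Rv := 31 (only parsing).
Notation tv := 32 (only parsing).
Notation kv := 33 (only parsing).
Notation dn := 34 (only parsing).
Notation ca := 35 (only parsing).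

Definition adj_expr (a b : expr) : expr := (1!!(a * $0 + b))%prog.

(** Overwriting [Pa] while [Iv] increases leaves the latest earlier neighbour. Column [Jv] of [Aa]
    then follows from that of the parent. *)
Definition tree_prog : cmd := (
  for_loop Jv $Nv (
    Pa @[$Jv] <- $Jv ;;
    for_loop Iv $Jv (
      If (adj_expr Xa!!$Iv Xa!!$Jv) (Pa @[$Jv] <- $Iv) Skip) ;;
    for_loop Iv $Nv (
      Aa @[$Iv * $0 + $Jv] <-
        ($Iv == $Jv) + (Pa!!$Jv < $Jv) * Aa!!($Iv * $0 + Pa!!$Jv))))%prog.

(** Visited vertices get key 0 and all others a positive one, even when their weight is 0. *)
Definition key_expr (e : expr) : expr := ((#1 - Va!!e) * (#1 + Wa!!e))%prog.

Definition mcs_prog : cmd := (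
  for_loop Jv $0 (
    Va @[$Jv] <- #0 ;;
    Wa @[$Jv] <- $0 * Ba!!$Jv) ;;
  for_loop Jv $0 (
    Bv @[#0] <- #0 ;;
    for_loop Iv $0 (If (key_expr $Bv < key_expr $Iv) (Bv @[#0] <- $Iv) Skip) ;;
    Xa @[$Jv] <- $Bv ;;
    Va @[$Bv] <- #1 ;;
    for_loop Iv $0 (Wa @[$Iv] <- Wa!!$Iv + adj_expr $Bv $Iv)))%prog.

(** The initial center 0 is the root, whose [n > k] descendants qualify it. *)
Definition center_prog : cmd := (
  Cv @[#0] <- #0 ;;
  for_loop Jv $0 (
    Sv @[#0] <- #0 ;;
    for_loop Iv $0 (Sv @[#0] <- $Sv + Aa!!($Jv * $0 + $Iv)) ;;
    If (0!!(#1) < $Sv) (Cv @[#0] <- $Jv) Skip) ;;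
  bv @[#0] <- #0 ;;
  for_loop Jv $0 (
    Ba @[Xa!!$Jv] <- ($Jv == $Cv) + ($Jv < $Cv) * adj_expr Xa!!$Jv Xa!!$Cv ;;
    bv @[#0] <- $bv + Ba!!(Xa!!$Jv)))%prog.

Definition output_prog : cmd := (
  2 @[#0] <- #1 ;;
  2 @[#1] <- Xa!!(#0) ;;
  for_loop Jv $0 (3 @[Xa!!$Jv] <- Xa!!(Pa!!$Jv)))%prog.

Definition push_prog (a c : nat) (e : expr) : cmd :=
  (a @[$c] <- e ;; c @[#0] <- $c + #1)%prog.

(** The vertices outside the bag come first in [Ua], so its first [qv] entries serve for comparing
    neighbourhoods. *)
Definition reps_prog : cmd := (
  qv @[#0] <- $0 - $bv ;;
  uv @[#0] <- #0 ;;
  for_loop Jv $0 (If Ba!!$Jv Skip (push_prog Ua uv $Jv)) ;;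
  for_loop Jv $0 (If Ba!!$Jv (
      cv @[#0] <- #0 ;;
      for_loop Iv $uv (
        ev @[#0] <- #1 ;;
        for_loop Rv $qv (
          ev @[#0] <- $ev * (adj_expr Ua!!$Iv Ua!!$Rv == adj_expr $Jv Ua!!$Rv)) ;;
        cv @[#0] <- $cv + $ev) ;;
      If ($cv < #5 * 0!!(#1) + $qv) (push_prog Ua uv $Jv) Skip)
    Skip))%prog.

(** The [q] vertices outside the bag, and [5 k + q] for each of [2 ^ q] neighbourhoods. *)
Definition reps_bound (k q : nat) : nat := q + (5 * k + q) * 2 ^ q.

Definition and_prog (e : expr) : cmd := (kv @[#0] <- $kv * e)%prog.

Definition mark_prog : cmd := (
  for_loop Jv $0 (Ma @[$Jv] <- #0) ;;
  for_loop Jv $Nv (Ma @[Xa!!$Jv] <- #1))%prog.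

(** On truth values 0 and 1, a product is a conjunction and [1 - a * (1 - b)] an implication. *)
Definition check_prog : cmd := (
  kv @[#0] <- #1 ;;
  mark_prog ;;
  cv @[#0] <- #0 ;;
  for_loop Jv $0 (
    cv @[#0] <- $cv + Ma!!$Jv ;;
    and_prog (#1 - (#1 - Ma!!$Jv) * (#1 - Ba!!$Jv))) ;;
  and_prog ($cv == $Nv) ;;
  tree_prog ;;
  for_loop Jv $Nv (
    and_prog (($Jv == #0) + (Pa!!$Jv < $Jv)) ;;
    and_prog (($tv < $Jv) + (#1 - ($tv < $Jv)) * (Pa!!$Jv == $Jv - #1)) ;;
    Sv @[#0] <- #0 ;;
    for_loop Iv $Nv (
      Sv @[#0] <- $Sv + Aa!!($Iv * $0 + $Jv) ;;
      and_prog (#1 - ($Iv < $Jv) * adj_expr Xa!!$Iv Xa!!$Jv *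
                     (#1 - Aa!!($Iv * $0 + $Jv)))) ;;
    and_prog (#1 - ($Nv - 0!!(#1) < $Sv))) ;;
  for_loop Jv $0 (
    If Ma!!$Jv Skip (
      and_prog (adj_expr $Jv Xa!!$tv) ;;
      and_prog (#1 - (#0 < $tv) * (#1 - adj_expr $Jv (Xa!!($tv - #1)))) ;;
      for_loop Iv $Nv (
        and_prog (#1 - (#1 - ($Iv < $tv)) * adj_expr $Jv Xa!!$Iv *
                       (#1 - Aa!!($tv * $0 + $Iv)))))))%prog.

Definition cand_prog : cmd := (
  for_loop Jv $Nv (Xa @[$Jv] <- Ua!!(Da!!$Jv)) ;;
  tv @[#0] <- Da!!$Nv * (Da!!$Nv < $Nv))%prog.

(** An odometer in base [uv]; a carry out of the last digit means that all candidates have been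
    tried. *)
Definition next_prog : cmd := (
  ca @[#0] <- #1 ;;
  for_loop Jv ($Nv + #1) (
    Da @[$Jv] <- Da!!$Jv + $ca ;;
    ca @[#0] <- (Da!!$Jv == $uv) ;;
    Da @[$Jv] <- Da!!$Jv * (#1 - $ca)))%prog.

Definition search_prog : cmd := (
  dn @[#0] <- #0 ;;
  While (#1 - $dn) (
    cand_prog ;;
    check_prog ;;
    If $kv (dn @[#0] <- #1) (next_prog ;; dn @[#0] <- $ca)))%prog.

Definition order_prog : cmd := (
  cv @[#0] <- #0 ;;
  for_loop Jv $Nv (
    If ($Jv == $tv) (for_loop Iv $0 (If Ma!!$Iv Skip (push_prog Ya cv $Iv))) Skip ;;
    push_prog Ya cv Xa!!$Jv) ;;
  for_loop Jv $0 (Xa @[$Jv] <- Ya!!$Jv) ;;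
  Nv @[#0] <- $0 ;;
  tree_prog ;;
  output_prog)%prog.

Definition search_cost (n N : nat) : nat :=
  500 * (N * N) + 500 * (n * N) + 1000 * n + 1200 * N + 1600.

(* The candidates list the [q] vertices outside the bag and [5 k] vertices of the
   bag, the bound of [removable_many] for [q < 2 k]. *)
Definition main_prog : cmd := (
  If (0!!(#1) < $0) (
    mcs_prog ;;
    Nv @[#0] <- $0 ;;
    tree_prog ;;
    center_prog ;;
    If ($0 - $bv < #2 * 0!!(#1)) (
      reps_prog ;;
      Nv @[#0] <- #5 * 0!!(#1) + $qv ;;
      If ($0 < $Nv) (Nv @[#0] <- $0) Skip ;;
      search_prog ;;
      If $kv order_prog Skip) (
      mcs_prog ;;
      Nv @[#0] <- $0 ;;
      tree_prog ;;
      output_prog))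
    Skip)%prog.

(** The value of [reps_bound k q] at [q = 2 k]. *)
Definition reps_max (k : nat) : nat := 2 * k + 7 * k * 2 ^ (2 * k).

Definition main_cost (n k : nat) : nat :=
  4000 * (n * n) + 5000 * n + 5000 + n * (reps_max k * (200 * k + 100) + 300) +
  reps_max k ^ (7 * k).+1 * (search_cost n (7 * k) + 10).

Lemma search_cost_le n N N' : N <= N' -> search_cost n N <= search_cost n N'.
Proof.
move=> lN; have := leq_mul lN lN; have := leq_mul (leqnn n) lN.
by rewrite /search_cost; lia.
Qed.

(** * Correctness and running time of the subprograms *)

Section Programs.
Variables (n k : nat) (G : sgraph 'I_n) (Z bound space : nat).
Hypotheses (n_gt0 : 0 < n) (Z_big : n * n + 2 * n + 20 * k + 20 <= Z)
  (Z_bound : wide Z bound) (space_big : n * n + n + n < space).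

Local Notation runs := (runs Z bound space).
Let g := gadj G.

Let Z_ge8 : 8 <= Z. Proof. lia. Qed.
Let space_gt0 : 0 < space. Proof. lia. Qed.
Let idx2 i j : i < n -> j < n -> i * n + j < space.
Proof. by move=> li lj; nia. Qed.

Definition env (m : store) : Prop :=
  [/\ m 0 0 = n, m 0 1 = k & forall a b, a < n -> b < n -> m 1 (a * n + b) = g a b].

Lemma same_env mods m m' : same mods m m' -> 0 \notin mods -> 1 \notin mods ->
  env m -> env m'.
Proof.
move=> H n0 n1 [E0 E1 E2]; split; rewrite ?H // => a b la lb.
by rewrite H // E2.
Qed.

Lemma idx2_inj i j i' j' : j < n -> j' < n ->
  (i * n + j == i' * n + j') = (i == i') && (j == j').
Proof.
move=> lj lj'; apply/eqP/andP => [E|[/eqP-> /eqP->//]].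
have Ei : i = i'.
  by have := congr1 (divn^~ n) E; rewrite !divnMDl // !divn_small // !addn0.
by split; apply/eqP => //; move: E; rewrite Ei; lia.
Qed.

Ltac ix := rewrite ?space_gt0 //=; repeat (apply/andP; split); rewrite ?space_gt0 //;
  first [nlia | apply: idx2; nlia | lia].
Ltac rfor N' Tb' I' :=
  apply: (runs_for Z_ge8 Z_bound space_gt0 (N := N') (Tb := Tb') (I := I'));
  [by [] | by nlia | | | | | by rewrite /=; nlia].
Ltac rskip := apply: runs_skip; first by rewrite /=; nlia.
Ltac rput := apply: (runs_put Z_ge8 Z_bound space_gt0);
  [by [] | | by rewrite /=; nlia | ].
Ltac rif := apply: (runs_if Z_ge8 Z_bound space_gt0);
  [by [] | | by rewrite /=; nlia | | ].
Ltac rseq T' := apply: (@runs_seq _ _ _ _ _ _ T'); first by nlia.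

Lemma tree_runs m N : env m -> N <= n -> m Nv 0 = N -> (forall j, j < N -> m Xa j < n) ->
  let e i j := g (m Xa i) (m Xa j) in
  runs tree_prog m (200 * (N * N) + 200 * N + 200) (fun m' =>
    [/\ same [:: Pa; Aa; Iv; Jv] m m', forall j, j < N -> m' Pa j = par e j &
       forall i j, i < N -> j < N -> m' Aa (i * n + j) = anc e i j]).
Proof.
move=> envm le_N mN lX e.
pose I0 j m' := [/\ same [:: Pa; Aa; Iv; Jv] m m', forall j', j' < j -> m' Pa j' = par e j' &
       forall i j', i < N -> j' < j -> m' Aa (i * n + j') = anc e i j'].
rfor N (150 * N + 150) I0.
- move=> j m' le_j Ej [sm _ _] /=; rewrite space_gt0; split=> //.
  by rewrite sm.
- by split=> //; do ?apply: same_upd.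
- move=> j m' lj Ej [sm HP HA].
  have envm' : env m' by exact: same_env sm isT isT envm.
  have [E0 E1 E2] := envm'.
  rseq 10; rput => //=; rewrite ?Ej; first by ix.
  rseq (70 * N + 50).
  pose I1 i m1 := [/\ same [:: Pa; Aa; Iv; Jv] m m1, m1 Jv 0 = j,
     forall j', j' < j -> m1 Pa j' = par e j', m1 Pa j = latest e j i &
       forall i j', i < N -> j' < j -> m1 Aa (i * n + j') = anc e i j'].
  rfor j 40 I1.
  + by move=> i m1 li Ei [sm1 Ej1 _ _ _] /=; rewrite space_gt0.
  + split=> //; first by do ?apply: same_upd.
    * by move=> j' lj'; rewrite /upd /= (ltn_eqF lj') HP.
    * by rewrite /upd /= eqxx.
  + move=> i m1 li Ei [sm1 Ej1 HP1 Hj HA1].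
    have [F0 F1 F2] : env m1 by exact: same_env sm1 isT isT envm.
    have XE l : m1 Xa l = m Xa l by rewrite sm1.
    have lXi : m Xa i < n by apply: lX; lia.
    have lXj : m Xa j < n by apply: lX; lia.
    rif => //=.
      by rewrite Ei Ej1 !XE F0; ix.
    * rewrite Ei Ej1 !XE F0 F2 // => eij.
      rput => //=; rewrite ?Ei ?Ej1; first by ix.
      split; first by [].
      split=> //.
      - by do ?apply: same_upd.
      - by move=> j' lj'; rewrite /upd /= (ltn_eqF lj') HP1.
      - by rewrite /upd /= eqxx /e; case: (g _ _) eij.
    * rewrite Ei Ej1 !XE F0 F2 // => eij; rskip; split=> //.
      split=> //; first by do ?apply: same_upd.
      by rewrite /upd /= Hj /e; case: (g _ _) eij.
  move=> m1 Ei [sm1 Ej1 HP1 Hj HA1].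
  have HPj : forall j', j' <= j -> m1 Pa j' = par e j'.
    by move=> j'; rewrite leq_eqVlt => /predU1P[->|/HP1].
  have lp : par e j <= j := par_le e j.
  pose I2 i m2 := [/\ same [:: Pa; Aa; Iv; Jv] m m2, m2 Jv 0 = j,
     forall j', j' <= j -> m2 Pa j' = par e j',
     forall i j', i < N -> j' < j -> m2 Aa (i * n + j') = anc e i j' &
     forall i', i' < i -> m2 Aa (i' * n + j) = anc e i' j].
  rfor N 40 I2.
  + by move=> i m2 li Ei2 [sm2 *] /=; rewrite space_gt0 sm2.
  + split=> //; by do ?apply: same_upd.
  + move=> i m2 li Ei2 [sm2 Ej2 HP2 HA2 Hi].
    have [F0 F1 F2] : env m2 by exact: same_env sm2 isT isT envm.
    have ii : i * n + j < space by apply: idx2; lia.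
    have ip : i * n + par e j < space by apply: idx2; lia.
    (* The summands are never both 1, since [j] is not an ancestor of a smaller vertex. *)
    have Av : (i == j) + (par e j < j) * m2 Aa (i * n + par e j) = anc e i j.
      rewrite ancE; have [lpj|] := ltnP (par e j) j; last by rewrite mul0n addn0 andFb orbF.
      rewrite mul1n HA2 // andTb; have [->|//] := eqVneq i j.
      by case: (boolP (anc e j (par e j))) => // /anc_le; lia.
    rput => //=.
    * rewrite ?Ei2 ?Ej2 ?F0 ?HP2 // ?Av.
      by have : anc e i j <= 1; [case: anc | move=> ?; ix].
    * rewrite ?Ei2 ?Ej2 ?F0 ?HP2 // ?Av; split=> //; split=> //.
      - by do ?apply: same_upd.
      - by move=> i' j' li' lj'; rewrite /upd /= idx2_inj ?(ltn_eqF lj') ?andbF ?HA2 //; lia.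
      - move=> i'; rewrite ltnS /upd /= idx2_inj ?eqxx ?andbT; try lia.
        by rewrite leq_eqVlt; case: eqP => [->|_ /Hi].
  move=> m2 Ei2 [sm2 Ej2 HP2 HA2 Hi]; split=> //; split.
  + by do ?apply: same_upd.
  + exact: HP2.
  + move=> i j' li'; rewrite ltnS leq_eqVlt => /predU1P[->|lj']; first exact: Hi.
    exact: HA2.
- by move=> m' Ej [sm HP HA].
Qed.

Section Mcs.
Variables (B : pred nat) (m : store).
Hypotheses (envm : env m) (mB : forall u, u < n -> m Ba u = B u).

Let mods := [:: Xa; Va; Wa; Iv; Jv; Bv].
Let wt (s : seq nat) u := weight g n B (nth 0 s) (size s) u.
Let greedy (s : seq nat) := forall j u, j < size s -> u < n ->
  u \notin take j s -> wt (take j s) u <= wt (take j s) (nth 0 s j).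
Let state (s : seq nat) m' := [/\ same mods m m', uniq s, all (ltn^~ n) s,
  (forall i, i < size s -> m' Xa i = nth 0 s i) & greedy s].
Let marks (s : seq nat) (m' : store) := forall u, u < n ->
  m' Va u = (u \in s) /\ m' Wa u = wt s u.

Let wt_le s u : wt s u <= n + size s.
Proof. by rewrite /wt /weight leq_add ?count_le //; case: (B u); lia. Qed.

Lemma mcs_runs : runs mcs_prog m (300 * (n * n) + 400 * n + 300) (fun m' =>
  [/\ same mods m m', forall j, j < n -> m' Xa j < n,
     forall i j, i < n -> j < n -> m' Xa i = m' Xa j -> i = j &
     forall j u, j < n -> u < n -> fresh (m' Xa) j u ->
       weight g n B (m' Xa) j u <= weight g n B (m' Xa) j (m' Xa j)]).
Proof.
rseq (100 * n + 100).
pose I0 j m' := same mods m m' /\ forall u, u < j -> m' Va u = 0 /\ m' Wa u = n * B u.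
rfor n 40 I0.
- move=> j m' lj Ej [sm _] /=; have [E0 _ _] := same_env sm isT isT envm.
  by rewrite space_gt0 E0.
- by split=> //; do ?apply: same_upd.
- move=> j m' lj Ej [sm Hj].
  have [E0 _ _] := same_env sm isT isT envm.
  have EB : m' Ba j = B j by rewrite sm // mB.
  rseq 10; rput => //=; rewrite ?Ej; first by ix.
  rput => //=; rewrite ?Ej; rewrite /upd /= ?E0 ?EB ?Ej.
    by case: (B j) => /=; ix.
  split=> //; split; first by do ?apply: same_upd.
  by move=> u; rewrite ltnS leq_eqVlt /upd /=; case: eqP => [-> _|_ /Hj //]; rewrite EB.
move=> m1 _ [sm1 H1].
pose I1 j m' := exists2 s, size s = j & state s m' /\ marks s m'.
rfor n (200 * n + 250) I1.
- move=> j m' lj Ej [s _ [[sm _ _ _ _] _]] /=.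
  have [E0 _ _] := same_env sm isT isT envm.
  by rewrite space_gt0 E0.
- exists [::] => //; split; first by split=> //; do ?apply: same_upd.
  by move=> u lu; rewrite /upd /= /wt /weight big_ord0 addn0; apply: H1.
- move=> j m' lj Ej [s sz [[sm us ls Xs gs] mk]].
  have [E0 _ _] := same_env sm isT isT envm.
  rseq 10; rput => //=; first by ix.
  rseq (90 * n + 50).
  pose key u := (1 - (u \in s)) * (1 + wt s u).
  pose I2 i m2 := [/\ state s m2, marks s m2, m2 Jv 0 = j & m2 Bv 0 < n /\
    forall u, u < i -> key u <= key (m2 Bv 0)].
  rfor n 50 I2.
  + move=> i m2 li Ei [[sm2 _ _ _ _] _ _ _] /=.
    have [F0 _ _] := same_env sm2 isT isT envm.
    by rewrite space_gt0 F0.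
  + by split=> //; split=> //; do ?apply: same_upd.
  + move=> i m2 li Ei [[sm2 _ _ Xs2 _] mk2 Ej2 [lB maxB]].
    have [F0 _ _] := same_env sm2 isT isT envm.
    have [Vi Wi] := mk2 _ li; have [Vb Wb] := mk2 _ lB.
    rif => //=; rewrite ?Ei; first by ix.
    * rewrite Vi Wi Vb Wb => lt_key; rput => //=; rewrite ?Ei; first by ix.
      split=> //; split=> //; first by split=> //; do ?apply: same_upd.
      split=> // u; rewrite /upd /= ltnS leq_eqVlt => /predU1P[->//|/maxB le_u].
      apply: leq_trans le_u _; rewrite /key; move: lt_key.
      by case: ltnP => // /ltnW.
    * rewrite Vi Wi Vb Wb => le_key; rskip; split=> //.
      split=> //; first by split=> //; do ?apply: same_upd.
      split=> // u; rewrite /upd /= ltnS leq_eqVlt => /predU1P[->|/maxB//].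
      by rewrite /key; move: le_key; case: ltnP.
  move=> m2 _ [[sm2 _ _ Xs2 _] mk2 Ej2 [lB maxB]].
  set b := m2 Bv 0 in lB maxB.
  (* Some vertex is unvisited because [s] has only [j < n] entries; its positive key forces the
     maximum to be unvisited. *)
  have nsb : b \notin s /\ forall u, u < n -> u \notin s -> wt s u <= wt s b.
    have [v lv nsv] : exists2 v, v < n & v \notin s.
      have [/allP all_s|/allPn[v]] := boolP (all (mem s) (iota 0 n)).
        have := uniq_leq_size (iota_uniq 0 n) all_s; rewrite size_iota sz => le_n.
        by exfalso; lia.
      by rewrite mem_iota; exists v.
    have nsb : b \notin s.
      by apply/negP => sb; have := maxB v lv; rewrite /key sb (negbTE nsv); lia.
    by split=> // u lu nsu; have := maxB u lu; rewrite /key (negbTE nsu) (negbTE nsb); lia.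
  have [nsb1 maxb] := nsb.
  have s'_nth i : i < (size s).+1 -> nth 0 (rcons s b) i = if i == j then b else nth 0 s i.
    by rewrite nth_rcons sz => li; case: (ltngtP i j) => //; lia.
  have gs' : greedy (rcons s b).
    move=> i u; rewrite size_rcons ltnS leq_eqVlt => /predU1P[->|li] lu.
      rewrite -cats1 take_size_cat // nth_cat ltnn subnn /=; exact: maxb.
    by rewrite -cats1 (takel_cat _ (ltnW li)) nth_cat li => nsu; apply: gs.
  have wt' u : wt (rcons s b) u = wt s u + g b u.
    rewrite /wt /weight size_rcons big_ord_recr /= nth_rcons ltnn eqxx addnA.
    by congr (_ + _ + _); apply: eq_bigr => i _; rewrite nth_rcons ltn_ord.
  rseq 10; rput => //=; rewrite ?Ej2; first by ix.
  rseq 10; rput => //=; first by rewrite /upd /= -/b; ix.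
  have Eb x y z : upd (upd m2 Xa x y) Va z 1 Bv 0 = b by [].
  rewrite /= -!/b.
  have -> : upd m2 20 j b 13 0 = b by [].
  pose I3 i m3 := [/\ state (rcons s b) m3, m3 Jv 0 = j, m3 Bv 0 = b,
    forall u, u < n -> m3 Va u = (u \in rcons s b) &
    forall u, u < n -> m3 Wa u = wt s u + (u < i) * g b u].
  rfor n 50 I3.
  + move=> i m3 li Ei [[sm3 _ _ _ _] *] /=.
    have [F0 _ _] := same_env sm3 isT isT envm.
    by rewrite space_gt0 F0.
  + split=> //.
    * split=> //; first by do ?apply: same_upd.
      - by rewrite rcons_uniq nsb1.
      - by rewrite all_rcons ls andbT.
      - move=> i; rewrite size_rcons => li; rewrite s'_nth // /upd /=.
        by case: eqP => //= ne; apply: Xs2; lia.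
    * move=> u lu; rewrite /upd /= mem_rcons in_cons.
      have [-> _] := mk2 _ lu; by case: (u == b).
    * by move=> u lu; rewrite /upd /= addn0; have [_ ->] := mk2 _ lu.
  + move=> i m3 li Ei [[sm3 us3 ls3 Xs3 gs3] Ej3 Eb3 V3 W3].
    have [F0 _ F2] := same_env sm3 isT isT envm.
    have := wt_le s i; rewrite sz => wli.
    rput => //=; rewrite ?Ei ?Eb3 ?F0 ?F2 ?W3 //.
      by rewrite ltnn mul0n addn0; case: (g b i) => /=; ix.
    rewrite ltnn mul0n addn0; split=> //; split=> //.
      by split=> //; do ?apply: same_upd.
    move=> u lu; rewrite /upd /= ltnS.
    have [->|nui] := eqVneq u i; first by rewrite leqnn mul1n.
    by rewrite W3 // (leq_eqVlt u) (negbTE nui).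
  move=> m3 _ [st3 Ej3 Eb3 V3 W3]; split=> //.
  exists (rcons s b); first by rewrite size_rcons sz.
  split; first by case: st3 => *; split=> //; do ?apply: same_upd.
  move=> u lu; split; first exact: V3.
  by rewrite wt' /upd /= W3 // lu mul1n.
move=> m' _ [s sz [[sm us ls Xs gs] _]].
have XE j : j < n -> m' Xa j = nth 0 s j by rewrite -sz; apply: Xs.
have wE j u : j <= n -> weight g n B (m' Xa) j u = wt (take j s) u.
  move=> lj; rewrite /wt /weight size_takel ?sz //; congr (_ + _).
  by apply: eq_bigr => i _; rewrite nth_take // XE //; apply: leq_trans lj.
split=> // [j lj|i j li lj|j u lj lu fu].
- by rewrite XE //; apply: (allP ls); rewrite mem_nth ?sz.
- by rewrite !XE // => /eqP; rewrite nth_uniq ?sz // => /eqP.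
- rewrite !wE ?(ltnW lj) // XE //; apply: gs; rewrite ?sz //.
  apply/negP => /(nthP 0)[i]; rewrite size_takel ?sz ?(ltnW lj) // => li.
  rewrite nth_take // => Ei; have := fu i li.
  by rewrite XE ?Ei ?eqxx //; apply: ltn_trans lj.
Qed.
End Mcs.

Section Center.
Variables (m : store).
Hypotheses (envm : env m) (lX : forall j, j < n -> m Xa j < n)
  (X_inj : forall i j, i < n -> j < n -> m Xa i = m Xa j -> i = j) (k_lt : k < n).
Let e : rel nat := fun i j => g (m Xa i) (m Xa j).
Hypotheses (e_rooted : rooted e n)
  (mA : forall i j, i < n -> j < n -> m Aa (i * n + j) = anc e i j).

Let mods := [:: Iv; Jv; Sv; Cv; bv; Ba].
Let subtree c := \sum_(j < n) anc e c j.

Lemma center_runs : runs center_prog m (300 * (n * n) + 400 * n + 300) (fun m' =>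
  exists2 i0, i0 < n & [/\ same mods m m', k < subtree i0,
     (forall c, i0 < c < n -> subtree c <= k),
     (forall j, j < n -> m' Ba (m Xa j) = bag e i0 j) &
     m' bv 0 = \sum_(j < n) bag e i0 j]).
Proof.
have sum_le c i : \sum_(j < i) anc e c j <= i.
  by rewrite -[X in _ <= X]card_ord -sum1_card; apply: leq_sum => j _; case: anc.
rseq 10; rput => //=; first by ix.
rseq (200 * (n * n) + 200 * n + 100).
pose I0 j (m' : store) := [/\ same mods m m', m' Cv 0 < n, k < subtree (m' Cv 0) &
  forall c, m' Cv 0 < c < j -> subtree c <= k].
rfor n (90 * n + 90) I0.
- move=> j m' lj Ej [sm _ _ _] /=; have [E0 _ _] := same_env sm isT isT envm.
  by rewrite space_gt0 E0.
- split=> //; rewrite /upd /=; try lia; first by do 2?apply: same_upd.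
  have -> // : subtree 0 = n.
  rewrite /subtree (eq_bigr (fun=> 1)) ?sum_nat_const ?card_ord ?muln1 //.
  by move=> i _; rewrite (root_anc e_rooted).
- move=> j m' lj Ej [sm lC kC HC].
  rseq 10; rput => //=; first by ix.
  rseq (70 * n + 40).
  pose I1 i (m1 : store) := [/\ I0 j m1, m1 Jv 0 = j & m1 Sv 0 = \sum_(i' < i) anc e j i'].
  rfor n 40 I1.
  + move=> i m1 li Ei [[sm1 _ _ _] _ _] /=.
    have [F0 _ _] := same_env sm1 isT isT envm.
    by rewrite space_gt0 F0.
  + split; [split=> //; by do 2?apply: same_upd | by [] | by rewrite big_ord0].
  + move=> i m1 li Ei [[sm1 lC1 kC1 HC1] Ej1 ES].
    have [F0 _ _] := same_env sm1 isT isT envm.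
    have EA : m1 Aa (j * n + i) = anc e j i by rewrite sm1 // mA.
    have := sum_le j i.+1; rewrite big_ord_recr /= => le_s.
    rput => //=; rewrite ?Ei ?Ej1 ?F0 ?EA ?ES; first by ix.
    split=> //; split=> //; first by split=> //; do 2?apply: same_upd.
    by rewrite big_ord_recr.
  move=> m1 _ [[sm1 lC1 kC1 HC1] Ej1 ES].
  have [_ F1 _] := same_env sm1 isT isT envm.
  rif => //=; first by ix.
  + rewrite F1 ES -/(subtree j) => lt_k; rput => //=; rewrite ?Ej1; first by ix.
    split=> //; split=> //; rewrite /upd /=; first by do 2?apply: same_upd.
      by case: ltnP lt_k.
    by move=> c; lia.
  + rewrite F1 ES -/(subtree j) => le_k; rskip; split=> //.
    split=> //; first by do 2?apply: same_upd.
    move=> c; rewrite /upd /= ltnS (leq_eqVlt c) => /andP[lc /predU1P[->|lcj]].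
      by case: ltnP le_k.
    by apply: HC1; rewrite lc.
move=> m1 _ [sm1 lC kC HC]; set i0 := m1 Cv 0 in lC kC HC.
rseq 10; rput => //=; first by ix.
pose I2 j (m2 : store) := [/\ same mods m m2, m2 Cv 0 = i0,
  (forall j', j' < j -> m2 Ba (m Xa j') = bag e i0 j') &
  m2 bv 0 = \sum_(j' < j) bag e i0 j'].
rfor n 90 I2.
- move=> j m2 lj Ej [sm2 _ _ _] /=.
  have [F0 _ _] := same_env sm2 isT isT envm.
  by rewrite space_gt0 F0.
- by split=> //; [do 2?apply: same_upd | rewrite big_ord0].
- move=> j m2 lj Ej [sm2 EC HB Eb].
  have [F0 _ F2] := same_env sm2 isT isT envm.
  have XE i : m2 Xa i = m Xa i by rewrite sm2.
  have [lj' l0'] := (lX lj, lX lC).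
  have Ebag : (j == i0) + (j < i0) * g (m Xa j) (m Xa i0) = bag e i0 j.
    by rewrite /bag /e; case: (ltngtP j i0); case: g.
  have bag_le i : \sum_(j' < i) bag e i0 j' <= i.
    by rewrite -[X in _ <= X]card_ord -sum1_card; apply: leq_sum => l _; case: bag.
  rseq 40; rput => //=; rewrite ?Ej ?EC ?XE ?F0 ?F2 ?Ebag //.
    by case: bag => /=; ix.
  rput => //=; rewrite /upd /= ?Ej ?XE ?Eb ?eqxx.
    by have := bag_le j.+1; rewrite big_ord_recr /= => le_b; ix.
  split=> //; split=> //.
  + by do 4?apply: same_upd.
  + move=> j'; rewrite ltnS leq_eqVlt /upd /= => /predU1P[->|lj2]; first by rewrite eqxx.
    by case: eqP => [/X_inj Ejj|_]; [have := Ejj (ltn_trans lj2 lj) lj; lia | apply: HB].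
  + by rewrite big_ord_recr.
move=> m2 _ [sm2 EC HB Eb].
by exists i0.
Qed.
End Center.

Lemma output_runs m : env m -> (forall j, j < n -> m Xa j < n) ->
    (forall i j, i < n -> j < n -> m Xa i = m Xa j -> i = j) ->
    (forall j, j < n -> m Pa j < n) ->
  runs output_prog m (60 * n + 100) (fun m' =>
    [/\ m' 2 0 = 1, m' 2 1 = m Xa 0 & forall j, j < n -> m' 3 (m Xa j) = m Xa (m Pa j)]).
Proof.
move=> envm lX X_inj lP; pose mods := [:: 2; 3; Jv].
rseq 10; rput => //=; first by ix.
rseq 10; rput => /=; first by have := lX 0 n_gt0; rewrite /upd /=; ix.
pose I0 j (m' : store) := [/\ same mods m m', m' 2 0 = 1, m' 2 1 = m Xa 0 &
  forall j', j' < j -> m' 3 (m Xa j') = m Xa (m Pa j')].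
rfor n 30 I0.
- move=> j m' lj Ej [sm _ _ _] /=; have [E0 _ _] := same_env sm isT isT envm.
  by rewrite space_gt0 E0.
- by split=> //; do ?apply: same_upd.
- move=> j m' lj Ej [sm E20 E21 H3].
  have [lXj lPj] := (lX _ lj, lP _ lj); have lXP := lX _ lPj.
  have XE i : m' Xa i = m Xa i by rewrite sm.
  have PE i : m' Pa i = m Pa i by rewrite sm.
  rput => //=; rewrite ?Ej ?PE ?XE; first by ix.
  split=> //; split=> //; first by do 2?apply: same_upd.
  move=> j'; rewrite ltnS leq_eqVlt /upd /= => /predU1P[->|lj2]; first by rewrite eqxx.
  by case: eqP => [/X_inj Ejj|_]; [have := Ejj (ltn_trans lj2 lj) lj; lia | apply: H3].
by move=> m' _ [].
Qed.

Definition holds (a c : nat) (s : seq nat) (m : store) : Prop :=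
  m c 0 = size s /\ forall i, i < size s -> m a i = nth 0 s i.

Lemma push_runs a c e s v m T (Q : store -> Prop) :
    a != c -> small e -> idx_ok space m e -> den m e = v -> expr_cost e + 20 <= T ->
    holds a c s m -> size s <= n -> v <= n ->
    (forall m', holds a c (rcons s v) m' -> same [:: a; c] m m' -> Q m') ->
  runs (push_prog a c e) m T Q.
Proof.
move=> nac se ie De le_T [Ec Ea] ls lv HQ.
have Dc : upd m a (m c 0) v c 0 = m c 0 by rewrite /upd eq_sym (negbTE nac).
apply: (@runs_seq _ _ _ _ _ _ (expr_cost e + 10)); first by lia.
apply: (runs_put Z_ge8 Z_bound space_gt0) => /=; rewrite ?De //.
- by rewrite ie Ec; ix.
- by rewrite addnC; lia.
apply: (runs_put Z_ge8 Z_bound space_gt0) => //=; rewrite ?Dc ?Ec.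
- by ix.
- by lia.
apply: HQ.
- split=> [|i]; rewrite size_rcons.
    by rewrite /upd !eqxx /= addn1.
  rewrite ltnS nth_rcons /upd (negbTE nac) eqxx /= => li.
  by case: (ltngtP i (size s)) li => // li _; rewrite ?Ea.
- by do 2?[apply: same_upd; first by rewrite !inE eqxx ?orbT].
Qed.

Section Reps.
Variables (B : pred nat) (m : store).
Hypotheses (envm : env m) (mB : forall u, u < n -> m Ba u = B u)
  (mb : m bv 0 = \sum_(u < n) B u).

Let mods := [:: qv; uv; cv; ev; Rv; Iv; Jv; Ua].
Let R := [seq v <- iota 0 n | ~~ B v].
Let q := n - \sum_(u < n) B u.

Lemma size_others : size R = q.
Proof.
rewrite size_filter /q -count_sum -[X in X - _](size_iota 0 n).
by rewrite -(count_predC B (iota 0 n)) addKn.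
Qed.

Lemma reps_runs um : reps_bound k q <= um ->
  runs reps_prog m (n * (um * (100 * q + 100) + 300) + 300 * n + 300) (fun m' =>
  [/\ same mods m m', m' qv 0 = q & exists2 s, holds Ua uv s m' &
    [/\ uniq s, all (ltn^~ n) s, forall v, v < n -> ~~ B v -> v \in s,
      forall v, v < n -> B v -> v \in s \/ 5 * k + q <= count (same_type g R v) s &
      size s <= um]]).
Proof.
move=> le_um.
have lqn : q <= n by rewrite /q; lia.
have lRn i : i < q -> nth 0 R i < n.
  by rewrite -size_others => /(mem_nth 0); rewrite mem_filter mem_iota => /and3P[].
have lB i : \sum_(u < i) B u <= i.
  by rewrite -[X in _ <= X]card_ord -sum1_card; apply: leq_sum => u _; case: (B u).
have lBn := lB n.
have [E0 E1 E2] := envm.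
rseq 10; rput => /=; rewrite ?E0 ?mb; first by ix.
rseq 10; rput => /=; first by ix.
rseq (90 * n + 60).
pose I0 j (m' : store) := [/\ same mods m m', m' qv 0 = q &
  holds Ua uv [seq v <- iota 0 j | ~~ B v] m'].
have size_le (P : pred nat) j : size [seq v <- iota 0 j | P v] <= j.
  by rewrite size_filter -{2}(size_iota 0 j) count_size.
rfor n 60 I0.
- move=> j m' lj Ej [sm _ _] /=; have [F0 _ _] := same_env sm isT isT envm.
  by rewrite space_gt0 F0.
- split=> //; first by do ?apply: same_upd.
- move=> j m' lj Ej [sm Eq hU].
  have EB : m' Ba j = B j by rewrite sm // mB.
  rif => /=; rewrite ?Ej; first by ix.
  + rewrite EB => nBj; rskip; split=> //; split=> //; first by do ?apply: same_upd.
    by rewrite iotaS filter_rcons; case: (B j) nBj.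
  + rewrite EB => nBj; apply: (push_runs (v := j)) hU _ _ _ => //=.
    * by apply: leq_trans (size_le _ j) _; lia.
    * by lia.
    move=> m1 hU1 sm1; split; first by rewrite sm1.
    split.
    * apply: same_upd => //; apply: same_trans sm sm1 => //.
      by move=> x; rewrite !inE; case/orP => ->; rewrite ?orbT.
    * by rewrite /upd /= sm1.
    * by rewrite iotaS filter_rcons; case: (B j) nBj.
move=> m1 _ [sm1 Eq1 hU1].
(* Types are bounded on [s2] alone, for [types_bound]. The program counts over the whole list, so
   its test implies the one for [s2]. *)
pose I1 j (m' : store) := [/\ same mods m m', m' qv 0 = q &
  exists2 s2, holds Ua uv (R ++ s2) m' &
  [/\ uniq (R ++ s2), all (ltn^~ n) (R ++ s2), forall v, v \in s2 -> v < j,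
    forall v, v < j -> B v -> v \in R ++ s2 \/ 5 * k + q <= count (same_type g R v) (R ++ s2) &
    forall w, count (same_type g R w) s2 <= 5 * k + q]].
have size_um s2 : (forall w, count (same_type g R w) s2 <= 5 * k + q) -> size (R ++ s2) <= um.
  move=> /types_bound; rewrite size_cat size_others => le_s2.
  by apply: leq_trans le_um; rewrite leq_add2l.
rfor n (um * (100 * q + 100) + 200) I1.
- move=> j m' lj Ej [sm _ _] /=; have [F0 _ _] := same_env sm isT isT envm.
  by rewrite space_gt0 F0.
- split=> //; first by do ?apply: same_upd.
  exists [::]; rewrite cats0 //; split=> //.
    by rewrite filter_uniq ?iota_uniq.
  by apply/allP => v; rewrite mem_filter mem_iota => /and3P[].
- move=> j m' lj Ej [sm Eq [s2 hU [us ls lts2 Hrep Hcnt]]].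
  set s := R ++ s2 in hU us ls Hrep.
  have EB : m' Ba j = B j by rewrite sm // mB.
  have l_sum : size s <= um by apply: size_um.
  have l_sn : size s <= n.
    rewrite -(size_iota 0 n); apply: uniq_leq_size => // v /(allP ls).
    by rewrite mem_iota.
  have sR r : r < q -> nth 0 s r = nth 0 R r.
    by move=> lr; rewrite nth_cat size_others lr.
  have [F0 F1 F2] := same_env sm isT isT envm.
  rif => /=; rewrite ?Ej; first by ix.
  + rewrite EB => Bj; have {}Bj : B j by case: (B j) Bj.
    rseq 10; rput => /=; first by ix.
    have l_mul : size s * (100 * q + 100) <= um * (100 * q + 100).
      by rewrite leq_mul2r l_sum orbT.
    rseq (size s * (100 * q + 100) + 60).
    pose J1 i (m2 : store) := [/\ same mods m m2, m2 qv 0 = q, m2 Jv 0 = j,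
      holds Ua uv s m2 & m2 cv 0 = count (same_type g R j) (take i s)].
    rfor (size s) (90 * q + 70) J1.
    * by move=> i m2 li Ei [_ _ _ [Eu _] _] /=; rewrite Eu space_gt0.
    * by split=> //; [do ?apply: same_upd | rewrite take0].
    * move=> i m2 li Ei [sm2 Eq2 Ej2 hU2 Ec2].
      have [Eu2 EU2] := hU2.
      have lsi : nth 0 s i < n by apply: (allP ls); apply: mem_nth.
      rseq 10; rput => /=; first by ix.
      rseq (90 * q + 30).
      pose J2 r (m3 : store) := [/\ same mods m m3, m3 qv 0 = q, m3 Jv 0 = j, m3 Iv 0 = i &
        [/\ holds Ua uv s m3, m3 cv 0 = count (same_type g R j) (take i s) &
        m3 ev 0 = all (fun r => g (nth 0 s i) (nth 0 R r) == g j (nth 0 R r)) (iota 0 r)]].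
      rfor q 60 J2.
      - by move=> r m3 lr Er [_ Eq3 *] /=; rewrite space_gt0.
      - by split=> //; do ?apply: same_upd.
      - move=> r m3 lr Er [sm3 Eq3 Ej3 Ei3 [hU3 Ec3 Ee3]].
        have [Eu3 EU3] := hU3.
        have [K0 _ K2] := same_env sm3 isT isT envm.
        have lRr := lRn _ lr.
        have lrs : r < size s by rewrite size_cat size_others; lia.
        rput => /=; rewrite ?Ei3 ?Ej3 ?Er ?K0 ?Ee3 !EU3 // (sR r lr) !K2 //.
          rewrite eq_nat_of_bool mulnb.
          have l1 b : nat_of_bool b <= Z by case: b; lia.
          by rewrite l1; ix.
        split=> //; split=> //; first by do ?apply: same_upd.
        split=> //; rewrite iotaS all_rcons /upd /=.
        by rewrite eq_nat_of_bool mulnb andbC.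
      move=> m3 Er [sm3 Eq3 Ej3 Ei3 [hU3 Ec3 Ee3]].
      have Ety : all (fun r => g (nth 0 s i) (nth 0 R r) == g j (nth 0 R r)) (iota 0 q) =
          same_type g R j (nth 0 s i).
        by rewrite /same_type -[in RHS](mkseq_nth 0 R) all_map size_others.
      rewrite Ety in Ee3.
      have le_c : count (same_type g R j) (take i s) <= i.
        by apply: leq_trans (count_size _ _) _; rewrite size_take_min geq_minl.
      rput => /=; rewrite ?Ec3 ?Ee3.
        by case: (same_type _ _ _) => /=; ix.
      split=> //; split=> //; first by do ?apply: same_upd.
      by rewrite /upd /= (take_nth 0 li) -cats1 count_cat /= addn0.
    move=> m2 _ [sm2 Eq2 Ej2 hU2]; rewrite take_size => Ec2.
    have [K0 K1 K2] := same_env sm2 isT isT envm.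
    rif => /=.
    * by ix.
    * rewrite Ec2 K1 Eq2; case: ltnP => // lt_c _.
      have njs : j \notin s.
        rewrite mem_cat mem_filter Bj /=; apply/negP => /lts2; lia.
      apply: (push_runs (v := j)) hU2 _ _ _ => //=.
      - by lia.
      - by lia.
      move=> m3 hU3 sm3; split; first by rewrite sm3.
      split.
      - apply: same_upd => //; apply: same_trans sm2 sm3 => //.
        by move=> x; rewrite !inE; case/orP => ->; rewrite ?orbT.
      - by rewrite /upd /= sm3.
      exists (rcons s2 j); first by rewrite -rcons_cat.
      have cnt_rcons (P : pred nat) t : count P (rcons t j) = count P t + P j.
        by rewrite -cats1 count_cat /= addn0.
      rewrite -rcons_cat -/s; split=> //.
      - by rewrite rcons_uniq njs.
      - by rewrite all_rcons /= lj.
      - by move=> v; rewrite mem_rcons in_cons => /predU1P[->//|/lts2]; lia.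
      - move=> v; rewrite ltnS leq_eqVlt => /predU1P[-> _|lv Bv].
          by left; rewrite mem_rcons mem_head.
        case: (Hrep v lv Bv) => [sv|le_cv]; [left | right].
          by rewrite mem_rcons in_cons sv orbT.
        by rewrite cnt_rcons; lia.
      - move=> w; rewrite cnt_rcons; have [tw|_] := boolP (same_type g R w j); last first.
          by rewrite addn0.
        have Etw : same_type g R w =1 same_type g R j.
          move=> v; apply: eq_in_all => r Rr.
          by have /allP/(_ r Rr)/eqP -> := tw.
        rewrite (eq_count Etw) addn1; apply: leq_ltn_trans lt_c.
        by rewrite count_cat leq_addl.
    * rewrite Ec2 K1 Eq2; case: ltnP => // le_c _; rskip; split=> //; split=> //.
        by do ?apply: same_upd.
      exists s2 => //; split=> //; first by move=> v /lts2; lia.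
      move=> v; rewrite ltnS leq_eqVlt => /predU1P[-> _|lv Bv]; last exact: Hrep.
      by right.
  + rewrite EB => nBj; rskip; split=> //; split=> //; first by do ?apply: same_upd.
    exists s2 => //; split=> //; first by move=> v /lts2; lia.
    move=> v; rewrite ltnS leq_eqVlt => /predU1P[->|lv]; last exact: Hrep.
    by case: (B j) nBj.
move=> m2 _ [sm2 Eq2 [s2 hU2 [us ls lts Hrep Hcnt]]]; split=> //.
exists (R ++ s2) => //; split=> //; last exact: size_um.
by move=> v lv nBv; rewrite mem_cat mem_filter nBv mem_iota /= lv.
Qed.

End Reps.
Lemma runs_and e (a b : bool) m T (Q : store -> Prop) :
    small ($kv * e)%prog -> idx_ok space m e -> den m e = b -> m kv 0 = a ->
    expr_cost e + 10 <= T -> Q (upd m kv 0 (a && b)) ->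
  runs (and_prog e) m T Q.
Proof.
move=> se ie De Ea le_T HQ.
have l1 (c : bool) : c <= Z by case: c; lia.
apply: (runs_put Z_ge8 Z_bound space_gt0) => //=; rewrite ?De ?Ea ?mulnb //.
- by rewrite ie l1; ix.
- by lia.
Qed.

Lemma runs_forall i e c N Tb (b : nat -> bool) (F : store -> Prop) (a : bool) m T
    (Q : store -> Prop) :
    small (Bin Lt (var i) e) -> N <= Z -> i != kv ->
    (forall j m', j <= N -> m' i 0 = j -> F m' -> idx_ok space m' e /\ den m' e = N) ->
    F m -> (forall m' j, F m' -> F (upd m' i 0 j)) -> m kv 0 = a ->
    (forall j m' (a' : bool), j < N -> m' i 0 = j -> F m' -> m' kv 0 = a' ->
       runs c m' Tb (fun m'' => [/\ m'' i 0 = j, F m'' & m'' kv 0 = (a' && b j)])) ->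
    (forall m', F m' -> m' kv 0 = (a && all b (iota 0 N)) -> Q m') ->
    N * (Tb + expr_cost e + 20) + expr_cost e + 20 <= T ->
  runs (for_loop i e c) m T Q.
Proof.
move=> se lN nik bnd Fm Fupd Ek body done le_T.
have kupd m' j : upd m' i 0 j kv 0 = m' kv 0.
  by rewrite /upd eq_sym (negbTE nik).
pose I j (m' : store) := F m' /\ m' kv 0 = (a && all b (iota 0 j)).
apply: (runs_for Z_ge8 Z_bound space_gt0 (N := N) (Tb := Tb) (I := I)) => //.
- by move=> j m' lj Ej [Fm' _]; apply: (bnd j).
- by split; [apply: Fupd | rewrite kupd Ek andbT].
- move=> j m' lj Ej [Fm' Ek']; apply: runs_weaken (body _ _ _ lj Ej Fm' Ek') => //.
  move=> m'' [Ej'' F'' Ek'']; split=> //; split; first exact: Fupd.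
  by rewrite kupd Ek'' iotaS all_rcons -andbA [b j && _]andbC.
- by move=> m' _ [Fm' Ek']; apply: done.
Qed.

Section CheckRuns.
Variables (B : pred nat) (m : store) (N t : nat).
Hypotheses (envm : env m) (mB : forall u, u < n -> m Ba u = B u)
  (mN : m Nv 0 = N) (lN : N <= n) (mt : m tv 0 = t) (lt_t : t < N)
  (lX : forall j, j < N -> m Xa j < n).

Let mods := [:: Iv; Jv; Sv; cv; kv; Ma; Pa; Aa].
Let x := mkseq (m Xa) N.
Let e := seq_adj g x.

Lemma check_runs : runs check_prog m
  (500 * (N * N) + 500 * (n * N) + 1000 * n + 1000 * N + 1000) (fun m' =>
    [/\ same mods m m', m' kv 0 = check n k g B x t &
        forall v, v < n -> m' Ma v = (v \in x)]).
Proof.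
have sx : size x = N by rewrite size_mkseq.
have xE j : j < N -> nth 0 x j = m Xa j by move=> lj; rewrite nth_mkseq.
have memx v : (v \in x) = (v \in [seq m Xa i | i <- iota 0 N]) by [].
rseq 10; rput => /=; first by ix.
rseq (60 * n + 60 * N + 100).
rseq (50 * n + 40).
pose I0 j (m' : store) := [/\ same mods m m', m' kv 0 = 1 & forall v, v < j -> m' Ma v = 0].
rfor n 20 I0.
- move=> j m' lj Ej [sm _ _] /=; have [F0 _ _] := same_env sm isT isT envm.
  by rewrite space_gt0 F0.
- by split=> //; do ?apply: same_upd.
- move=> j m' lj Ej [sm Ek M0].
  rput => /=; rewrite ?Ej; first by ix.
  split=> //; split=> //; first by do ?apply: same_upd.
  by move=> v; rewrite ltnS leq_eqVlt /upd /=; case: eqP => //= _ /M0.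
move=> m1 _ [sm1 Ek1 M1].
pose I1 j (m' : store) := [/\ same mods m m', m' kv 0 = 1 &
  forall v, v < n -> m' Ma v = (v \in [seq m Xa i | i <- iota 0 j])].
rfor N 20 I1.
- by move=> j m' lj Ej [sm _ _] /=; rewrite space_gt0 sm.
- by split=> //; do ?apply: same_upd.
- move=> j m' lj Ej [sm Ek Mj].
  have lXj := lX lj; have XE : m' Xa j = m Xa j by rewrite sm.
  rput => /=; rewrite ?Ej ?XE; first by ix.
  split=> //; split=> //; first by do ?apply: same_upd.
  move=> v lv; rewrite iotaS map_rcons mem_rcons in_cons /upd /=.
  by case: eqP => //= _; apply: Mj.
move=> m2 _ [sm2 Ek2 Mk]; rewrite -/x in Mk.
rseq 10; rput => /=; first by ix.
rseq (100 * n + 40).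
pose F0 (m' : store) := same mods m m' /\ forall v, v < n -> m' Ma v = (v \in x).
pose I2 j (m' : store) := [/\ F0 m', m' cv 0 = \sum_(v < j) (nat_of_ord v \in x) &
  m' kv 0 = all (fun v => (v \in x) || B v) (iota 0 j)].
rfor n 60 I2.
- move=> j m' lj Ej [[sm _] _ _] /=; have [K0 _ _] := same_env sm isT isT envm.
  by rewrite space_gt0 K0.
- by split=> //; [split=> //; do ?apply: same_upd | rewrite big_ord0].
- move=> j m' lj Ej [[sm Mj] Ec Ek].
  have EB : m' Ba j = B j by rewrite sm // mB.
  have le_c i : \sum_(v < i) (nat_of_ord v \in x) <= i.
    by rewrite -[X in _ <= X]card_ord -sum1_card; apply: leq_sum => u _; case: (_ \in x).
  have := le_c j.+1; rewrite big_ord_recr /= => le_cj.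
  rseq 10; rput => /=; rewrite ?Ej ?Ec ?Mj //; first by ix.
  apply: (runs_and (a := all (fun v => (v \in x) || B v) (iota 0 j))
            (b := (j \in x) || B j)) => //=; rewrite /upd /= ?Ej ?Mj ?EB //.
  + by ix.
  + by case: (j \in x); case: (B j).
  split=> //; split=> //.
  + by split=> //; do ?apply: same_upd.
  + by rewrite big_ord_recr /=.
  + by rewrite iotaS all_rcons /upd /= andbC.
move=> m3 _ [[sm3 M3] Ec3 Ek3].
have EN3 : m3 Nv 0 = N by rewrite sm3.
set c1 := all _ _ in Ek3; set sumx := \sum_(v < n) _ in Ec3.
rseq 20.
apply: (runs_and (a := c1) (b := sumx == N)) => //=; first by ix.
  by rewrite Ec3 EN3.
set m4 := upd m3 kv 0 _; have sm4 : same mods m m4 by do ?apply: same_upd.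
have env4 : env m4 by exact: same_env sm4 isT isT envm.
rseq (200 * (N * N) + 200 * N + 200).
have X4 j : m4 Xa j = m Xa j by rewrite sm4.
have lX4 j : j < N -> m4 Xa j < n by rewrite X4; apply: lX.
apply: runs_weaken (tree_runs env4 lN _ lX4) => //.
move=> m5 [sm5' HP' HA'].
have sm5 : same mods m m5.
  apply: same_trans sm4 sm5' => // a; rewrite !inE.
  by do ?[case/orP]; move=> ->; rewrite ?orbT.
have ek5 : m5 kv 0 = (c1 && (sumx == N)) by rewrite sm5' // /m4 /upd /=.
have M5 v : v < n -> m5 Ma v = (v \in x) by move=> lv; rewrite sm5' // /m4 /upd /= M3.
have eE a b : a < b < N -> e a b = g (m4 Xa a) (m4 Xa b).
  by move=> lab; rewrite /e /seq_adj !xE ?X4 //; lia.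
have HP j : j < N -> m5 Pa j = par e j.
  by move=> lj; rewrite HP' // (par_ext (N := N) (e' := e)) // => a b lab; apply/esym/eE.
have HA i j : i < N -> j < N -> m5 Aa (i * n + j) = anc e i j.
  by move=> li lj; rewrite HA' // (anc_ext (N := N) (e' := e)) // => a b lab; apply/esym/eE.
have [E50 E51 E52] := same_env sm5 isT isT envm.
have [X5 N5 t5 B5] : [/\ m5 Xa =1 m Xa, m5 Nv 0 = N, m5 tv 0 = t & forall v, v < n -> m5 Ba v = B v].
  by split=> [j|||v lv]; rewrite sm5 // mB.
pose mods2 := [:: Iv; Jv; Sv; kv].
set c3 := fun j => [&& (j == 0) || (par e j < j), (t < j) || (par e j == j.-1),
             all (fun i => (i < j) && e i j ==> anc e i j) (iota 0 N) &
             depth e N j <= N - k].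
have sum_le j i : \sum_(l < i) anc e l j <= i.
  by rewrite -[X in _ <= X]card_ord -sum1_card; apply: leq_sum => l _; case: anc.
rseq (200 * (N * N) + 300 * N + 60).
pose F5 (m' : store) := same mods2 m5 m'.
apply: (runs_forall (N := N) (Tb := 180 * N + 250) (b := c3) (F := F5)
          (a := c1 && (sumx == N))) => //.
- by nlia.
- by move=> j m' lj Ej sm /=; rewrite space_gt0 sm.
- by move=> m' j Fm'; apply: same_upd.
- move=> j m' a lj Ej sm Ek.
  have Pj : m' Pa j = par e j by rewrite sm // HP.
  have lp := par_le e j.
  rseq 30.
  apply: (runs_and (a := a) (b := (j == 0) || (par e j < j))) => //=; rewrite ?Ej ?Pj //.
  + by ix.
  + by case: j {Ej Pj lj lp} => // j.
  rseq 50.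
  apply: (runs_and (a := a && ((j == 0) || (par e j < j)))
           (b := (t < j) || (par e j == j.-1))) => //=; rewrite /upd /= ?Ej ?Pj //.
  + by ix.
  + have -> : m' tv 0 = t by rewrite sm.
    by rewrite subn1; case: (t < j); case: (_ == _).
  set a2 := (_ && _) && _; set m6 := (fun _ => _).
  have sm6 : same mods2 m5 m6 by do 2?apply: (same_upd (a := kv)).
  rseq 10; rput => /=; first by ix.
  rseq (150 * N + 60).
  pose F6 (m'' : store) := same mods2 m5 m'' /\ m'' Jv 0 = j.
  pose I6 i (m'' : store) := [/\ F6 m'', m'' Sv 0 = \sum_(l < i) anc e l j &
    m'' kv 0 = (a2 && all (fun i => (i < j) && e i j ==> anc e i j) (iota 0 i))].
  rfor N 90 I6.
  + by move=> i m'' li Ei [[sm'' _] _ _] /=; rewrite space_gt0 sm''.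
  + split=> //; first by split=> //; do ?apply: same_upd.
      by rewrite big_ord0.
    by rewrite /upd /= andbT.
  + move=> i m'' li Ei [[sm'' Ej''] ES Ek''].
    have [K0 K1 K2] := same_env sm'' isT isT (And3 E50 E51 E52).
    have XE l : m'' Xa l = m Xa l by rewrite sm'' // X5.
    have EA : m'' Aa (i * n + j) = anc e i j by rewrite sm'' // HA.
    have [lXi lXj] := (lX li, lX lj).
    have := sum_le j i.+1; rewrite big_ord_recr /= => le_s.
    rseq 30; rput => /=; rewrite ?Ei ?Ej'' ?K0 ?ES ?EA; first by ix.
    apply: (runs_and (a := a2 && all (fun i => (i < j) && e i j ==> anc e i j) (iota 0 i))
             (b := (i < j) && e i j ==> anc e i j)) => //=; rewrite /upd /= ?Ei ?Ej'' ?K0 ?XE //.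
    * by ix.
    * rewrite K2 // EA; have [lij|//] := ltnP i j.
      rewrite /e /seq_adj !xE // -/g.
      by case: (g (m Xa i) (m Xa j)); case: anc.
    split=> //; split=> //.
    * by split=> //; do ?apply: same_upd.
    * by rewrite big_ord_recr.
    * by rewrite iotaS all_rcons -andbA [(_ ==> _) && _]andbC.
  move=> m7 _ [[sm7 Ej7] ES7 Ek7].
  have [_ K1 _] := same_env sm7 isT isT (And3 E50 E51 E52).
  apply: (runs_and _ _ _ Ek7 (b := depth e N j <= N - k)) => //=.
  + by ix.
  + by rewrite K1 ES7 sm7 // N5 -/(depth e N j); case: ltnP.
  + by nlia.
  split=> //; first by do ?apply: same_upd.
  by rewrite /c3 /upd /= /a2 !andbA.
move=> m6 sm6 Ek6.
set a6 := _ && all c3 _ in Ek6.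
set c4 := fun v => (v \in x) || [&& g v (nth 0 x t), (0 < t) ==> g v (nth 0 x t.-1) &
             all (fun j => (t <= j) && g v (nth 0 x j) ==> anc e t j) (iota 0 N)].
pose F6 (m' : store) := same mods2 m5 m'.
apply: (runs_forall (N := n) (Tb := 120 * N + 250) (b := c4) (F := F6) (a := a6)) => //.
- by nlia.
- by move=> j m' lj Ej sm /=; rewrite space_gt0 sm // E50.
- by move=> m' j Fm'; apply: same_upd.
- move=> j m' a lj Ej sm Ek.
  have [K0 K1 K2] := same_env sm isT isT (And3 E50 E51 E52).
  have XE l : m' Xa l = m Xa l by rewrite sm // X5.
  have Et : m' tv 0 = t by rewrite sm.
  have Mj : m' Ma j = (j \in x) by rewrite sm // M5.
  have lXt := lX lt_t; have lt_t1 : t.-1 < N := leq_ltn_trans (leq_pred t) lt_t.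
  have lXt1 := lX lt_t1.
  rif => /=; rewrite ?Ej; first by ix.
    rewrite Mj => xj; rskip; split=> //.
    by rewrite /c4; case: (j \in x) xj; rewrite ?andbT.
  rewrite Mj => nxj; rseq 50.
  apply: (runs_and (a := a) (b := g j (nth 0 x t))) => //=; rewrite ?Ej ?K0 ?Et ?XE //.
  + by ix.
  + by rewrite K2 // xE.
  rseq 50.
  apply: (runs_and (a := a && g j (nth 0 x t)) (b := (0 < t) ==> g j (nth 0 x t.-1))) => //=;
    rewrite /upd /= ?Ej ?K0 ?Et ?XE ?subn1 //.
  + by ix.
  + rewrite K2 // xE //; case: (0 < t) => //.
    by rewrite mul1n -/g; case: (g j (m Xa t.-1)).
  set a2 := (_ && _) && _.
  pose F7 (m'' : store) := same mods2 m5 m'' /\ m'' Jv 0 = j.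
  apply: (runs_forall (N := N) (Tb := 80)
    (b := fun j' => (t <= j') && g j (nth 0 x j') ==> anc e t j') (F := F7) (a := a2)) => //.
  + by nlia.
  + by move=> i m'' li Ei [sm'' _] /=; rewrite space_gt0 sm''.
  + by split=> //; do ?apply: same_upd.
  + by move=> m'' i [sm'' Ej'']; split=> //; apply: same_upd.
  + move=> i m'' a' li Ei [sm'' Ej''] Ek''.
    have [G0 G1 G2] := same_env sm'' isT isT (And3 E50 E51 E52).
    have XE'' l : m'' Xa l = m Xa l by rewrite sm'' // X5.
    have EA : m'' Aa (t * n + i) = anc e t i by rewrite sm'' // HA.
    have Et'' : m'' tv 0 = t by rewrite sm''.
    have lXi := lX li.
    apply: (runs_and _ _ _ Ek'' (b := (t <= i) && g j (nth 0 x i) ==> anc e t i)) => //=;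
      rewrite ?Ei ?Ej'' ?Et'' ?G0 ?XE'' //.
    * by ix.
    * rewrite G2 // EA xE // -/g (leqNgt t i); case: (i < t) => //.
      by case: (g j (m Xa i)); case: anc.
    by split=> //; split=> //; apply: same_upd.
  + move=> m'' [sm'' Ej''] Ek''; split=> //.
    rewrite Ek'' /c4; case: (j \in x) nxj => // _.
    by rewrite /a2 -!andbA.
  + by rewrite /=; nlia.
- move=> m' sm Ek; split.
  + apply: same_trans sm5 sm => // b; rewrite !inE.
    by do ?[case/orP]; move=> ->; rewrite ?orbT.
  + by rewrite Ek /check sx -/e -/c3 -/c4 /a6 -!andbA.
  + by move=> v lv; rewrite sm // M5.
- by rewrite /=; nlia.
- by rewrite /=; nlia.
Qed.
End CheckRuns.

Section Search.
Variables (B : pred nat) (m : store) (N : nat) (s : seq nat).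
Hypotheses (envm : env m) (mB : forall u, u < n -> m Ba u = B u)
  (mN : m Nv 0 = N) (N_gt0 : 0 < N) (lN : N <= n)
  (mU : holds Ua uv s m) (ls : all (ltn^~ n) s) (s_gt0 : 0 < size s)
  (s_le : size s <= n).

Let u := size s.

Let mods := [:: Jv; Xa; tv; Iv; Sv; cv; kv; Ma; Pa; Aa; ca; Da; dn].

Lemma cand_runs m1 c : same mods m m1 -> (forall j, j <= N -> m1 Da j = digit u c j) ->
  runs cand_prog m1 (60 * N + 100) (fun m' =>
    [/\ same mods m m', same [:: Jv; Xa; tv] m1 m',
       forall j, j < N -> m' Xa j = nth 0 s (digit u c j) &
       m' tv 0 = cand_place N s c]).
Proof.
move=> sm1 D1; have ld j : digit u c j < u by rewrite ltn_mod.
have Us j : j < u -> m Ua j = nth 0 s j by case: mU => _; apply.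
have s_lt j : j < u -> nth 0 s j < n by move=> lj; apply/(allP ls)/mem_nth.
rseq (60 * N + 50).
pose I0 j (m' : store) := [/\ same mods m m', same [:: Jv; Xa; tv] m1 m' &
  forall i, i < j -> m' Xa i = nth 0 s (digit u c i)].
rfor N 20 I0.
- by move=> j m' lj Ej [sm _ _] /=; rewrite space_gt0 sm.
- by split=> //; do ?apply: same_upd.
- move=> j m' lj Ej [sm sm' Xj].
  have Dj : m' Da j = digit u c j by rewrite sm' // D1 // ltnW.
  have ldj := ld j; have Uj : m' Ua (digit u c j) = nth 0 s (digit u c j) by rewrite sm // Us.
  have lsj := s_lt _ ldj.
  rput => /=; rewrite ?Ej ?Dj ?Uj; first by move: ldj s_le; rewrite -/u => ldj' s_le'; ix.
  split=> //; split=> //; do ?[by do ?apply: same_upd].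
  by move=> i; rewrite ltnS leq_eqVlt /upd /=; case: eqP => [->//|_ /Xj].
move=> m' _ [sm sm' Xj].
have DN : m' Da N = digit u c N by rewrite sm' // D1.
have EN : m' Nv 0 = N by rewrite sm.
have ldN := ld N.
have l_place : digit u c N * (digit u c N < N) <= n.
  by case: ltnP => /=; lia.
rput => /=; rewrite ?EN ?DN; first by ix.
by split=> //; do ?apply: same_upd.
Qed.

Lemma next_runs m1 c : same mods m m1 -> (forall j, j <= N -> m1 Da j = digit u c j) ->
  runs next_prog m1 (100 * N + 200) (fun m' =>
    [/\ same mods m m', same [:: Jv; ca; Da] m1 m',
       forall j, j <= N -> m' Da j = digit u c.+1 j &
       m' ca 0 = (u ^ N.+1 %| c.+1)]).
Proof.
move=> sm1 D1; have ld j : digit u c j < u by rewrite ltn_mod.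
rseq 10; rput => /=; first by ix.
pose I0 j (m' : store) := [/\ same mods m m', same [:: Jv; ca; Da] m1 m',
  forall i, i < j -> m' Da i = digit u c.+1 i,
  forall i, j <= i <= N -> m' Da i = digit u c i &
  m' ca 0 = (u ^ j %| c.+1)].
rfor (N + 1) 60 I0.
- by move=> j m' lj Ej [sm _ _ _ _] /=; rewrite space_gt0 sm //= mN.
- by split; rewrite ?expn0 ?dvd1n //; do ?apply: same_upd.
- move=> j m' lj Ej [sm sm' Dlt Dge Eca].
  have [DE cE] := @digitS u c j s_gt0.
  set a := digit u c j + _ in DE cE.
  have Dj : m' Da j = digit u c j by apply: Dge; lia.
  have Eu : m' uv 0 = u by rewrite sm //; case: mU.
  have ldj := ld j.
  have la : a <= n by rewrite /a; case: (_ %| _) => /=; move: s_le; rewrite -/u; lia.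
  rseq 15; rput => /=; rewrite ?Ej ?Dj ?Eca -/a; first by ix.
  rseq 15; rput => /=; rewrite /upd /= ?Ej ?eqxx ?Eu /=.
    by case: (a == u) => /=; ix.
  rput => /=; rewrite /upd /= ?Ej ?eqxx ?Eu /=.
    by case: (a == u) => /=; rewrite ?muln0 ?muln1; ix.
  split=> //; split=> //.
  + by do 3?apply: (same_upd (a := Da)) => //; do ?apply: same_upd.
  + by do 3?apply: (same_upd (a := Da)) => //; do ?apply: same_upd.
  + move=> i; rewrite ltnS leq_eqVlt /upd /=; case: eqP => [-> _|_ /Dlt //].
    by rewrite DE; case: (a == u).
  + move=> i lji; rewrite /upd /=; case: eqP => [Eij|_]; first by lia.
    by apply: Dge; lia.
  + by rewrite /upd /= cE.
move=> m' _ [sm sm' Dlt _ Eca]; split=> //.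
  by move=> j lj; apply: Dlt; lia.
by rewrite Eca addn1.
Qed.

Let M := u ^ N.+1.
Hypothesis mD : forall j, j <= N -> m Da j = 0.

(** Invariant: either [dn] is set and the result is there, or the digits spell [c < M] and all
    candidates before [c] have failed. *)
Lemma search_runs : runs search_prog m (M * (search_cost n N + 10) + 100) (fun m' =>
  same mods m m' /\
  ((m' kv 0 = 0 /\ forall c, c < M -> ~~ check n k g B (cand N s c) (cand_place N s c)) \/
   let x := mkseq (m' Xa) N in let t := m' tv 0 in
   [/\ m' kv 0 = 1, all (ltn^~ n) x, t < N, check n k g B x t &
      forall v, v < n -> m' Ma v = (v \in x)])).
Proof.
set Q := (fun m' : store => _).
have M_gt0 : 0 < M by rewrite expn_gt0 s_gt0.
pose I c (m' : store) := (m' dn 0 = 1 /\ Q m') \/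
  [/\ m' dn 0 = 0, c < M, same mods m m', forall j, j <= N -> m' Da j = digit u c j &
     forall c', c' < c -> ~~ check n k g B (cand N s c') (cand_place N s c')].
have lM : M * (search_cost n N + 10) + 100 - 10 >= M * (search_cost n N + 5) + 5.
  have : M * (search_cost n N + 5) <= M * (search_cost n N + 10) by rewrite leq_mul2l; nlia.
  by nlia.
rseq 10; rput => /=; first by ix.
apply: (runs_while Z_ge8 Z_bound space_gt0 (M := M) (Tb := search_cost n N) (I := I)) => //.
- by move=> c m' [[/= -> //]|[_ lc _ _ _] _].
- move=> c m' [[/= -> //]|[Ed lc sm Dm fails] _].
  rewrite /search_cost; rseq (60 * N + 100); apply: runs_weaken (cand_runs sm Dm) => //.
  move=> m1 [sm1 sm1' X1 t1].
  have env1 : env m1 by exact: same_env sm1 isT isT envm.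
  have lX1 j : j < N -> m1 Xa j < n.
    by move=> lj; rewrite X1 //; apply/(allP ls)/mem_nth; rewrite ltn_mod.
  have lt_t : cand_place N s c < N.
    by rewrite /cand_place; case: (ltnP (digit u c N) N) => [ld|_] /=; rewrite ?muln1 ?muln0.
  have B1 v : v < n -> m1 Ba v = B v by move=> lv; rewrite sm1 // mB.
  have N1 : m1 Nv 0 = N by rewrite sm1.
  have x1 : mkseq (m1 Xa) N = cand N s c.
    by apply/eq_in_map => j; rewrite mem_iota => /andP[_ lj]; apply: X1.
  rseq (500 * (N * N) + 500 * (n * N) + 1000 * n + 1000 * N + 1000).
  apply: runs_weaken (check_runs env1 B1 N1 lN t1 lt_t lX1) => //.
  move=> m2; rewrite x1 => -[sm2' k2 M2].
  have sm2 : same mods m m2.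
    apply: same_trans sm1 sm2' => // a; rewrite !inE.
    by do ?[case/orP]; move=> ->; rewrite ?orbT.
  apply: (runs_if Z_ge8 Z_bound space_gt0) => //=.
  + by nlia.
  + rewrite k2 => ck; rput => /=; first by ix.
    left; split=> //; split; first by do ?apply: same_upd.
    right; have -> : mkseq (upd m2 dn 0 1 Xa) N = cand N s c.
      by rewrite -x1; apply/eq_in_map => j _; rewrite /upd /= sm2'.
    have -> : upd m2 dn 0 1 tv 0 = cand_place N s c by rewrite /upd /= sm2'.
    rewrite /upd /= k2; have ck' : check n k g B (cand N s c) (cand_place N s c).
      by case: (check _ _ _ _ _ _) ck.
    split=> //; rewrite ?ck' //; apply/allP => v /mapP[j _ ->].
    by apply/(allP ls)/mem_nth; rewrite ltn_mod.
  + rewrite k2 => ck; have nck : ~~ check n k g B (cand N s c) (cand_place N s c).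
      by case: (check _ _ _ _ _ _) ck.
    have fails' c' : c' < c.+1 -> ~~ check n k g B (cand N s c') (cand_place N s c').
      by rewrite ltnS leq_eqVlt => /predU1P[->|/fails].
    have D2 j : j <= N -> m2 Da j = digit u c j.
      by move=> lj; rewrite sm2' // sm1' // Dm.
    rseq (100 * N + 200).
    apply: runs_weaken (next_runs sm2 D2) => //.
    move=> m3 [sm3 sm3' D3 E3].
    rput => /=.
      by rewrite E3; case: (_ %| _) => /=; ix.
    (* As [c.+1 <= M], divisibility by [M] means that [c] was the last candidate. *)
    rewrite E3; have [dv|ndv] := boolP (u ^ N.+1 %| c.+1).
      have Ec : c.+1 = M by apply/eqP; rewrite eqn_leq lc dvdn_leq.
      left; split=> //; split; first by do ?apply: same_upd.
      left; split; last by rewrite -Ec.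
      by rewrite /upd /= sm3' // k2 (negbTE nck).
    right; split=> //; last by do ?apply: same_upd.
    rewrite ltn_neqAle lc andbT; apply: contraNneq ndv => ->.
    exact: dvdnn.
- by move=> c m' [[_ //]|[/= -> //]].
- right; split=> //.
  + by do ?apply: same_upd.
  + by move=> j lj; rewrite /upd /= mD // /digit div0n mod0n.
Qed.

End Search.

Section Order.
Variables (m : store) (N t : nat).
Hypotheses (envm : env m) (mN : m Nv 0 = N) (lN : N <= n) (mt : m tv 0 = t)
  (lt_t : t < N).
Let x := mkseq (m Xa) N.
Hypotheses (ux : uniq x) (lx : all (ltn^~ n) x)
  (mM : forall v, v < n -> m Ma v = (v \in x)).
Let O := [seq v <- iota 0 n | v \notin x].
Let y := insert x t O.
Hypotheses (size_y : size y = n) (uniq_y : uniq y) (ly : all (ltn^~ n) y).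
Let mods := [:: cv; Jv; Iv; Ya].

Lemma order_runs : runs order_prog m (800 * (n * n) + 1000 * n + 800) (fun m' =>
  [/\ m' 2 0 = 1, m' 2 1 = nth 0 y 0 &
     forall j, j < n -> m' 3 (nth 0 y j) = nth 0 y (par (seq_adj g y) j)]).
Proof.
have sx : size x = N by rewrite size_mkseq.
have xE j : j < N -> nth 0 x j = m Xa j by move=> lj; rewrite nth_mkseq.
have lxn j : j < N -> m Xa j < n by move=> lj; rewrite -xE //; apply/(allP lx)/mem_nth; rewrite sx.
have y_nth j : j < n -> nth 0 y j < n by move=> lj; apply/(allP ly)/mem_nth; rewrite size_y.
have l_sO i : size [seq v <- iota 0 i | v \notin x] <= i.
  by rewrite size_filter -{2}(size_iota 0 i) count_size.
have sO : N + size O = n.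
  have := size_y; rewrite !size_cat size_takel ?size_drop sx; last exact: ltnW.
  by rewrite addnCA subnKC ?(ltnW lt_t) // addnC.
(* [pre j] is the content of [Ya] before iteration [j], and [mid j] that just before the [j]-th
   entry of [x] is appended; they differ only at the place. *)
pose pre j := take (minn j t) x ++ (if t < j then O else [::]) ++ drop t (take j x).
pose mid j := take (minn j t) x ++ (if t <= j then O else [::]) ++ drop t (take j x).
have s_take j : j <= N -> size (take j x) = j by move=> lj; rewrite size_takel ?sx.
have drop0 j : j <= t -> drop t (take j x) = [::].
  move=> lj; apply: drop_oversize; rewrite s_take //; exact: leq_trans lj (ltnW lt_t).
have pre_mid j : j < N -> j != t -> mid j = pre j.
  by move=> lj ne; rewrite /mid /pre leq_eqVlt eq_sym (negbTE ne).
have pre_t : pre t = take t x /\ mid t = take t x ++ O.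
  by rewrite /pre /mid ltnn leqnn minnn drop0 ?cats0.
have pre_S j : j < N -> pre j.+1 = rcons (mid j) (m Xa j).
  move=> lj; rewrite /pre /mid ltnS (take_nth 0) ?sx // xE // !rcons_cat.
  have [ltj|ljt] := leqP t j; last first.
    rewrite (minn_idPl ljt) (drop0 _ (ltnW ljt)) drop_oversize; last first.
      by rewrite size_rcons s_take // ltnW.
    by rewrite /= cats0 (take_nth 0) ?sx // xE // -cats1.
  by rewrite (minn_idPr (leqW ltj)) drop_rcons ?s_take ?(ltnW lj).
have size_mid j : j <= N -> size (mid j) <= n.
  move=> lj; rewrite !size_cat size_drop !s_take //; last first.
    exact: leq_trans (geq_minl _ _) lj.
  have [ltj|ljt] := leqP t j; rewrite /= -[X in _ <= X]sO.
    by rewrite addnCA subnKC // addnC leq_add2r.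
  by apply: leq_trans (leq_addr _ _); rewrite add0n; move: ljt lj; nlia.
have pre_N : pre N = y.
  by rewrite /pre lt_t (minn_idPr (ltnW lt_t)) [take N x]take_oversize ?sx.
rseq 10; rput => /=; first by ix.
rseq (200 * (n * n) + 300 * n + 100).
have lNn : N * (100 * n + 200) <= n * (100 * n + 200) by rewrite leq_mul2r lN orbT.
pose I0 j (m' : store) := [/\ same mods m m' & holds Ya cv (pre j) m'].
rfor N (100 * n + 170) I0.
- by move=> j m' lj Ej [sm _] /=; rewrite space_gt0 sm.
- split; first by do ?apply: same_upd.
  by rewrite /pre min0n take0 ltn0.
- move=> j m' lj Ej [sm hY].
  have [E0 E1 E2] := same_env sm isT isT envm.
  have Et : m' tv 0 = t by rewrite sm.
  have lXj := lxn j lj.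
  rseq (90 * n + 80).
    suff post : runs (If ($Jv == $tv) (for_loop Iv $0 (If Ma!!$Iv Skip (push_prog Ya cv $Iv))) Skip)%prog
        m' (90 * n + 80) (fun m1 => [/\ same mods m m1, m1 Jv 0 = j & holds Ya cv (mid j) m1]).
      apply: runs_weaken post => // m1 [sm1 Ej1 hY1].
      have XE : m1 Xa j = m Xa j by rewrite sm1.
      apply: (push_runs (s := mid j) (v := m Xa j)) => //=; rewrite ?Ej1 ?XE //.
      + by ix.
      + by nlia.
      + by apply/size_mid/ltnW.
      + exact: ltnW.
      move=> m2 hY2 sm2; split; first by rewrite sm2.
      split; last by rewrite pre_S.
      apply: same_upd => //; apply: same_trans sm1 sm2 => //.
      by move=> a; rewrite !inE; case/orP => ->; rewrite ?orbT.
    rif => /=; rewrite ?Ej ?Et; first by ix.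
    + case: (j =P t) => [Ejt _|//]; rewrite Ejt in hY *; rewrite pre_t.1 in hY.
      pose I1 i (m1 : store) := [/\ same mods m m1, m1 Jv 0 = t &
        holds Ya cv (take t x ++ [seq v <- iota 0 i | v \notin x]) m1].
      rfor n 60 I1.
      * move=> i m1 li Ei [sm1 _ _] /=.
        have [F0 _ _] := same_env sm1 isT isT envm.
        by rewrite space_gt0 F0.
      * by split=> //; [do ?apply: same_upd | rewrite /upd /= -Ejt | rewrite cats0].
      * move=> i m1 li Ei [sm1 Ej1 hY1].
        have Mi : m1 Ma i = (i \in x) by rewrite sm1 // mM.
        rif => /=; rewrite ?Ei; first by ix.
        - rewrite Mi => xi; rskip; split=> //; split=> //; first by do ?apply: same_upd.
          by rewrite iotaS filter_rcons; case: (i \in x) xi.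
        - rewrite Mi => nxi.
          apply: (push_runs (s := take t x ++ [seq v <- iota 0 i | v \notin x]) (v := i)) => //=.
          + rewrite size_cat s_take ?(ltnW lt_t) //.
            rewrite -[X in _ <= X]sO; apply: leq_add; first exact: ltnW.
            rewrite /O !size_filter -(subnKC (ltnW li)) iotaD count_cat.
            exact: leq_addr.
          + exact: ltnW.
          move=> m2 hY2 sm2; split; first by rewrite sm2.
          split.
          + apply: same_upd => //; apply: same_trans sm1 sm2 => //.
            by move=> a; rewrite !inE; case/orP => ->; rewrite ?orbT.
          + by rewrite /upd /= sm2.
          + rewrite iotaS filter_rcons; case: (i \in x) nxi => //= _.
            by rewrite -rcons_cat.
      by move=> m1 _ [sm1 Ej1 hY1]; split=> //; rewrite pre_t.2.
    + case: (j =P t) => [//|ne _]; rskip; split=> //.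
      by rewrite pre_mid //; apply/eqP.
move=> m1 _ [sm1]; rewrite pre_N => -[_ hY]; rewrite size_y in hY.
rseq (60 * n + 50).
pose mods1 := [:: cv; Jv; Iv; Ya; Xa].
pose I2 j (m' : store) := [/\ same mods1 m m', forall i, i < n -> m' Ya i = nth 0 y i &
  forall i, i < j -> m' Xa i = nth 0 y i].
rfor n 30 I2.
- move=> j m' lj Ej [sm _ _] /=; have [E0 _ _] := same_env sm isT isT envm.
  by rewrite space_gt0 E0.
- have sm1' : same mods1 m m1.
    by move=> a na; apply: sm1; apply: contra na; rewrite !inE; do ?[case/orP] => ->; rewrite ?orbT.
  by split=> //; do ?apply: same_upd.
- move=> j m' lj Ej [sm Yi Xi]; have := y_nth j lj => lyj.
  rput => /=; rewrite ?Ej ?Yi //; first by ix.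
  split=> //; split=> //; first by do ?apply: same_upd.
  by move=> i; rewrite ltnS leq_eqVlt /upd /=; case: eqP => [->//|_ /Xi].
move=> m2 _ [sm2 _ X2].
have [E20 _ _] := same_env sm2 isT isT envm.
rseq 10; rput => /=; rewrite ?E20; first by ix.
set m3 := upd m2 _ _ _; have env3 : env m3.
  have [H0 H1 H2] := same_env sm2 isT isT envm.
  by split.
have X3 j : j < n -> m3 Xa j = nth 0 y j by exact: X2.
have lX3 j : j < n -> m3 Xa j < n by move=> lj; rewrite X3 // y_nth.
rseq (200 * (n * n) + 200 * n + 200).
apply: runs_weaken (tree_runs env3 (leqnn n) _ lX3) => //.
move=> m4 [sm4 P4 _].
have X4 j : j < n -> m4 Xa j = nth 0 y j by move=> lj; rewrite sm4 // X3.
have lX4 j : j < n -> m4 Xa j < n by move=> lj; rewrite X4 // y_nth.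
have X4_inj i j : i < n -> j < n -> m4 Xa i = m4 Xa j -> i = j.
  by move=> li lj; rewrite !X4 // => /eqP; rewrite nth_uniq ?size_y // => /eqP.
have P4' j : j < n -> m4 Pa j = par (seq_adj g y) j.
  move=> lj; rewrite P4 //; apply: (par_ext (N := n)) => // a b lab.
  by rewrite /seq_adj !X3 //; lia.
have lP4 j : j < n -> m4 Pa j < n.
  by move=> lj; rewrite P4' //; apply: leq_ltn_trans (par_le _ _) lj.
have env4 : env m4 by exact: same_env sm4 isT isT env3.
apply: runs_weaken (output_runs env4 lX4 X4_inj lP4); first by nlia.
move=> m' [m20 m21 m3']; split=> //; first by rewrite m21 X4.
move=> j lj; rewrite -{1}X4 // m3' // P4' // X4 //.
exact: leq_ltn_trans (par_le _ _) lj.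
Qed.
End Order.

(** * Correctness of the whole program *)

Section Main.
Hypotheses (connG : connected_graph G) (chG : chordal G) (k_gt0 : 0 < k).

Definition solved (m : store) : Prop :=
  answers m (MinHLT G <= n - k) /\
  (MinHLT G <= n - k -> exists T : rtree 'I_n,
     [/\ dfs_tree G T, height T <= n - k & returns_tree m T]).

Lemma env_input : env (input G k).
Proof. by split=> // a b la lb; apply: input_adj. Qed.

Definition treed (X : nat -> nat) (m : store) : Prop :=
  let e := fun i j => g (X i) (X j) in
  [/\ env m, forall j, m Xa j = X j, forall j, j < n -> m Pa j = par e j &
     forall i j, i < n -> j < n -> m Aa (i * n + j) = anc e i j].

(** Stated with a continuation [c], as both searches start this way but proceed differently. *)
Lemma mcs_tree_runs (B : pred nat) m T (Q : store -> Prop) (c : cmd) :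
    env m -> (forall u, u < n -> m Ba u = B u) ->
    (forall u v, u < n -> v < n -> u != v -> B u -> B v -> g u v) ->
    600 * (n * n) + 700 * n + 600 <= T ->
    (forall X m', same [:: Nv; Xa; Va; Wa; Iv; Jv; Bv; Pa; Aa] m m' -> treed X m' ->
       (forall j, j < n -> X j < n) ->
       (forall i j, i < n -> j < n -> X i = X j -> i = j) ->
       (forall j u, j < n -> u < n -> fresh X j u ->
          weight g n B X j u <= weight g n B X j (X j)) ->
       runs c m' (T - (600 * (n * n) + 700 * n + 600)) Q) ->
  runs (mcs_prog ;; Nv @[#0] <- $0 ;; tree_prog ;; c)%prog m T Q.
Proof.
move=> envm mB B_clique le_T HQ.
rseq (300 * (n * n) + 400 * n + 300).
apply: runs_weaken (mcs_runs envm mB) => //.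
move=> m1 [sm1 lX X_inj X_max].
have [E0 E1 E2] := same_env sm1 isT isT envm.
rseq 10; rput => /=; rewrite ?E0; first by ix.
set m2 := upd _ _ _ _; have env2 : env m2 by split.
rseq (200 * (n * n) + 200 * n + 200).
apply: runs_weaken (tree_runs env2 (leqnn n) _ lX) => //.
move=> m3 [sm3 P3 A3]; have env3 := same_env sm3 isT isT env2.
apply: runs_weaken (HQ (m1 Xa) m3 _ _ lX X_inj X_max) => //; first by nlia.
- move=> a na i; rewrite sm3; last first.
    by apply: contra na; rewrite !inE; do ?[case/orP] => ->; rewrite ?orbT.
  rewrite /m2 /upd; case: eqP => [Ea|_] /=; first by rewrite Ea in na.
  by apply: sm1; apply: contra na; rewrite !inE; do ?[case/orP] => ->; rewrite ?orbT.
- by split=> // j; rewrite sm3.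
Qed.

Lemma finish_runs X m : treed X m -> (forall j, j < n -> X j < n) ->
    (forall i j, i < n -> j < n -> X i = X j -> i = j) -> k < n ->
    let e := fun i j => g (X i) (X j) in
    rooted e n -> dfs_order e n -> (forall j, j < n -> depth e n j <= n - k) ->
  runs output_prog m (60 * n + 100) solved.
Proof.
move=> [envm mX mP _] lX X_inj k_lt e re de he.
have lh : n - k < n by rewrite ltn_subrL k_gt0.
have [le_min ret] := order_tree n_gt0 lX X_inj lh re de he.
have lP j : j < n -> m Pa j < n.
  by move=> lj; rewrite mP //; apply: leq_ltn_trans (par_le _ _) lj.
apply: runs_weaken (output_runs envm _ _ lP) => //.
- move=> m' [m20 m21 m3]; split; first by rewrite /answers m20 le_min.
  move=> _; apply: ret; first by rewrite m21 mX.
  by move=> j lj; rewrite -!mX -mP // m3 // mX.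
- by move=> j lj; rewrite mX lX.
- by move=> i j li lj; rewrite !mX; apply: X_inj.
Qed.

Section Bag.
Variables (X : nat -> nat) (i0 : nat).
Hypotheses (lX : forall j, j < n -> X j < n)
  (X_inj : forall i j, i < n -> j < n -> X i = X j -> i = j) (lt_i0 : i0 < n).
Let e : rel nat := fun i j => g (X i) (X j).
Hypothesis (e_peo : peo e n).

(** The bag as a set of vertices: its description by positions depends on the first order, which the
    second search overwrites. *)
Definition in_bag (v : nat) : bool :=
  has (fun j => (X j == v) && bag e i0 j) (iota 0 n).

Lemma in_bagE j : j < n -> in_bag (X j) = bag e i0 j.
Proof.
move=> lj; apply/hasP/idP => [[i]|bj].
  by rewrite mem_iota => /andP[_ li] /andP[/eqP/X_inj <-].
by exists j; rewrite ?mem_iota // eqxx.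
Qed.

Lemma sum_in_bag : \sum_(u < n) in_bag u = \sum_(j < n) bag e i0 j.
Proof.
pose xo (j : 'I_n) : 'I_n := Ordinal (lX (ltn_ord j)).
have xo_inj : injective xo by move=> i j [] /X_inj Eij; apply/ord_inj/Eij.
by rewrite (reindex_inj xo_inj) /=; apply: eq_bigr => j _; rewrite in_bagE.
Qed.

(** Earlier neighbours of [i0] are pairwise adjacent by [e_peo]. *)
Lemma in_bag_clique u v : u < n -> v < n -> u != v -> in_bag u -> in_bag v -> g u v.
Proof.
move=> _ _ nuv /hasP[i]; rewrite mem_iota => /andP[_ li] /andP[/eqP Eu bi].
move=> /hasP[j]; rewrite mem_iota => /andP[_ lj] /andP[/eqP Ev bj].
rewrite -{}Eu -{}Ev in nuv *; have nij : i != j by apply: contraNneq nuv => ->.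
have e_sym : symmetric e by move=> a b; apply: gadj_sym.
case/orP: bi => [/eqP Ei|/andP[li0 ei]]; case/orP: bj => [/eqP Ej|/andP[lj0 ej]].
- by rewrite Ei Ej eqxx in nij.
- by rewrite Ei -/(e i0 j) e_sym.
- by rewrite Ej.
- case: (ltngtP i j) nij => // [lij|lji] _; first exact: (e_peo lij lj0).
  by rewrite -/(e i j) e_sym; apply: (e_peo lji li0).
Qed.

End Bag.

Lemma main_runs : runs main_prog (input G k) (main_cost n k) solved.
Proof.
have envI := env_input.
rewrite /main_cost; set CA := n * (_ + _); set CB := _ ^ _ * _.
have reps_le q : q < k.*2 -> reps_bound k q <= reps_max k.
  move=> lq; have lq2 : q <= 2 * k by rewrite mul2n ltnW.
  apply: leq_add => //; apply: leq_mul; first by lia.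
  by rewrite leq_pexp2l.
have leA q : q < k.*2 -> n * (reps_bound k q * (100 * q + 100) + 300) <= CA.
  move=> lq; rewrite leq_mul2l leq_add2r orbC leq_mul ?reps_le //.
  by rewrite leq_add2r; lia.
have leB q (s : seq nat) N : q < k.*2 -> N = minn n (5 * k + q) -> 0 < size s -> size s <= reps_bound k q ->
    size s ^ N.+1 * (search_cost n N + 10) <= CB.
  move=> lq -> s_gt0 s_le; have lN : minn n (5 * k + q) <= 7 * k.
    by apply: leq_trans (geq_minr _ _) _; lia.
  apply: leq_mul.
    apply: (@leq_trans (reps_max k ^ (minn n (5 * k + q)).+1)).
      by rewrite leq_exp2r // (leq_trans s_le) ?reps_le.
    by rewrite leq_pexp2l ?ltnS // (leq_trans s_gt0) // (leq_trans s_le) ?reps_le.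
  by rewrite leq_add2r search_cost_le.
(* Made opaque so that the remaining cost inequalities are linear in them. *)
clearbody CA CB.
apply: (runs_if Z_ge8 Z_bound space_gt0) => //=.
- by ix.
- by nlia.
- move=> lt_kn; have k_lt : k < n by case: (k < n) lt_kn.
  (* The bag array is still zero, so the first search has no preferred vertices. *)
  apply: (@mcs_tree_runs pred0) => //; first by nlia.
  move=> X m1 sm1 [env1 X1 P1 A1] lX X_inj X_max.
  set e := fun i j => g (X i) (X j) in P1 A1.
  have X0 (u v : nat) : u < n -> v < n -> u != v -> pred0 u -> pred0 v -> g u v by [].
  have pe : peo e n := greedy_peo n_gt0 chG lX X_inj X_max X0.
  have re : rooted e n := greedy_rooted n_gt0 connG lX X_inj X_max X0.
  rseq (300 * (n * n) + 400 * n + 300).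
  have eqe i j : anc (fun i j => g (m1 Xa i) (m1 Xa j)) i j = anc e i j.
    by apply: (anc_ext (N := (maxn i j).+1)) => [a b _|]; rewrite ?X1 // ltnS leq_maxr.
  apply: runs_weaken (center_runs env1 _ _ k_lt _ _) => //; last first.
  + by move=> i j li lj; rewrite eqe A1.
  + move=> j lj; rewrite (par_ext (N := n) (e' := e)); [exact: re | | lia].
    by move=> a b _; rewrite !X1.
  + by move=> i j li lj; rewrite !X1; apply: X_inj.
  + by move=> j lj; rewrite X1 lX.
  move=> m2 [i0 lt_i0 [sm2 large0 last0 bag2 b2]].
  have sizeE c : \sum_(j < n) anc (fun i j => g (m1 Xa i) (m1 Xa j)) c j =
                 \sum_(j < n) anc e c j by apply: eq_bigr => j _; rewrite eqe.
  have bagE j : bag (fun i j => g (m1 Xa i) (m1 Xa j)) i0 j = bag e i0 j.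
    by rewrite /bag /e !X1.
  have {}large0 : k < \sum_(j < n) anc e i0 j by rewrite -sizeE.
  have {}last0 c : i0 < c < n -> \sum_(j < n) anc e c j <= k.
    by move=> lc; rewrite -sizeE; apply: last0.
  pose B := in_bag X i0.
  have env2 : env m2 := same_env sm2 isT isT env1.
  have [f lf Xf] := surj_inv lX X_inj.
  have B2 u : u < n -> m2 Ba u = B u.
    move=> lu; have lfu := lf _ lu; rewrite -(Xf _ lu) -{1}X1 bag2 //.
    by rewrite bagE /B in_bagE.
  have Bcl : forall u v, u < n -> v < n -> u != v -> B u -> B v -> g u v.
    exact: in_bag_clique.
  have b2' : m2 bv 0 = \sum_(u < n) B u.
    rewrite b2 /B sum_in_bag //; apply: eq_bigr => j _; exact: congr1 (bagE _).
  set b := \sum_(u < n) B u in b2'.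
  have [F0 F1 F2] := env2.
  have lbn : b <= n.
    by rewrite -[X in _ <= X]card_ord -sum1_card; apply: leq_sum => u _; case: (B u).
  apply: (runs_if Z_ge8 Z_bound space_gt0) => //=; rewrite ?F0 ?F1 ?b2'.
  + by ix.
  + by nlia.
  + move=> lt_q; set q := n - b in lt_q; have {}lt_q : q < k.*2 by case: ltnP lt_q; lia.
    rseq (CA + 300 * n + 300).
    apply: runs_weaken (reps_runs env2 B2 b2' (leqnn _)) => //.
      by rewrite !leq_add2r; apply: leA.
    move=> m3 [sm3 q3 [s hU [us ls sR sB s_le]]].
    have env3 : env m3 := same_env sm3 isT isT env2.
    have [K0 K1 K2] := env3.
    have s_gt0 : 0 < size s.
      have [B0|nB0] := boolP (B 0); last by move: (sR 0 n_gt0 nB0); case: (s).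
      case: (sB 0 n_gt0 B0) => [|le_c]; first by case: (s).
      apply: leq_trans (leq_trans le_c (count_size _ _)).
      by rewrite addn_gt0 muln_gt0 k_gt0.
    have s_len : size s <= n.
      rewrite -(size_iota 0 n); apply: uniq_leq_size => // v /(allP ls).
      by rewrite mem_iota.
    rseq 20; rput => /=; rewrite ?K1 ?q3 -/b -/q; first by ix.
    pose N := minn n (5 * k + q).
    pose m4 := upd m3 Nv 0 N.
    apply: (@runs_seq _ _ _ _ _ _ 30); first by nlia.
    suff cont m5 : m5 Nv 0 = N -> same [:: Nv] m3 m5 ->
        runs (search_prog ;; If $kv order_prog Skip)%prog m5
          (CB + 800 * (n * n) + 1500 * n + 1500) solved.
      rif => /=; rewrite /upd /= ?K0; first by ix.
      * rewrite -/(q) => lt_n; rput => /=; first by rewrite /upd /= ?K0; ix.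
        apply: runs_weaken (cont _ _ _); [by nlia | by [] | | by do ?apply: same_upd].
        by rewrite /upd /= K0 /N; case: ltnP lt_n; lia.
      * move=> le_n; rskip; apply: runs_weaken (cont _ _ _); [by nlia | by [] | | by do ?apply: same_upd].
        by rewrite /upd /= /N; case: ltnP le_n; lia.
    move=> N5 sm5; have env5 : env m5 := same_env sm5 isT isT env3.
    have B5 u : u < n -> m5 Ba u = B u by move=> lu; rewrite sm5 // sm3 // B2.
    have hU5 : holds Ua uv s m5.
      by case: hU => h1 h2; split=> [|i li]; rewrite sm5 // h2.
    have D5 j : j <= N -> m5 Da j = 0.
      (* The digit array has not been written yet; its zeros spell candidate 0. *)
      by move=> _; rewrite sm5 // sm3 // sm2 // sm1.
    have N_gt0 : 0 < N by rewrite /N; lia.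
    have lN : N <= n by apply: geq_minl.
    rseq (CB + 100).
    apply: runs_weaken (search_runs env5 B5 N5 N_gt0 lN hU5 ls s_gt0 s_len D5).
      by have := leB _ s N lt_q erefl s_gt0 s_le; nlia.
    move=> m6 [sm6 res]; have env6 : env m6 := same_env sm6 isT isT env5.
    case: res => [[k6 fails]|[k6 lx lt_t ck M6]].
      rif => /=; rewrite ?k6; [by ix | by [] | move=> _].
      rskip; have no : ~~ (MinHLT G <= n - k).
        apply/negP => le_min.
        have [c lc] := search_complete n_gt0 k_gt0 k_lt Bcl lt_q us ls sR sB le_min.
        by move/negP: (fails c lc).
      split; last by move=> yes; rewrite yes in no.
      by rewrite /answers (negbTE no) sm6 // sm5 // sm3 // sm2 // sm1.
    rif => /=; rewrite ?k6; [by ix | move=> _ | by []].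
    have sx : size (mkseq (m6 Xa) N) = N by rewrite size_mkseq.
    have N6 : m6 Nv 0 = N by rewrite sm6.
    have kN : k <= N by rewrite /N; lia.
    have lt_t' : m6 tv 0 < size (mkseq (m6 Xa) N) by rewrite sx.
    have kN' : k <= size (mkseq (m6 Xa) N) by rewrite sx.
    have [sy uy ly vy] := insert_order n_gt0 lx lt_t' kN' Bcl ck.
    have [ux _ _] := elimT (checkP k g B lt_t' lx) ck.
    apply: runs_weaken (order_runs env6 N6 lN erefl lt_t ux lx M6 sy uy ly); first by nlia.
    set y := insert _ _ _ in sy uy ly vy *.
    have y_lt j : j < n -> nth 0 y j < n.
      by move=> lj; apply/(allP ly)/mem_nth; rewrite sy.
    have y_inj i j : i < n -> j < n -> nth 0 y i = nth 0 y j -> i = j.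
      by move=> li lj /eqP; rewrite nth_uniq ?sy // => /eqP.
    have lh : n - k < n by rewrite ltn_subrL k_gt0.
    have [ry dy hy] : [/\ rooted (seq_adj g y) n, dfs_order (seq_adj g y) n &
        forall j, j < n -> depth (seq_adj g y) n j <= n - k].
      by have := valid_rooted vy; have := valid_dfs vy; have := valid_depth vy; rewrite sy.
    have [le_min ret] := order_tree n_gt0 y_lt y_inj lh ry dy hy.
    move=> m7 [m20 m21 m3']; split; first by rewrite /answers m20 le_min.
    by move=> _; apply: ret.
  + move=> ge_q; have {}ge_q : k.*2 + b <= n by move: ge_q; case: ltnP; lia.
    apply: (mcs_tree_runs env2 B2 Bcl); first by nlia.
    move=> X2 m3 sm3 tr2 lX2 X2_inj X2_max.
    have pe2 := greedy_peo n_gt0 chG lX2 X2_inj X2_max Bcl.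
    have re2 := greedy_rooted n_gt0 connG lX2 X2_inj X2_max Bcl.
    apply: runs_weaken (finish_runs tr2 lX2 X2_inj k_lt re2 (peo_dfs pe2) _) => //.
      by nlia.
    (* Position in the first order of the [j]-th vertex of the second. *)
    pose f2 j := f (X2 j).
    have Xf2 j : j < n -> X (f2 j) = X2 j by move=> lj; rewrite /f2 Xf ?lX2.
    have lf2 j : j < n -> f2 j < n by move=> lj; apply/lf/lX2.
    have f2_inj i j : i < n -> j < n -> f2 i = f2 j -> i = j.
      by move=> li lj Eij; apply: X2_inj; rewrite // -!Xf2 // Eij.
    have f2_bag i j : i < j < n -> bag e i0 (f2 j) -> bag e i0 (f2 i).
      move=> /andP[lij lj]; have li := ltn_trans lij lj.
      rewrite -!(in_bagE (X := X)) ?lf2 // !Xf2 //.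
      by apply: (bag_first lX2 X2_inj X2_max); rewrite lij.
    have e_sym : symmetric e by move=> a c; apply: gadj_sym.
    have sm_bag : k.*2 + \sum_(i < n) bag e i0 i <= n by rewrite -sum_in_bag.
    move=> j lj.
    have := prefix_depth e_sym pe lt_i0 lf2 f2_inj f2_bag large0 last0 sm_bag lj.
    rewrite (depth_ext (N := n) (e' := fun i j => g (X2 i) (X2 j))) //.
    by move=> a c /andP[lac lc]; rewrite /e !Xf2 //; apply: ltn_trans lc.
(* For [k >= n] the answer is no, as the root alone has level 1, and the answer cell is initially
   0. *)
- move=> ge_kn; have {}ge_kn : n - k = 0.
    by apply/eqP; rewrite subn_eq0 leqNgt; case: (k < n) ge_kn.
  rskip; have no : ~~ (MinHLT G <= n - k).
    rewrite ge_kn; apply/(MinHLT_leP G (h := 0)); first by rewrite card_ord.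
    case=> T dT; rewrite leqNgt => /negP[]; apply: leq_trans (level_height dT (root T)).
    by apply/card_gt0P; exists (root T); rewrite inE ancestor_refl.
  by split=> [|yes]; [rewrite /answers (negbTE no) | rewrite yes in no].
Qed.

End Main.
End Programs.

(** * Arithmetic of the running time *)

Section Cost.
Variable k : nat.
Hypothesis k_gt0 : 0 < k.
Let K := k ^ 2.

Lemma k_le_pow : k <= 2 ^ k. Proof. exact/ltnW/ltn_expl. Qed.

Lemma reps_max_le : reps_max k <= 2 ^ (7 * k).
Proof.
have le1 : 2 * k <= 2 ^ (6 * k).
  apply: leq_trans (_ : 2 ^ 1 * 2 ^ k <= _); first by rewrite leq_mul2l k_le_pow.
  by rewrite -expnD leq_pexp2l //; lia.
have le2 : 7 * k * 2 ^ (2 * k) <= 2 ^ (6 * k).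
  apply: leq_trans (_ : 2 ^ 3 * 2 ^ k * 2 ^ (2 * k) <= _).
    by rewrite leq_mul2r leq_mul ?k_le_pow ?orbT.
  by rewrite -!expnD leq_pexp2l //; lia.
apply: leq_trans (_ : 2 ^ 1 * 2 ^ (6 * k) <= _).
  by rewrite expn1 mul2n -addnn leq_add.
by rewrite -expnD leq_pexp2l //; lia.
Qed.

Lemma leq_kK : k <= K. Proof. by rewrite /K expnS expn1 leq_pmull. Qed.

Let K_gt0 : 0 < K. Proof. exact: leq_trans k_gt0 leq_kK. Qed.

(** With this and the next two facts, bounds [2 ^ (a * K)] are combined through [a] alone: a sum
    costs one more than the larger exponent, a product adds them. *)
Let const a b x : x <= 2 ^ a -> a <= b -> x <= 2 ^ (b * K).
Proof.
move=> le_x le_ab; apply: leq_trans le_x _; rewrite leq_pexp2l //.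
exact: leq_trans le_ab (leq_pmulr _ K_gt0).
Qed.

Let add a b c x y : x <= 2 ^ (a * K) -> y <= 2 ^ (b * K) -> b <= a < c ->
  x + y <= 2 ^ (c * K).
Proof.
move=> le_x le_y /andP[le_ba lt_ac].
apply: leq_trans (_ : 2 ^ 1 * 2 ^ (a * K) <= _).
  rewrite expn1 mul2n -addnn leq_add // (leq_trans le_y) // leq_pexp2l //.
  by rewrite leq_mul2r le_ba orbT.
rewrite -expnD leq_pexp2l // (leq_trans (_ : _ <= a.+1 * K)) ?leq_mul2r ?lt_ac ?orbT //.
by rewrite mulSn leq_add2r.
Qed.

Let mul a b c x y : x <= 2 ^ (a * K) -> y <= 2 ^ (b * K) -> a + b <= c ->
  x * y <= 2 ^ (c * K).
Proof.
move=> le_x le_y le_c; apply: leq_trans (leq_mul le_x le_y) _.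
by rewrite -expnD leq_pexp2l // -mulnDl leq_mul2r le_c orbT.
Qed.

Let K_le : K <= 2 ^ (1 * K). Proof. by rewrite mul1n; apply/ltnW/ltn_expl. Qed.

Let k_le : k <= 2 ^ (1 * K). Proof. exact: leq_trans leq_kK K_le. Qed.

Lemma main_cost_le n : 0 < n -> main_cost n k <= 4 * 5000 * n ^ 2 + 2 ^ (160 * K).
Proof.
move=> n_gt0; rewrite /main_cost /search_cost.
set R := reps_max k; set P := R ^ _.
have R_le : R <= 2 ^ (7 * K).
  by apply: leq_trans reps_max_le _; rewrite leq_pexp2l // leq_mul2l leq_kK.
(* The exponent is [7 k (7 k + 1) <= 56 k^2]. *)
have P_le : P <= 2 ^ (56 * K).
  apply: leq_trans (_ : (2 ^ (7 * k)) ^ (7 * k).+1 <= _).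
    by rewrite leq_exp2r // reps_max_le.
  by rewrite -expnM leq_pexp2l // /K expnS expn1; nia.
pose A := R * (200 * k + 100) + 300.
have A_le : A <= 2 ^ (20 * K).
  apply: (@add 19 10) => //; last exact: (@const 9).
  apply: (@mul 7 12) => //; apply: (@add 10 8) => //; last exact: (@const 7).
  by apply: (@mul 9 1) => //; apply: (@const 8).
pose W := A + P * (3500 * k + 1000).
have W_le : W <= 2 ^ (72 * K).
  rewrite /W addnC; apply: (@add 71 20) => //.
  apply: (@mul 56 15) => //; apply: (@add 13 10) => //; last exact: (@const 10).
  by apply: (@mul 12 1) => //; apply: (@const 12).
pose C := 500 * (7 * k * (7 * k)) + 1200 * (7 * k) + 1610.
have le7 : 7 * k <= 2 ^ (4 * K) by apply: (@mul 3 1) => //; apply: (@const 3).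
have C_le : C <= 2 ^ (20 * K).
  apply: (@add 19 11) => //; last exact: (@const 11).
  apply: (@add 18 15) => //.
    by apply: (@mul 9 8) => //; [apply: (@const 9) | apply: (@mul 4 4)].
  by apply: (@mul 11 4) => //; apply: (@const 11).
have WW_le : W * W <= 2 ^ (144 * K) by apply: (@mul 72 72).
have PC_le : P * C <= 2 ^ (76 * K) by apply: (@mul 56 20).
have sum_le : W * W + P * C <= 2 ^ (145 * K) by apply: (@add 144 76).
(* Compare [n] with [W]; this separates the mixed term, at the price of doubling the exponent 72. *)
have nW : n * W <= n * n + W * W.
  have [le_nW|lt_Wn] := leqP n W; first by apply: leq_trans (leq_addl _ _); rewrite leq_mul2r le_nW orbT.
  by apply: leq_trans (leq_addr _ _); rewrite leq_mul2l ltnW // orbT.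
have pow_le : 2 ^ (145 * K) <= 2 ^ (160 * K) by rewrite leq_pexp2l // leq_mul2r orbT.
have le_nn : n <= n * n by rewrite leq_pmull.
have E : n * A + P * (500 * (7 * k * (7 * k)) + 500 * (n * (7 * k)) + 1000 * n +
    1200 * (7 * k) + 1600 + 10) = n * W + P * C.
  by rewrite /W /C; move: (A) (P) => a p; lia.
have n2 : n ^ 2 = n * n by rewrite expnS expn1.
rewrite -/A -addnA E n2.
move: (n * W) (P * C) (W * W) (2 ^ (145 * K)) (2 ^ (160 * K)) (n * n) sum_le nW pow_le le_nn.
move=> a b c d e nn; lia.
Qed.

End Cost.

Theorem theorem12 :
  exists (P : cmd) (w s c d : nat),
  forall (n : nat) (G : sgraph 'I_n) (k : nat),
    connected_graph G -> chordal G -> 0 < k ->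
    exists (t : nat) (m : store),
      [/\ exec ((n + k) ^ w) (s * n ^ 2) P (input G k) t m,
          t <= c * n ^ 2 + 2 ^ (d * k ^ 2),
          answers m (MinHLT G <= n - k) &
          MinHLT G <= n - k ->
          exists T : rtree 'I_n,
            [/\ dfs_tree G T, height T <= n - k & returns_tree m T]].
Proof.
(* Memory contents stay below [Z = (n + k) ^ 6], so values reach at most [Z ^ 30 = (n + k) ^ 180];
   one more factor makes the bound strict. [4 n^2] exceeds [n^2 + 2 n], enough for an index into a
   matrix. *)
exists main_prog, 181, 4, (4 * 5000), 160 => n G k connG chG k_gt0.
have n_gt0 : 0 < n by case: connG; rewrite card_ord.
pose Z := (n + k) ^ 6.
have nk_gt1 : 1 < n + k by lia.
have Z_big : n * n + 2 * n + 20 * k + 20 <= Z.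
  have p4 : 2 ^ 4 <= (n + k) ^ 4 by rewrite leq_exp2r.
  have -> : Z = (n + k) ^ 4 * ((n + k) * (n + k)) by rewrite /Z -[6]/(4 + 2) expnD.
  apply: leq_trans (_ : 2 ^ 4 * ((n + k) * (n + k)) <= _); last by rewrite leq_mul2r p4 orbT.
  by rewrite -[2 ^ 4]/16; nia.
have Z_bound : wide Z ((n + k) ^ 181) by rewrite /wide /Z -expnM ltn_exp2l.
have space_big : n * n + n + n < 4 * n ^ 2 by rewrite expnS expn1; nia.
have bounded_input : bounded Z (input G k).
  have leZ x : x <= n + k -> x <= Z by move=> le_x; nia.
  have le1 (b : bool) : b <= Z by apply: leZ; case: b; lia.
  by move=> [|[|a]] [|[|i]] //=; rewrite ?le1 //; apply: leZ; rewrite ?leq_addr ?leq_addl.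
have [t [m [ex le_t _ [ans ret]]]] :=
  main_runs n_gt0 Z_big Z_bound space_big connG chG k_gt0 bounded_input.
exists t, m; split=> //.
exact: leq_trans le_t (main_cost_le k_gt0 n_gt0).
Qed.
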